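(* Let $q>64$ be a prime power, $E$ an elliptic curve over $\mathbb{F}_q$, and $D=\{P_1,\dots,P_n\}\subseteq E(\mathbb{F}_q)$ a set of $n\ge q+2$ rational points. Let $k$ be an integer with $3<k<q-1$ and let $G'$ be a divisor on $E$ of degree $k$ with support disjoint from $D$. Then the elliptic curve code $C_{\mathscr{L}}(D,G')$ (an $[n,k]$ code) has minimum distance exactly $n-k$.
   Context: For a divisor $V$ on $E$, $\mathscr{L}(V)$ is the $\mathbb{F}_q$-vector space of rational functions $f\in\mathbb{F}_q(E)$ with $\mathrm{div}(f)\ge -V$, together with $0$; for $\deg V=k>0$ it has dimension $k$. The code $C_{\mathscr{L}}(D,V)$ is the image of the evaluation map $\mathscr{L}(V)\to\mathbb{F}_q^n$, $f\mapsto(f(P_1),\dots,f(P_n))$. The minimum distance is the minimum Hamming weight of a nonzero codeword. *)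

(* Defs.v *)
From HB Require Import structures.
From mathcomp Require Import all_boot all_order all_algebra all_field.
From mathcomp Require Import mpoly.
Set Implicit Arguments. Unset Strict Implicit. Unset Printing Implicit Defensive.
Import Order.TTheory GRing.Theory.
Local Open Scope ring_scope.

Definition X0 {R : nzRingType} : {mpoly R[3]} := 'X_(@Ordinal 3 0 isT).
Definition X1 {R : nzRingType} : {mpoly R[3]} := 'X_(@Ordinal 3 1 isT).
Definition X2 {R : nzRingType} : {mpoly R[3]} := 'X_(@Ordinal 3 2 isT).

Definition weierstrass {R : comNzRingType} (a1 a2 a3 a4 a6 : R) : {mpoly R[3]} :=
  X1 ^+ 2 * X2 + a1%:MP * X0 * X1 * X2 + a3%:MP * X1 * X2 ^+ 2
  - X0 ^+ 3 - a2%:MP * X0 ^+ 2 * X2 - a4%:MP * X0 * X2 ^+ 2 - a6%:MP * X2 ^+ 3.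

Definition wdisc {R : comNzRingType} (a1 a2 a3 a4 a6 : R) : R :=
  let b2 := a1 ^+ 2 + 4%:R * a2 in
  let b4 := 2%:R * a4 + a1 * a3 in
  let b6 := a3 ^+ 2 + 4%:R * a6 in
  let b8 := a1 ^+ 2 * a6 + 4%:R * a2 * a6 - a1 * a3 * a4 + a2 * a3 ^+ 2 - a4 ^+ 2 in
  - b2 ^+ 2 * b8 - 8%:R * b4 ^+ 3 - 27%:R * b6 ^+ 2 + 9%:R * b2 * b4 * b6.

(* Points of the projective plane curve over a field K, in normalized form:
   Some (x, y) is the affine point (x : y : 1), None is (0 : 1 : 0), the
   unique point at infinity of a Weierstrass cubic. *)
Definition pt (K : Type) := option (K * K)%type.

Definition pcoord {K : nzRingType} (P : pt K) : 'I_3 -> K :=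
  fun i => match P with
           | Some (x, y) => nth 0 [:: x; y; 1] i
           | None => nth 0 [:: 0; 1; 0] i
           end.

Definition onCurve {K : comNzRingType} (W : {mpoly K[3]}) (P : pt K) : bool :=
  W.@[pcoord P] == 0.

Definition dvdW {K : comNzRingType} (W T : {mpoly K[3]}) : Prop :=
  exists Q : {mpoly K[3]}, T = Q * W.

Definition mult_ge {K : comNzRingType} (T : {mpoly K[3]}) (p : 'I_3 -> K)
  (m : nat) : Prop :=
  forall mm : 'X_{1..3}, (mdeg mm < m)%N ->
    (T \mPo [tuple ('X_i + (p i)%:MP) | i < 3])@_mm = 0.

(* For a homogeneous form T, "ord_P (T / l^deg T) >= m" on the curve W = 0,
   l a linear form not vanishing at P: T * B lies in I_P^m + (W) for some
   form B with B(P) <> 0 (so that B/l^deg B is a unit of the local ring O_P). *)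
Definition ord_ge {K : comNzRingType} (W : {mpoly K[3]}) (P : pt K)
  (T : {mpoly K[3]}) (m : nat) : Prop :=
  exists (B C : {mpoly K[3]}) (e d : nat),
    B \is e.-homog /\ B.@[pcoord P] != 0 /\
    (T * B - C * W) \is d.-homog /\ mult_ge (T * B - C * W) (pcoord P) m.

Definition ord_geZ {K : comNzRingType} (W : {mpoly K[3]}) (P : pt K)
  (T : {mpoly K[3]}) (z : int) : Prop :=
  match z with Posz m => ord_ge W P T m | Negz _ => True end.

Definition ratfun {F : fieldType} (W : {mpoly F[3]}) (G H : {mpoly F[3]}) : Prop :=
  exists d : nat, G \is d.-homog /\ H \is d.-homog /\ ~ dvdW W H.

(* divisors on E over F, represented as Galois (Frobenius) invariant divisors
   on E(L) for an algebraically closed extension iota : F -> L; [s] is a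
   duplicate-free list containing the support. *)
Definition frob_pt {L : nzRingType} (q : nat) (P : pt L) : pt L :=
  match P with Some (x, y) => Some (x ^+ q, y ^+ q) | None => None end.

Definition map_pt {F L : nzRingType} (iota : F -> L) (P : pt F) : pt L :=
  match P with Some (x, y) => Some (iota x, iota y) | None => None end.

Definition is_divisor {F : finFieldType} {L : closedFieldType}
  (iota : {rmorphism F -> L}) (W : {mpoly F[3]}) (V : pt L -> int)
  (s : seq (pt L)) : Prop :=
  [/\ uniq s, (forall P, V P != 0 -> P \in s),
      (forall P, V P != 0 -> onCurve (map_mpoly iota W) P) &
      (forall P, V (frob_pt #|F| P) = V P)].

Definition divisor_deg {L : closedFieldType} (V : pt L -> int) (s : seq (pt L)) : int :=
  \sum_(P <- s) V P.

(* f = G/H lies in L(V): div(f) >= -V, i.e. ord_P(G) - ord_P(H) >= - V(P)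
   at every point P of E(L). *)
Definition inRR {F : finFieldType} {L : closedFieldType}
  (iota : {rmorphism F -> L}) (W : {mpoly F[3]}) (V : pt L -> int)
  (G H : {mpoly F[3]}) : Prop :=
  ratfun W G H /\
  forall P : pt L, onCurve (map_mpoly iota W) P ->
    forall m : nat, ord_ge (map_mpoly iota W) P (map_mpoly iota H) m ->
      ord_geZ (map_mpoly iota W) P (map_mpoly iota G) (m%:Z - V P).

Definition evalAt {F : fieldType} (W : {mpoly F[3]}) (G H : {mpoly F[3]})
  (P : pt F) (c : F) : Prop :=
  exists (G' H' : {mpoly F[3]}) (d : nat),
    G' \is d.-homog /\ H' \is d.-homog /\ dvdW W (G * H' - G' * H) /\
    H'.@[pcoord P] != 0 /\ G'.@[pcoord P] = c * H'.@[pcoord P].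

Definition in_code {F : finFieldType} {L : closedFieldType}
  (iota : {rmorphism F -> L}) (W : {mpoly F[3]}) (V : pt L -> int)
  (n : nat) (D : 'I_n -> pt F) (c : 'I_n -> F) : Prop :=
  exists G H : {mpoly F[3]}, inRR iota W V G H /\ forall i, evalAt W G H (D i) (c i).

Definition hweight {F : finFieldType} (n : nat) (c : 'I_n -> F) : nat :=
  #|[pred i | c i != 0]|.

Definition min_dist_eq {F : finFieldType} {L : closedFieldType}
  (iota : {rmorphism F -> L}) (W : {mpoly F[3]}) (V : pt L -> int)
  (n : nat) (D : 'I_n -> pt F) (d : nat) : Prop :=
  (exists c, in_code iota W V D c /\ (exists i, c i != 0) /\ hweight c = d) /\
  (forall c, in_code iota W V D c -> (exists i, c i != 0) -> (d <= hweight c)%N).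

(* Main.v *)
(** On the affine curve, the number of zeros of a function, counted with multiplicity,
    is the degree of its norm. Hence a form of degree [d] has exactly [3 d] zeros on
    the curve, a nonzero element of L(V) vanishes at no more than [k = deg V] points of
    [D], and every nonzero codeword has weight at least [n - k].

    For a codeword of weight [n - k] one needs [k] distinct points of [D] whose sum in
    E(F_q) is the sum of the divisor [V]. Counting the linear conditions imposed by
    zeros shows that every divisor of degree 1 is equivalent to a unique point; this
    gives both the group structure and the function with divisor
    [sum of the k points - V], which has coefficients in F_q because its normalised
    multiple is unique, hence fixed by Frobenius.

    The trivial bound |E(F_q)| <= 2 q + 1 already makes [D] contain more than half of
    the group, and in a finite abelian group every element is a sum of [k] distinct
    elements of such a subset: all but a bounded number of the summands are taken in
    pairs [a, x - a] with [x] fixed, so their total does not depend on the choice. *)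

Require Import Defs.
From Stdlib Require Import ClassicalEpsilon.
From HB Require Import structures.
From mathcomp Require Import all_boot all_order all_algebra all_field.
From mathcomp Require Import ring zify mpoly.
Set Implicit Arguments. Unset Strict Implicit. Unset Printing Implicit Defensive.
Import GRing.Theory.
Local Open Scope ring_scope.

(** * The affine coordinate ring of a Weierstrass curve *)

(** The definitions in the statement use homogeneous forms modulo [W] and all points over an
    algebraically closed field. The proof never builds a function field or a local ring. A function
    is a fraction of two elements of K[x] + K[x] y, and local identities are multiplied through by
    elements that do not vanish at the point. A form is studied through its restriction to X2 = 1;
    forms of one degree with the same restriction differ by a multiple of [W]. The order at infinity
    is read off the degree of the norm, so the affine zeros determine a principal divisor.

    Poles at affine points would leave the coordinate ring. They are avoided because x - x(P) has
    the zeros P and its conjugate: a point with negative coefficient is traded for its conjugate,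
    and every divisor becomes a list of points.

    For subset sums, one half is the natural threshold: a coset of a subgroup of index 2 contains
    half of the group, yet all sums of k of its elements lie in a single coset. The trivial bound
    leaves only the margin 2 n >= N + 3, where N is the order of the group, so the counting has to
    be tight. *)

Record wcoef (K : Type) := Wc { wa1 : K; wa2 : K; wa3 : K; wa4 : K; wa6 : K }.

(** The pair [(a, b)] stands for a(x) + b(x) y: the coordinate ring is free over K[x] with basis 1,
    y. The type does not depend on [E], which only selects the multiplication. *)
Definition crd (K : fieldType) (E : wcoef K) : Type := ({poly K} * {poly K})%type.

HB.instance Definition _ (K : fieldType) (E : wcoef K) :=
  GRing.Zmodule.copy (crd E) ({poly K} * {poly K})%type.

Section CoordinateRing.
Variables (K : fieldType) (E : wcoef K).
Implicit Types f g h : crd E.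

Definition wlin : {poly K} := wa1 E *: 'X + (wa3 E)%:P.
Definition wcub : {poly K} :=
  'X^3 + wa2 E *: 'X^2 + wa4 E *: 'X + (wa6 E)%:P.

Definition crd_one : crd E := (1, 0).
Definition crd_mul f g : crd E :=
  (f.1 * g.1 + f.2 * g.2 * wcub, f.1 * g.2 + f.2 * g.1 - f.2 * g.2 * wlin).

Lemma crd_mulA : associative crd_mul.
Proof. by case=> a b [c d] [e f]; congr pair => /=; ring. Qed.
Lemma crd_mulC : commutative crd_mul.
Proof. by case=> a b [c d]; congr pair => /=; ring. Qed.
Lemma crd_mul1 : left_id crd_one crd_mul.
Proof. by case=> a b; congr pair => /=; ring. Qed.
Lemma crd_mulDl : left_distributive crd_mul +%R.
Proof. by case=> a b [c d] [e f]; congr pair => /=; ring. Qed.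
Lemma crd_one_neq0 : crd_one != 0.
Proof. by apply/eqP=> -[/eqP]; rewrite oner_eq0. Qed.

HB.instance Definition _ := GRing.Zmodule_isComNzRing.Build (crd E)
  crd_mulA crd_mulC crd_mul1 crd_mulDl crd_one_neq0.

Lemma crdM f g : f * g =
  (f.1 * g.1 + f.2 * g.2 * wcub, f.1 * g.2 + f.2 * g.1 - f.2 * g.2 * wlin) :> crd E.
Proof. by []. Qed.

Lemma crd_eq0 f : (f == 0) = (f.1 == 0) && (f.2 == 0).
Proof. by case: f. Qed.

Definition px (p : {poly K}) : crd E := (p, 0).

Fact px_is_zmod_morphism : zmod_morphism px.
Proof. by move=> p q; congr pair; rewrite /= subr0. Qed.
Fact px_is_monoid_morphism : monoid_morphism px.
Proof. by split=> // p q; rewrite crdM; congr pair => /=; ring. Qed.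
HB.instance Definition _ :=
  GRing.isZmodMorphism.Build {poly K} (crd E) px px_is_zmod_morphism.
HB.instance Definition _ :=
  GRing.isMonoidMorphism.Build {poly K} (crd E) px px_is_monoid_morphism.

Definition cst (c : K) : crd E := px c%:P.
HB.instance Definition _ := GRing.RMorphism.copy cst (px \o polyC).

Definition xc : crd E := px 'X.
Definition yc : crd E := (0, 1).

Lemma crdE f : f = px f.1 + px f.2 * yc.
Proof. by case: f => a b; congr pair => /=; ring. Qed.

Lemma px_eq0 p : (px p == 0) = (p == 0).
Proof. by rewrite crd_eq0 eqxx andbT. Qed.

Lemma px_wlin : px wlin = cst (wa1 E) * xc + cst (wa3 E).
Proof. by rewrite /wlin -mul_polyC rmorphD rmorphM. Qed.

Lemma px_wcub : px wcub =
  xc ^+ 3 + cst (wa2 E) * xc ^+ 2 + cst (wa4 E) * xc + cst (wa6 E).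
Proof. by rewrite /wcub -!mul_polyC !rmorphD !rmorphM. Qed.

Lemma yc2 : yc * yc = xc ^+ 3 + cst (wa2 E) * xc ^+ 2 + cst (wa4 E) * xc
  + cst (wa6 E) - (cst (wa1 E) * xc + cst (wa3 E)) * yc.
Proof.
by rewrite -px_wcub -px_wlin !crdM; apply/eqP/andP; split; apply/eqP => /=; ring.
Qed.

(** The substitution y -> - y - a1 x - a3, that is, composition with negation on the curve. *)
Definition conj f : crd E := (f.1 - f.2 * wlin, - f.2).

Fact conj_is_zmod_morphism : zmod_morphism conj.
Proof. by move=> [a b] [c d]; congr pair => /=; ring. Qed.
Fact conj_is_monoid_morphism : monoid_morphism conj.
Proof.
split=> [|[a b] [c d]].
  by rewrite /conj /= mul0r subr0 oppr0.
by rewrite !crdM /conj /=; congr pair => /=; ring.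
Qed.
HB.instance Definition _ :=
  GRing.isZmodMorphism.Build (crd E) (crd E) conj conj_is_zmod_morphism.
HB.instance Definition _ :=
  GRing.isMonoidMorphism.Build (crd E) (crd E) conj conj_is_monoid_morphism.

Lemma conjK : involutive conj.
Proof. by case=> a b; congr pair => /=; ring. Qed.
Lemma conj_eq0 f : (conj f == 0) = (f == 0).
Proof. by rewrite -[RHS](inj_eq (inv_inj conjK)) raddf0. Qed.

Definition nrm f : {poly K} := f.1 ^+ 2 - f.1 * f.2 * wlin - f.2 ^+ 2 * wcub.

Lemma px_nrm f : px (nrm f) = f * conj f.
Proof. by case: f => a b; rewrite crdM /px /nrm; congr pair => /=; ring. Qed.

Lemma nrmM f g : nrm (f * g) = nrm f * nrm g.
Proof. case: f => a b; case: g => c d; rewrite crdM /nrm /=; ring. Qed.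

Lemma nrm_px p : nrm (px p) = p ^+ 2.
Proof. by rewrite /nrm /=; ring. Qed.

Lemma size_wlin : (size wlin <= 2)%N.
Proof.
rewrite /wlin (leq_trans (size_polyD _ _)) // geq_max.
rewrite (leq_trans (size_scale_leq _ _)) ?size_polyX //=.
by rewrite (leq_trans (size_polyC_leq1 _)).
Qed.

Lemma size_wcub : size wcub = 4%N.
Proof.
rewrite /wcub -!addrA size_polyDl size_polyXn // ltnS.
rewrite (leq_trans (size_polyD _ _)) // geq_max.
rewrite (leq_trans (size_scale_leq _ _)) ?size_polyXn //=.
rewrite (leq_trans (size_polyD _ _)) // geq_max.
rewrite (leq_trans (size_scale_leq _ _)) ?size_polyX //=.
by rewrite (leq_trans (size_polyC_leq1 _)).
Qed.

(* The two extreme terms of the norm have degrees of opposite parities and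
   the mixed term is strictly below their maximum. *)
Lemma size_nrm_eq f : f != 0 ->
  size (nrm f) = maxn ((size f.1).*2.-1) (if f.2 == 0 then 0%N else (size f.2).*2.+2).
Proof.
have sz2 (p : {poly K}) : size (p ^+ 2) = (size p).*2.-1.
  have [->|p0] := eqVneq p 0; first by rewrite expr0n /= size_poly0.
  by rewrite expr2 size_mul // addnn.
case: f => a b; rewrite crd_eq0 /nrm /= => ab.
have [b0|b0] := eqVneq b 0.
  by rewrite b0 mulr0 mul0r subr0 expr0n mul0r subr0 sz2 maxn0.
have wc0 : wcub != 0 by rewrite -size_poly_gt0 size_wcub.
have szb : size (b ^+ 2 * wcub) = (size b).*2.+2.
  rewrite size_mul ?expf_neq0 // sz2 size_wcub.
  by move: b0; rewrite -size_poly_gt0; lia.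
have [a0|a0] := eqVneq a 0.
  by rewrite a0 expr0n /= !mul0r subr0 sub0r size_polyN szb size_poly0 max0n.
have szab : (size (a * b * wlin)%R <= size a + size b)%N.
  rewrite (leq_trans (size_polyMleq _ _)) //.
  have := size_polyMleq a b; have := size_wlin.
  by move: a0 b0; rewrite -!size_poly_gt0; lia.
move: a0 b0; rewrite -!size_poly_gt0 => a0 b0.
case: (ltnP (size b).*2.+2 (size a).*2.-1) => hab.
  rewrite -addrA -opprD size_polyDl sz2; first by lia.
  rewrite size_polyN (leq_ltn_trans (size_polyD _ _)) // szb gtn_max hab andbT.
  by rewrite (leq_ltn_trans szab) //; lia.
rewrite addrC size_polyDl size_polyN szb; first by lia.
rewrite (leq_ltn_trans (size_polyD _ _)) // size_polyN sz2 gtn_max; apply/andP; split;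
  first by lia.
by rewrite (leq_ltn_trans szab) //; lia.
Qed.

Lemma nrm_eq0 f : (nrm f == 0) = (f == 0).
Proof.
apply/eqP/eqP=> [|->]; last by rewrite /nrm /=; ring.
move=> n0; apply/eqP/negPn/negP=> f0; have := size_nrm_eq f0.
rewrite n0 size_poly0; have [b0|b0] := eqVneq f.2 0; last by lia.
move: f0; rewrite crd_eq0 b0 eqxx andbT -size_poly_gt0 maxn0; lia.
Qed.

Lemma crd_mul_eq0 f g : (f * g == 0) = (f == 0) || (g == 0).
Proof. by rewrite -!nrm_eq0 nrmM mulf_eq0. Qed.

Lemma crd_mul_neq0 f g : f != 0 -> g != 0 -> f * g != 0.
Proof. by move=> f0 g0; rewrite crd_mul_eq0 negb_or f0. Qed.

Lemma crd_mulfI f g h : f != 0 -> f * g = f * h -> g = h.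
Proof.
move=> f0 /eqP; rewrite -subr_eq0 -mulrBr crd_mul_eq0 (negPf f0) /=.
by rewrite subr_eq0 => /eqP.
Qed.

Lemma crd_expf_neq0 f n : f != 0 -> f ^+ n != 0.
Proof.
move=> f0; elim: n => [|n IH]; first by rewrite expr0 oner_neq0.
by rewrite exprS crd_mul_eq0 negb_or f0.
Qed.

(* [pole_le f m]: the pole of [f] at infinity has order at most [m]
   ([x] and [y] have poles of orders 2 and 3 there). *)
Definition pole_le f m := (size f.1 <= m./2.+1)%N && (size f.2 <= m.-1./2)%N.

Lemma pole_leE f m : f != 0 -> pole_le f m = (size (nrm f) <= m.+1)%N.
Proof.
move=> f0; rewrite size_nrm_eq // geq_max /pole_le.
have [->|b0] := eqVneq f.2 0; first by rewrite size_poly0; lia.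
by move: b0; rewrite -size_poly_gt0; lia.
Qed.

(** For [f != 0] this is the exact order of the pole at infinity, and hence also the number of
    affine zeros over a closed field. *)
Definition dg f : nat := (size (nrm f)).-1.

Lemma dgE f m : f != 0 -> (dg f <= m)%N = pole_le f m.
Proof. by move=> f0; rewrite pole_leE // /dg -subn1 leq_subLR add1n. Qed.

Lemma dgM f g : f != 0 -> g != 0 -> dg (f * g) = (dg f + dg g)%N.
Proof.
rewrite -!nrm_eq0 /dg nrmM => f0 g0; rewrite size_mul //.
rewrite -!size_poly_gt0 in f0 g0; by rewrite -{1}(prednK f0) -{1}(prednK g0) addSn addnS.
Qed.

End CoordinateRing.

(** * Points and local uniformizers *)

Section Points.
Variables (K : fieldType) (E : wcoef K).
Implicit Types (f g h s : crd E) (P : K * K).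

Definition oncv P : bool :=
  P.2 ^+ 2 + wa1 E * P.1 * P.2 + wa3 E * P.2 ==
  P.1 ^+ 3 + wa2 E * P.1 ^+ 2 + wa4 E * P.1 + wa6 E.

Definition onc (R : pt K) : bool := if R is Some P then oncv P else true.

Definition ev P f : K := f.1.[P.1] + f.2.[P.1] * P.2.

(* Up to sign, the partial derivatives of the affine equation. *)
Definition dwy P : K := P.2 *+ 2 + wa1 E * P.1 + wa3 E.
Definition dwx P : K :=
  P.1 ^+ 2 *+ 3 + wa2 E * P.1 *+ 2 + wa4 E - wa1 E * P.2.

Definition cpt P : K * K := (P.1, - P.2 - wa1 E * P.1 - wa3 E).

Lemma evD P f g : ev P (f + g) = ev P f + ev P g.
Proof. by rewrite /ev /= !hornerD; ring. Qed.
Lemma evN P f : ev P (- f) = - ev P f.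
Proof. by rewrite /ev /= !hornerN; ring. Qed.
Lemma evB P f g : ev P (f - g) = ev P f - ev P g.
Proof. by rewrite evD evN. Qed.
Lemma ev0 P : ev P 0 = 0.
Proof. by rewrite /ev /= horner0; ring. Qed.
Lemma ev_px P p : ev P (px E p) = p.[P.1].
Proof. by rewrite /ev /= horner0; ring. Qed.
Lemma ev_cst P c : ev P (cst E c) = c.
Proof. by rewrite ev_px hornerC. Qed.
Lemma ev1 P : ev P 1 = 1.
Proof. by rewrite -[1](rmorph1 (px E)) ev_px hornerC. Qed.
Lemma ev_xc P : ev P (xc E) = P.1.
Proof. by rewrite ev_px hornerX. Qed.
Lemma ev_yc P : ev P (yc E) = P.2.
Proof. by rewrite /ev /= horner0 hornerC; ring. Qed.

Lemma oncvE P : oncv P -> P.2 ^+ 2 = P.1 ^+ 3 + wa2 E * P.1 ^+ 2 + wa4 E * P.1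
  + wa6 E - wa1 E * P.1 * P.2 - wa3 E * P.2.
Proof. by move/eqP <-; ring. Qed.

Lemma evM P f g : oncv P -> ev P (f * g) = ev P f * ev P g.
Proof.
case: f g => a b [c d] /oncvE w; rewrite crdM /ev /wcub /wlin /= !hornerE /=.
ring: w.
Qed.

Lemma evX P f n : oncv P -> ev P (f ^+ n) = ev P f ^+ n.
Proof. by move=> oP; elim: n => [|n IH]; rewrite ?ev1 // !exprS evM ?IH. Qed.

Lemma cptK : involutive cpt.
Proof. by case=> x y; congr pair => /=; ring. Qed.
Lemma oncv_cpt P : oncv (cpt P) = oncv P.
Proof. by rewrite /oncv /=; congr (_ == _); ring. Qed.
Lemma ev_conj P f : ev P (conj f) = ev (cpt P) f.
Proof. by rewrite /ev /wlin /= !hornerE /=; ring. Qed.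
Lemma dwy_cpt P : dwy (cpt P) = - dwy P.
Proof. by rewrite /dwy /=; ring. Qed.
Lemma cpt_fix P : (cpt P == P) = (dwy P == 0).
Proof.
case: P => x y; rewrite /cpt /dwy xpair_eqE eqxx /=.
by rewrite -subr_eq0 -oppr_eq0; congr (_ == _); ring.
Qed.

Lemma same_x P Q : oncv P -> oncv Q -> P.1 = Q.1 -> Q = P \/ Q = cpt P.
Proof.
case: P Q => x y [x' z] oP oQ /= xx'; rewrite -{x'}xx' in oQ *.
have: (z - y) * (z - (cpt (x, y)).2) == 0.
  rewrite /oncv /= in oP oQ *; move/eqP: oP; move/eqP: oQ => <- eyz.
  apply/eqP; transitivity ((z ^+ 2 + wa1 E * x * z + wa3 E * z) - (y ^+ 2 + wa1 E * x * y +
    wa3 E * y)); first by ring.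
  by rewrite eyz subrr.
by rewrite mulf_eq0 !subr_eq0 => /orP[] /eqP ->; [left|right].
Qed.

Definition ux P : crd E := xc E - cst E P.1.
Definition uy P : crd E := yc E - cst E P.2.
(** The curve equation expanded around [P] factors as uy e1 = ux e2. The cofactors take the values
    of the two partial derivatives at [P], so at a smooth point one of them is invertible. *)
Definition e1 P : crd E := uy P + cst E (wa1 E) * ux P + cst E (dwy P).
Definition e2 P : crd E :=
  ux P ^+ 2 + cst E (P.1 *+ 3 + wa2 E) * ux P + cst E (dwx P).

Lemma uye1 P : oncv P -> uy P * e1 P = ux P * e2 P.
Proof.
move=> /oncvE /(congr1 (cst E)).
rewrite /e1 /e2 /uy /ux /dwx /dwy !(rmorphD, rmorphM, rmorphMn, rmorphB, rmorphN, rmorphXn) /=.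
move: (yc2 E); move: (xc E) (yc E) (cst E (wa1 E)) (cst E (wa2 E)) (cst E (wa3 E)) (cst E (wa4 E)) (cst E (wa6 E)) (cst E P.1) (cst E P.2).
move=> x y a1 a2 a3 a4 a6 p q h1 h2.
rewrite -expr2 in h1. ring: h1 h2.
Qed.

Definition unif P : crd E := if dwy P != 0 then ux P else uy P.
(** A function nonzero at [P] that turns both [ux P] and [uy P] into multiples of [unif P];
    multiplying by it replaces a division in the local ring. *)
Definition lunit P : crd E := if dwy P != 0 then e1 P else e2 P.

Lemma ev_ux P : ev P (ux P) = 0.
Proof. by rewrite evB ev_xc ev_cst subrr. Qed.
Lemma ev_uy P : ev P (uy P) = 0.
Proof. by rewrite evB ev_yc ev_cst subrr. Qed.
Lemma ev_unif P : ev P (unif P) = 0.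
Proof. by rewrite /unif; case: ifP; rewrite (ev_ux, ev_uy). Qed.
Lemma ev_e1 P : oncv P -> ev P (e1 P) = dwy P.
Proof. by move=> oP; rewrite /e1 2!evD evM // ev_ux ev_uy !ev_cst; ring. Qed.
Lemma ev_e2 P : oncv P -> ev P (e2 P) = dwx P.
Proof. by move=> oP; rewrite /e2 2!evD evX // evM // ev_ux !ev_cst expr0n /=; ring. Qed.

Lemma lunit_ux P : oncv P -> lunit P * ux P = unif P * e1 P.
Proof. by move=> oP; rewrite /lunit /unif; case: ifP => _; [ring|rewrite uye1 //; ring]. Qed.
Lemma lunit_uy P : oncv P -> lunit P * uy P = unif P * e2 P.
Proof. by move=> oP; rewrite /lunit /unif; case: ifP => _; [rewrite -uye1 //; ring|ring]. Qed.

Lemma unif_neq0 P : unif P != 0.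
Proof.
rewrite /unif; case: ifP => _; rewrite crd_eq0 /= ?subr0 negb_and.
  by rewrite polyXsubC_eq0.
by rewrite oner_neq0 orbT.
Qed.

Definition smooth := forall P, oncv P -> (dwy P != 0) || (dwx P != 0).
Hypothesis smoothE : smooth.

Lemma ev_lunit P : oncv P -> ev P (lunit P) != 0.
Proof.
move=> oP; have := smoothE oP; rewrite /lunit.
by case: ifP => /= d0; rewrite (ev_e1, ev_e2) // d0.
Qed.

(* One step of the local expansion at [P]: (f - f(P)) / unif, up to the local unit [lunit P]. *)
Definition stp P f : crd E :=
  px E ((f.1 + f.2 * (P.2)%:P - (ev P f)%:P) %/ ('X - (P.1)%:P)) * e1 P
  + px E f.2 * e2 P.

Lemma stpD P f g : stp P (f + g) = stp P f + stp P g.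
Proof.
rewrite /stp evD /= [X in px E (X %/ _)](_ : _ =
  (f.1 + f.2 * (P.2)%:P - (ev P f)%:P) + (g.1 + g.2 * (P.2)%:P - (ev P g)%:P)).
  by rewrite divpD !rmorphD /=; ring.
by rewrite polyCD; ring.
Qed.

Lemma stpZ P c f : stp P (cst E c * f) = cst E c * stp P f.
Proof.
rewrite /stp /cst; have -> : px E c%:P * f = (c%:P * f.1, c%:P * f.2).
  by rewrite crdM /=; congr pair; ring.
rewrite /= [X in px E (X %/ _)](_ : _ =
  c *: (f.1 + f.2 * (P.2)%:P - (ev P f)%:P)).
  by rewrite divpZl -mul_polyC !rmorphM /=; ring.
rewrite {1}/ev /= !hornerE /= -mul_polyC /ev.
by rewrite !(polyCD, polyCM) /=; ring.
Qed.

Lemma stpE P f : oncv P -> lunit P * (f - cst E (ev P f)) = unif P * stp P f.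
Proof.
move=> oP; rewrite /stp; set q := _ %/ _.
have eq : px E q * ux P = px E (f.1 + f.2 * (P.2)%:P - (ev P f)%:P).
  rewrite /ux /xc /cst -rmorphB -rmorphM /=; congr px.
  by rewrite /q divpK // dvdp_XsubCl /root !hornerE /ev; apply/eqP; ring.
have -> : f - cst E (ev P f) = px E q * ux P + px E f.2 * uy P.
  by rewrite eq {1}(crdE f) /uy !(rmorphD, rmorphM, rmorphN) /cst /=; ring.
by rewrite mulrDr mulrCA lunit_ux // [lunit P * (px E f.2 * _)]mulrCA lunit_uy // [RHS]mulrDr;
  congr (_ + _); rewrite mulrCA.
Qed.

(** At a singular point the two derivatives and the equation express a3, a4 and a6 through the
    point, a1 and a2. After this substitution the discriminant is identically zero, in every
    characteristic. *)
Lemma smooth_wdisc : wdisc (wa1 E) (wa2 E) (wa3 E) (wa4 E) (wa6 E) != 0 -> smooth.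
Proof.
move=> nz P oP; rewrite -negb_and; apply: contraNN nz => /andP[/eqP dy /eqP dx].
have e3 : wa3 E = - (P.2 *+ 2) - wa1 E * P.1.
  by apply/eqP; rewrite -subr_eq0 -dy /dwy; apply/eqP; ring.
have e4 : wa4 E = wa1 E * P.2 - P.1 ^+ 2 *+ 3 - wa2 E * P.1 *+ 2.
  by apply/eqP; rewrite -subr_eq0 -dx /dwx; apply/eqP; ring.
have e6 : wa6 E = P.2 ^+ 2 + wa1 E * P.1 * P.2 + wa3 E * P.2 - P.1 ^+ 3
    - wa2 E * P.1 ^+ 2 - wa4 E * P.1 by rewrite (eqP oP); ring.
by rewrite /wdisc e6 e3 e4; apply/eqP; ring.
Qed.

End Points.

(** * Orders of vanishing *)

Section Orders.
Variables (K : fieldType) (E : wcoef K).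
Implicit Types (f g h s : crd E) (P : K * K).
Hypothesis smoothE : smooth E.

(** The factor [s] plays the role of a denominator in the local ring at [P]. *)
Definition vanish P f m := exists s g, ev P s != 0 /\ s * f = unif E P ^+ m * g.
Definition has_ord P f m :=
  exists s g, [/\ ev P s != 0, ev P g != 0 & s * f = unif E P ^+ m * g].

Lemma has_ordW P f m : has_ord P f m -> vanish P f m.
Proof. by case=> s [g [s0 _ e]]; exists s, g. Qed.

Lemma has_ordM P f g m n : oncv E P ->
  has_ord P f m -> has_ord P g n -> has_ord P (f * g) (m + n).
Proof.
move=> oP [s [f' [s0 f0 e]]] [t [g' [t0 g0 e']]]; exists (s * t), (f' * g').
by split; rewrite ?evM ?mulf_neq0 // mulrACA e e' mulrACA exprD.
Qed.

Lemma vanishMr P f g m : oncv E P -> vanish P f m -> vanish P (f * g) m.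
Proof. by move=> oP [s [h [s0 e]]]; exists s, (h * g); rewrite mulrA e mulrA. Qed.

Lemma vanishD P f g m : oncv E P -> vanish P f m -> vanish P g m -> vanish P (f + g) m.
Proof.
move=> oP [s [f' [s0 e]]] [t [g' [t0 e']]]; exists (s * t), (t * f' + s * g').
split; first by rewrite evM ?mulf_neq0.
have -> : s * t * (f + g) = t * (s * f) + s * (t * g) by ring.
by rewrite e e'; ring.
Qed.

Lemma vanish_leq P f m n : (m <= n)%N -> vanish P f n -> vanish P f m.
Proof.
move=> mn [s [g [s0 e]]]; exists s, (unif E P ^+ (n - m) * g); split=> //.
by rewrite e mulrA -exprD subnKC.
Qed.

Lemma vanish_has_ord P f m n : oncv E P -> has_ord P f m -> vanish P f n -> (n <= m)%N.
Proof.
move=> oP [s [g [s0 g0 e]]] [t [h [t0 e']]]; rewrite leqNgt; apply/negP=> mn.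
have := congr1 ( *%R t) e; rewrite mulrCA e' mulrCA [t * (_ * g)]mulrCA.
rewrite -(subnK (ltnW mn)) addnC exprD -mulrA => /(crd_mulfI (crd_expf_neq0 m (unif_neq0 E P))).
move/(congr1 (ev P)); rewrite evM // evX // ev_unif.
rewrite expr0n subn_eq0 leqNgt mn mul0r evM // => /esym/eqP.
by rewrite mulf_eq0 (negPf t0) (negPf g0).
Qed.

Lemma has_ord_inj P f m n : oncv E P -> has_ord P f m -> has_ord P f n -> m = n.
Proof.
move=> oP hm hn; apply/anti_leq/andP; split.
  exact: vanish_has_ord hn (has_ordW hm).
exact: vanish_has_ord hm (has_ordW hn).
Qed.

Lemma has_ord0 P f : ev P f != 0 -> has_ord P f 0.
Proof. by move=> f0; exists 1, f; split; rewrite ?ev1 ?oner_neq0. Qed.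

Lemma has_ordX P f m k : oncv E P -> has_ord P f m -> has_ord P (f ^+ k) (k * m).
Proof.
move=> oP hf; elim: k => [|k IH]; first by apply: has_ord0; rewrite ev1 oner_neq0.
by rewrite exprS mulSn; apply: has_ordM.
Qed.

(** At a vertical tangent [e1 P] loses its constant term and becomes uy + a1 ux. Applying ux e2 = uy
    e1 twice then gives ux e2^2 = uy^2 (e2 + a1 e1). *)
Lemma has_ord_ux P : oncv E P -> has_ord P (ux E P) (if dwy E P != 0 then 1%N else 2%N).
Proof.
move=> oP; case: ifP => [d0|/negbFE/eqP d0].
  exists 1, 1; rewrite ev1 oner_neq0; split=> //.
  by rewrite /unif d0; ring.
have := smoothE oP; rewrite d0 eqxx /= => d1.
exists (e2 E P * e2 E P), (e2 E P + cst E (wa1 E) * e1 E P).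
rewrite evM // evD evM // ev_e1 // ev_e2 // d0 mulr0 addr0 mulf_neq0 //; split=> //.
have h := uye1 oP; rewrite /unif d0 eqxx /=.
have e1E : e1 E P = uy E P + cst E (wa1 E) * ux E P by rewrite /e1 d0 rmorph0 addr0.
have -> : e2 E P * e2 E P * ux E P = e2 E P * (uy E P * e1 E P) by rewrite h; ring.
rewrite {1}e1E.
have -> : e2 E P * (uy E P * (uy E P + cst E (wa1 E) * ux E P)) =
  uy E P ^+ 2 * e2 E P + uy E P * cst E (wa1 E) * (ux E P * e2 E P) by ring.
by rewrite -h; ring.
Qed.

Lemma stp_iter P f n : oncv E P ->
  (forall i, (i < n)%N -> ev P (iter i (stp P) f) = 0) ->
  lunit E P ^+ n * f = unif E P ^+ n * iter n (stp P) f.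
Proof.
move=> oP; elim: n => [|n IH] H; first by rewrite !expr0.
have := stpE (iter n (stp P) f) oP; rewrite H // rmorph0 subr0 => h.
rewrite exprSr -mulrA mulrCA IH; last by move=> i /ltnW; apply: H.
by rewrite mulrCA h /= exprSr; ring.
Qed.

(** The product [f * conj f] vanishes at least as much and is a polynomial in x, whose order at [P]
    is at most twice a root multiplicity. The bound is crude; it serves to make the search in [ordc]
    finite. *)
Lemma vanish_bound P f m : oncv E P -> f != 0 -> vanish P f m ->
  (m <= (size (nrm f)).*2)%N.
Proof.
move=> oP f0 /(@vanishMr _ _ (conj f) _ oP); rewrite -px_nrm.
have [k [q [q0 eq]]] : exists k q, ~~ root q P.1 /\ nrm f = q * ('X - P.1%:P) ^+ k.
  have [k [q]] := multiplicity_XsubC (nrm f) P.1.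
  by rewrite nrm_eq0 f0 => ? ?; exists k, q.
have sk : (k < size (nrm f))%N.
  rewrite eq size_mul ?size_exp_XsubC; last first.
  - by rewrite expf_neq0 // polyXsubC_eq0.
  - by apply: contraNneq q0 => ->; rewrite root0.
  rewrite addnS /= -add1n leq_add2r.
  by rewrite size_poly_gt0; apply: contraNneq q0 => ->; rewrite root0.
have hn : has_ord P (px E (nrm f)) (0 + k * (if dwy E P != 0%R then 1 else 2))%N.
  rewrite eq rmorphM rmorphXn; apply: has_ordM => //.
    by apply: has_ord0; rewrite ev_px.
  by have := has_ordX k oP (has_ord_ux oP); rewrite /ux /xc /cst -rmorphB.
move/(vanish_has_ord oP hn)/leq_trans; apply; case: ifP => _; lia.
Qed.

(* Meaningful only for [f != 0] and [P] on the curve. *)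
Definition ordc P f : nat :=
  find (fun i => ev P (iter i (stp P) f) != 0) (iota 0 (size (nrm f)).*2.+1).

Lemma ordcP P f : oncv E P -> f != 0 -> has_ord P f (ordc P f).
Proof.
move=> oP f0; set a := fun i => ev P (iter i (stp P) f) != 0.
have bf i : (i < ordc P f)%N -> ev P (iter i (stp P) f) = 0.
  move=> il; have := before_find 0%N il; rewrite nth_iota ?add0n => [/negbFE/eqP //|].
  by rewrite (leq_trans il) // -[X in (_ <= X)%N](size_iota 0) find_size.
have e := stp_iter oP bf.
have sn : ev P (lunit E P ^+ ordc P f) != 0 by rewrite evX // expf_neq0 ?ev_lunit.
exists (lunit E P ^+ ordc P f), (iter (ordc P f) (stp P) f); split=> //.
have hb : (ordc P f <= (size (nrm f)).*2)%N by apply: (vanish_bound oP f0); eexists; eexists;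
  split; eauto.
have ha : has a (iota 0 (size (nrm f)).*2.+1) by rewrite has_find size_iota ltnS.
by have := nth_find 0%N ha; rewrite nth_iota // add0n.
Qed.

Lemma ordc_uniq P f m : oncv E P -> f != 0 -> has_ord P f m -> ordc P f = m.
Proof. by move=> oP f0; apply: has_ord_inj => //; apply: ordcP. Qed.

Lemma vanishE P f m : oncv E P -> f != 0 -> vanish P f m <-> (m <= ordc P f)%N.
Proof.
move=> oP f0; split; first exact: vanish_has_ord (ordcP oP f0).
by move/vanish_leq; apply; apply/has_ordW/ordcP.
Qed.

Lemma vanish_stp P f n : oncv E P ->
  (forall i, (i < n)%N -> ev P (iter i (stp P) f) = 0) -> vanish P f n.
Proof.
move=> oP /(stp_iter oP) e; exists (lunit E P ^+ n), (iter n (stp P) f).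
by rewrite evX // expf_neq0 ?ev_lunit.
Qed.

Lemma ordcM P f g : oncv E P -> f != 0 -> g != 0 ->
  ordc P (f * g) = (ordc P f + ordc P g)%N.
Proof.
move=> oP f0 g0; apply: ordc_uniq => //; first by rewrite crd_mul_eq0 negb_or f0.
by apply: has_ordM => //; apply: ordcP.
Qed.

Lemma ordc_eq0 P f : oncv E P -> f != 0 -> (ordc P f == 0%N) = (ev P f != 0).
Proof.
move=> oP f0; apply/eqP/idP => [o0|e0]; last exact/ordc_uniq/has_ord0.
have [s [g [s0 g0]]] := ordcP oP f0; rewrite o0 expr0 mul1r => /(congr1 (ev P)).
rewrite evM // => e; apply: contra_neq g0 => f'; by rewrite -e f' mulr0.
Qed.

Lemma ordcD P f g m : oncv E P -> f + g != 0 ->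
  (f != 0 -> (m <= ordc P f)%N) -> (g != 0 -> (m <= ordc P g)%N) ->
  (m <= ordc P (f + g)%R)%N.
Proof.
move=> oP fg hf hg; apply/vanishE => //.
have v h : (h != 0 -> (m <= ordc P h)%N) -> vanish P h m.
  have [->|h0 hh] := eqVneq h 0; last by apply/vanishE => //; apply: hh.
  by move=> _; exists 1, 0; rewrite ev1 oner_neq0 !mulr0.
by apply: vanishD => //; apply: v.
Qed.

Lemma ordc_cst P c : oncv E P -> c != 0 -> ordc P (cst E c) = 0%N.
Proof.
move=> oP c0; apply/eqP; rewrite ordc_eq0 ?ev_cst //.
by rewrite px_eq0 polyC_eq0.
Qed.

Lemma ordc_cstM P c f : oncv E P -> c != 0 -> ordc P (cst E c * f) = ordc P f.
Proof.
move=> oP c0; have [->|f0] := eqVneq f 0; first by rewrite mulr0.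
by rewrite ordcM ?ordc_cst // px_eq0 polyC_eq0.
Qed.

Lemma ordcN P f : oncv E P -> ordc P (- f) = ordc P f.
Proof.
by move=> oP; rewrite -(ordc_cstM f oP (_ : -1 != 0)) ?oppr_eq0 ?oner_neq0 // rmorphN1 mulN1r.
Qed.

(** The conjugate of a uniformizer at [P] vanishes at the conjugate point, so it has order at least
    1 there. Since conjugation is an involution, this inequality implies equality. *)
Lemma ordc_conj_le P f : oncv E P -> f != 0 -> (ordc P f <= ordc (cpt E P) (conj f))%N.
Proof.
move=> oP f0; have [s [g [s0 g0 /(congr1 (@conj _ _))]]] := ordcP oP f0.
rewrite !rmorphM rmorphXn /= => e; have oP' : oncv E (cpt E P) by rewrite oncv_cpt.
apply/vanishE => //; first by rewrite conj_eq0.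
suff [s' [h [s'0 e']]] : vanish (cpt E P) (conj (unif E P)) 1.
  exists (s' ^+ ordc P f * conj s), (h ^+ ordc P f * conj g).
  rewrite evM // evX // ev_conj cptK mulf_neq0 ?expf_neq0 //; split=> //.
  by rewrite -mulrA e mulrA -exprMn e' expr1 exprMn mulrA.
have t0 : conj (unif E P) != 0 by rewrite conj_eq0 unif_neq0.
apply/vanishE => //; rewrite lt0n ordc_eq0 // negbK ev_conj cptK.
by rewrite ev_unif.
Qed.

Lemma ordc_conj P f : oncv E P -> f != 0 -> ordc (cpt E P) (conj f) = ordc P f.
Proof.
move=> oP f0; apply/anti_leq/andP; split; last exact: ordc_conj_le.
have := @ordc_conj_le (cpt E P) (conj f); rewrite conjK cptK oncv_cpt conj_eq0.
exact.
Qed.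

Lemma ordc_XsubC P r : oncv E P -> ordc P (px E ('X - r%:P)) =
  if P.1 == r then (if dwy E P != 0 then 1%N else 2%N) else 0%N.
Proof.
move=> oP; have p0 : px E ('X - r%:P) != 0 by rewrite px_eq0 polyXsubC_eq0.
case: ifP => [/eqP <-|Pr].
  apply: ordc_uniq; rewrite ?px_eq0 ?polyXsubC_eq0 //.
  by have := has_ord_ux oP; rewrite /ux /xc /cst -rmorphB.
by apply/eqP; rewrite ordc_eq0 // ev_px !hornerE subr_eq0 Pr.
Qed.

End Orders.

(** * The degree of a principal divisor and functions with prescribed zeros *)

Lemma sum_support (T : eqType) (s1 s2 : seq T) (F : T -> nat) :
  uniq s1 -> uniq s2 -> (forall x, x \in s1 -> F x != 0%N -> x \in s2) ->
  (\sum_(x <- s1) F x <= \sum_(x <- s2) F x)%N.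
Proof.
move=> u1 u2 s12; rewrite (bigID (fun x => F x == 0%N)) /= big1 ?add0n => [|x /eqP//].
rewrite [X in (_ <= X)%N](bigID (fun x => (x \in s1) && (F x != 0%N))) /=.
rewrite -big_filter -[X in (_ <= X + _)%N]big_filter.
rewrite (perm_big (filter (fun x => (x \in s1) && (F x != 0%N)) s2)) ?leq_addr //=.
apply: uniq_perm; rewrite ?filter_uniq // => x; rewrite !mem_filter.
have [x1|] := boolP (x \in s1); rewrite /= ?andbF //= andbT.
by have [//|Fx] := eqVneq (F x) 0%N; rewrite s12.
Qed.

Lemma sum_count_mem (T : eqType) (s Z : seq T) :
  uniq s -> {subset Z <= s} -> (\sum_(x <- s) count_mem x Z)%N = size Z.
Proof.
move=> us; elim: Z => [|a Z IH] sZ; first by rewrite big1.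
rewrite big_split /= IH => [|x xZ]; last by rewrite sZ // inE xZ orbT.
rewrite -[size Z]add0n -addSn; congr addn.
rewrite (bigD1_seq a) ?sZ ?mem_head //= eqxx big1 ?addn0 // => x.
by rewrite eq_sym => /negPf->.
Qed.

Lemma common_kernel (K : fieldType) (m : nat) (fs : seq ('rV[K]_m -> K)) :
  (size fs < m)%N ->
  (forall i c u v, (i < size fs)%N ->
     nth (fun=> 0) fs i (c *: u + v) = c * nth (fun=> 0) fs i u + nth (fun=> 0) fs i v) ->
  exists2 v, v != 0 & forall i, (i < size fs)%N -> nth (fun=> 0) fs i v = 0.
Proof.
move=> sm lin; pose M := \matrix_(j < m, i < size fs) nth (fun=> 0) fs i (delta_mx 0 j).
have : kermx M != 0.
  rewrite kermx_eq0 /row_free neq_ltn; apply/orP; left.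
  by rewrite (leq_ltn_trans (rank_leq_col _)).
move/rowV0Pn => [v /sub_kermxP vM v0]; exists v => // i lti.
have phi0 : nth (fun=> 0) fs i 0 = 0.
  have := lin i 1 0 0 lti; rewrite scaler0 addr0 mul1r => /eqP.
  by rewrite -subr_eq0 opprD addrA subrr sub0r oppr_eq0 => /eqP.
have <- : (v *m M) 0 (Ordinal lti) = nth (fun=> 0) fs i v; last by rewrite vM mxE.
rewrite mxE [in RHS](row_sum_delta v).
pose ph := nth (fun=> 0) fs i.
rewrite -/ph; have sumE r : ph (\sum_(j <- r) v 0 j *: delta_mx 0 j) =
  \sum_(j <- r) v 0 j * ph (delta_mx 0 j).
  by elim: r => [|j r IH]; rewrite ?big_nil // !big_cons -IH; apply: lin.
by rewrite sumE; apply: eq_bigr => j _; rewrite mxE.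
Qed.

Definition affs (K : Type) (Z : seq (pt K)) : seq (K * K) := pmap id Z.

Lemma count_affs (K : eqType) (P : K * K) (Z : seq (pt K)) :
  count_mem P (affs Z) = count_mem (Some P) Z.
Proof. by elim: Z => [|[Q|] Z IH] //=; rewrite IH. Qed.

Section Divisors.
Variables (K : closedFieldType) (E : wcoef K).
Implicit Types (f g h s : crd E) (P Q : K * K).
Hypothesis smoothE : smooth E.
Local Notation onc := (onc E).

Lemma point_over (x : K) : exists y, oncv E (x, y).
Proof.
pose p : {poly K} := 'X^2 + (wa1 E * x + wa3 E) *: 'X
  - (x ^+ 3 + wa2 E * x ^+ 2 + wa4 E * x + wa6 E)%:P.
have /closed_rootP[y /rootP e] : size p != 1%N.
  rewrite /p -addrA size_polyDl size_polyXn // ltnS.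
  rewrite (leq_trans (size_polyD _ _)) // geq_max size_polyN.
  rewrite (leq_trans (size_scale_leq _ _)) ?size_polyX //=.
  by rewrite (leq_trans (size_polyC_leq1 _)).
exists y; rewrite /oncv /= -subr_eq0; apply/eqP; rewrite -{}e /p !hornerE /=; ring.
Qed.

Lemma points_over (r : seq K) :
  exists2 s : seq (K * K), uniq s & forall P, (P \in s) = oncv E P && (P.1 \in r).
Proof.
elim: r => [|x r [s us ms]]; first by exists [::] => // P; rewrite andbF.
have [y oy] := point_over x; exists (undup [:: (x, y), cpt E (x, y) & s]);
  first exact: undup_uniq.
move=> P; rewrite mem_undup !inE ms; apply/idP/idP.
  by case/or3P=> [/eqP->|/eqP->|/andP[-> ->]]; rewrite ?oncv_cpt ?oy ?eqxx ?orbT //=.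
case/andP=> oP /orP[/eqP Px|->]; last by rewrite oP !orbT.
by have [->|->] := same_x oy oP (esym Px); rewrite eqxx ?orbT.
Qed.

(** A vertical line meets the curve in two conjugate points, or in a single point of order 2 when
    they coincide, which is the case [dwy = 0]. *)
Lemma sum_ord_XsubC (s : seq (K * K)) x : uniq s ->
  (forall P, P.1 = x -> (P \in s) = oncv E P) -> all (oncv E) s ->
  (\sum_(P <- s) ordc P (px E ('X - x%:P)))%N = 2%N.
Proof.
move=> us ms os; have [y oy] := point_over x.
rewrite (eq_big_seq (fun P => if P.1 == x then (if dwy E P != 0 then 1%N else 2%N) else 0%N));
  last first.
  by move=> P /(allP os) oP; rewrite ordc_XsubC.
rewrite -big_mkcond -big_filter.
have oc : oncv E (cpt E (x, y)) by rewrite oncv_cpt.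
have [d0|d0] := eqVneq (dwy E (x, y)) 0.
  rewrite (perm_big [:: (x, y)]) ?big_seq1 ?d0 ?eqxx //.
  apply: uniq_perm; rewrite ?filter_uniq // => P; rewrite mem_filter inE.
  apply/andP/eqP => [[/eqP Px]|->]; last by rewrite ms.
  rewrite ms // => oP; have [//|->] := same_x oy oP (esym Px).
  by apply/eqP; rewrite cpt_fix d0.
rewrite (perm_big [:: (x, y); cpt E (x, y)]) ?big_cons ?big_nil ?dwy_cpt ?oppr_eq0 ?d0 //.
apply: uniq_perm; rewrite ?filter_uniq //=.
  by rewrite inE andbT eq_sym cpt_fix d0.
move=> P; rewrite mem_filter !inE; apply/andP/orP => [[/eqP Px]|].
  by rewrite ms // => oP; have [->|->] := same_x oy oP (esym Px); rewrite eqxx; [left|right].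
by case=> /eqP ->; rewrite ms /= ?eqxx.
Qed.

Lemma sum_ord_px (s : seq (K * K)) (p : {poly K}) : uniq s -> p != 0 ->
  (forall P, root p P.1 -> (P \in s) = oncv E P) -> all (oncv E) s ->
  (\sum_(P <- s) ordc P (px E p))%N = (size p).-1.*2.
Proof.
move=> us p0 ms os; have [r er] := closed_field_poly_normal p.
have l0 : lead_coef p != 0 by rewrite lead_coef_eq0.
have sr : (size p).-1 = size r by rewrite er size_scale // size_prod_XsubC.
have {ms} : forall P, P.1 \in r -> (P \in s) = oncv E P.
  by move=> P Pr; apply: ms; rewrite er rootZ // root_prod_XsubC.
rewrite {}sr {}er -mul_polyC rmorphM /=.
under eq_big_seq => P /(allP os) oP do rewrite ordc_cstM //.
elim: r => [|x r IH] ms.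
  rewrite big_nil big1_seq // => P /andP[_ /(allP os) oP].
  by have := ordc_cst smoothE oP (oner_neq0 K); rewrite /cst => ->.
have q0 : \prod_(z <- r) ('X - z%:P) != 0 by rewrite monic_neq0 ?monic_prod_XsubC.
rewrite big_cons.
under eq_big_seq => P /(allP os) oP do rewrite rmorphM /= ordcM ?px_eq0 ?polyXsubC_eq0 //.
rewrite big_split /= sum_ord_XsubC // ?IH // => P Pr; first by rewrite ms // inE Pr orbT.
by rewrite ms // Pr mem_head.
Qed.

Lemma root_nrm P f : oncv E P -> ev P f = 0 -> root (nrm f) P.1.
Proof. by move=> oP f0; rewrite /root -(ev_px E) px_nrm evM // f0 mul0r. Qed.

(* Conjugation permutes the points and [f * conj f = nrm f] is a polynomial in [x],
   so twice the total order of [f] is twice the degree of [nrm f]. *)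
Lemma sum_ord_exists f : f != 0 -> exists s : seq (K * K),
  [/\ uniq s, all (oncv E) s, (forall P, oncv E P -> ev P f = 0 -> P \in s) &
      (\sum_(P <- s) ordc P f)%N = dg f].
Proof.
move=> f0; have n0 : nrm f != 0 by rewrite nrm_eq0.
have [r er] := closed_field_poly_normal (nrm f).
have rr x : root (nrm f) x = (x \in r).
  by rewrite er rootZ ?lead_coef_eq0 // root_prod_XsubC.
have [s us ms] := points_over r; have os : all (oncv E) s.
  by apply/allP=> P; rewrite ms => /andP[].
exists s; split=> // [P oP e0|].
  by rewrite ms oP -rr root_nrm.
have sc : (\sum_(P <- s) ordc P (conj f) = \sum_(P <- s) ordc P f)%N.
  rewrite (perm_big (map (cpt E) s)) /=; last first.
    apply: uniq_perm; rewrite ?map_inj_uniq //; first exact: inv_inj (@cptK _ E).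
    move=> P; rewrite -{2}(cptK E P) mem_map; last exact: inv_inj (@cptK _ E).
    by rewrite !ms oncv_cpt.
  by rewrite big_map; apply: eq_big_seq => P /(allP os) oP; rewrite ordc_conj.
have := sum_ord_px us n0; rewrite px_nrm.
under eq_big_seq => P /(allP os) oP do rewrite ordcM ?conj_eq0 //.
rewrite big_split /= sc addnn => h; apply: double_inj; apply: h => // P Pr.
by rewrite ms -rr Pr andbT.
Qed.

Lemma sum_ord f (s : seq (K * K)) : f != 0 -> uniq s -> all (oncv E) s ->
  (forall P, oncv E P -> ev P f = 0 -> P \in s) ->
  (\sum_(P <- s) ordc P f)%N = dg f.
Proof.
move=> f0 us os zs; have [s' [us' os' zs' <-]] := sum_ord_exists f0.
by apply/anti_leq/andP; split; apply: sum_support => // P Ps;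
  have oP : oncv E P by [apply: (allP os)|apply: (allP os')];
  rewrite ordc_eq0 // negbK => /eqP; [apply: zs'|apply: zs].
Qed.

Lemma sum_ord_le f (s : seq (K * K)) : f != 0 -> uniq s -> all (oncv E) s ->
  (\sum_(P <- s) ordc P f <= dg f)%N.
Proof.
move=> f0 us os; have [s' [us' os' zs' <-]] := sum_ord_exists f0.
apply: sum_support => // P Ps; have oP := allP os _ Ps.
by rewrite ordc_eq0 // negbK => /eqP; apply: zs'.
Qed.

(** Each entry [P] tests the local coefficient whose index is the number of later occurrences of
    [P]; the entries equal to [P] thus test all indices below its multiplicity. *)
Fixpoint conditions (Z : seq (K * K)) : seq (crd E -> K) :=
  if Z is P :: Z' then
    (fun f => ev P (iter (count_mem P Z') (stp P) f)) :: conditions Z'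
  else [::].

Lemma size_conditions Z : size (conditions Z) = size Z.
Proof. by elim: Z => //= P Z ->. Qed.

Lemma conditions_lin Z i c f g : all (oncv E) Z -> (i < size Z)%N ->
  nth (fun=> 0) (conditions Z) i (cst E c * f + g) =
  c * nth (fun=> 0) (conditions Z) i f + nth (fun=> 0) (conditions Z) i g.
Proof.
elim: Z i => [|P Z IH] [|i] //= /andP[oP oZ] iZ; last exact: IH.
clear IH; elim: (count_mem _ _) f g => [|n IHn] f g; first by rewrite /= evD evM // ev_cst.
by rewrite !iterSr stpD stpZ IHn.
Qed.

Lemma conditions_vanish Z f : all (oncv E) Z ->
  (forall i, (i < size Z)%N -> nth (fun=> 0) (conditions Z) i f = 0) ->
  forall P, oncv E P -> vanish P f (count_mem P Z).
Proof.
move=> oZ cZ P oP; apply: vanish_stp => // n nZ.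
elim: Z oZ cZ nZ => //= Q Z IH /andP[_ oZ] cZ.
have [nZ _|nZ] := ltnP n (count_mem P Z).
  by apply: IH => // i iZ; have := cZ i.+1; apply.
have [QP|_] := eqVneq Q P; last by rewrite add0n ltnNge nZ.
rewrite add1n ltnS => nZ'; have -> : n = count_mem P Z by apply/anti_leq/andP.
by have := cZ 0%N isT; rewrite /= QP.
Qed.

(* The functions with a pole of order at most [n + 1] at infinity form a space
   of dimension [n + 1], so [n] linear conditions do not kill it. *)
Lemma exists_vanishing Z : all (oncv E) Z -> exists f, [/\ f != 0,
  pole_le f (size Z).+1 & forall P, oncv E P -> (count_mem P Z <= ordc P f)%N].
Proof.
move=> oZ; pose m := (size Z).+1; pose p := m./2.+1; pose q := m.-1./2.
pose fm (v : 'rV[K]_(p + q)) : crd E := (rVpoly (lsubmx v), rVpoly (rsubmx v)).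
have fmD c u v : fm (c *: u + v) = cst E c * fm u + fm v.
  rewrite /fm /cst crdM !linearP /=; congr pair => /=; rewrite -mul_polyC; ring.
have [||v v0 cv] := @common_kernel K _ (map (fun c => c \o fm) (conditions Z)).
- by rewrite size_map size_conditions /p /q /m; move: (size Z) => n; lia.
- move=> i c u v; rewrite size_map size_conditions => iZ.
  by rewrite !(nth_map (fun=> 0)) ?size_conditions //= fmD conditions_lin.
have f0 : fm v != 0.
  rewrite crd_eq0 /=; apply: contraNN v0 => /andP[/eqP v1 /eqP v2].
  rewrite -[v]hsubmxK -[lsubmx v]rVpolyK -[rsubmx v]rVpolyK v1 v2 !linear0.
  by rewrite row_mx0.
exists (fm v); split=> //; first by rewrite /pole_le /= !size_poly.
move=> P oP; apply/vanishE => //; apply: conditions_vanish => // i iZ.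
have := cv i; rewrite size_map size_conditions => /(_ iZ).
by rewrite (nth_map (fun=> 0)) ?size_conditions.
Qed.

Lemma all_affs Z : all onc Z -> all (oncv E) (affs Z).
Proof. by elim: Z => [|[P|] Z IH] //= /andP[-> /IH]. Qed.

(* The affine part of the divisor of [f] is that of the list [Z]. *)
Definition divis f (Z : seq (pt K)) : Prop :=
  f != 0 /\ forall P, oncv E P -> ordc P f = count_mem (Some P) Z.

Lemma divis_dg f Z : all onc Z -> divis f Z -> dg f = size (affs Z).
Proof.
move=> oZ [f0 fZ]; have [s [us os zs <-]] := sum_ord_exists f0.
rewrite -(@sum_count_mem _ s) //.
  by apply: eq_big_seq => P /(allP os) oP; rewrite fZ // count_affs.
move=> P PZ; have oP := allP (all_affs oZ) _ PZ.
apply: zs => //; apply/eqP; rewrite -[_ == _]negbK -ordc_eq0 // fZ // -count_affs.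
by rewrite -lt0n -has_count has_pred1.
Qed.

(** The existence half of Riemann-Roch. A function vanishing on [Z] with a pole of order at most one
    more than the number of affine points of [Z] has at most one further affine zero. If it has
    none, the residual point is at infinity, where entries are invisible to [divis]. *)
Lemma residual Z : all onc Z -> exists2 R, onc R & exists f, divis f (R :: Z).
Proof.
move=> /all_affs oZ; have [f [f0 fp fZ]] := exists_vanishing oZ.
have [s [us os zs sf]] := sum_ord_exists f0.
pose d P := (ordc P f - count_mem P (affs Z))%N.
have Zs : {subset affs Z <= s}.
  move=> P PZ; have oP := allP oZ _ PZ; apply: zs => //; apply/eqP.
  rewrite -[_ == _]negbK -ordc_eq0 // -lt0n (leq_trans _ (fZ _ oP)) //.
  by rewrite -has_count has_pred1.
have sd : (\sum_(P <- s) d P <= 1)%N.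
  have : (\sum_(P <- s) d P + \sum_(P <- s) count_mem P (affs Z) = dg f)%N.
    rewrite -big_split -sf; apply: eq_big_seq => P /(allP os) oP.
    by rewrite /= subnK ?fZ.
  rewrite sum_count_mem // => e; move: fp; rewrite -dgE // -e -addn1 addnC leq_add2l; apply.
have dE P : oncv E P -> ordc P f = (d P + count_mem P (affs Z))%N.
  by move=> oP; rewrite subnK ?fZ.
have [/allP d0|/allPn[P Ps dP]] := boolP (all (fun P => d P == 0%N) s).
  exists None => //; exists f; split=> // P oP; rewrite dE //= count_affs.
  have [/d0/eqP->//|Ps] := boolP (P \in s).
  have : ordc P f = 0%N.
    by apply/eqP; rewrite ordc_eq0 //; apply: contraNN Ps => /eqP; apply: zs.
  by rewrite dE // => /eqP; rewrite addn_eq0 => /andP[/eqP->].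
have oP := allP os _ Ps; exists (Some P) => //; exists f; split=> // Q oQ.
rewrite dE // /= count_affs; congr addn; move: sd; rewrite (bigD1_seq P) //=.
have [<-|QP] := eqVneq P Q; first by rewrite eqxx; move: dP => /=; lia.
have [Qs|Qs] := boolP (Q \in s).
  rewrite -big_filter (bigD1_seq Q) ?filter_uniq ?mem_filter ?Qs ?andbT //=;
    last by rewrite eq_sym.
  have -> : (Some P == Some Q) = false by apply/negP => /eqP[QP']; rewrite QP' eqxx in QP.
  by move: dP; case: (d P) => // a _; case: (d Q) => // b; rewrite !addSn addnS.
have -> : d Q = 0%N.
  have : ordc Q f = 0%N by apply/eqP; rewrite ordc_eq0 //; apply: contraNN Qs => /eqP; apply: zs.
  by rewrite /d => ->.
by case: eqP => // -[QP']; rewrite QP' eqxx in QP.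
Qed.

End Divisors.

(** * Affine divisors *)

Section LeadingTerm.
Variables (K : fieldType) (E : wcoef K).
Implicit Types (f g h : crd E).

(** Shaped so that the successor case is [pole_le] by computation, while order 0 forces [f = 0];
    this is what inductions on the pole order start from. *)
Definition pole_lt f m := (size f.1 <= uphalf m)%N && (size f.2 <= m.-2./2)%N.

Lemma pole_ltS f m : pole_lt f m.+1 = pole_le f m.
Proof. by []. Qed.

Lemma pole_lt0 f : pole_lt f 0 = (f == 0).
Proof. by rewrite /pole_lt !leqn0 !size_poly_eq0 -crd_eq0. Qed.

Lemma pole_ltE f m : f != 0 -> pole_lt f m = (size (nrm f) <= m)%N.
Proof.
case: m => [|m] f0; last by rewrite pole_ltS pole_leE.
by rewrite pole_lt0 leqn0 size_poly_eq0 nrm_eq0.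
Qed.

Lemma pole_leD f g m : pole_le f m -> pole_le g m -> pole_le (f + g) m.
Proof.
move=> /andP[h1 h2] /andP[h3 h4]; apply/andP; split;
  by rewrite (leq_trans (size_polyD _ _)) // geq_max ?h1 ?h2.
Qed.

Lemma cstM c f : cst E c * f = (c *: f.1, c *: f.2).
Proof. by rewrite crdM /= -!mul_polyC; congr pair; ring. Qed.

Lemma pole_leZ c f m : pole_le f m -> pole_le (cst E c * f) m.
Proof.
by move=> /andP[h1 h2]; rewrite cstM; apply/andP; split;
  rewrite (leq_trans (size_scale_leq _ _)).
Qed.

(* The coefficient of the monomial [x^i] or [x^i y] whose pole has order [m]. *)
Definition pcoef m f : K := if odd m then (f.2)`_((m - 3)./2) else (f.1)`_(m./2).

Lemma pcoefD m f g : pcoef m (f + g) = pcoef m f + pcoef m g.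
Proof. by rewrite /pcoef; case: ifP; rewrite coefD. Qed.
Lemma pcoefZ m c f : pcoef m (cst E c * f) = c * pcoef m f.
Proof. by rewrite cstM /pcoef; case: ifP; rewrite coefZ. Qed.

Lemma size_drop (p : {poly K}) n : (size p <= n.+1)%N -> p`_n = 0 -> (size p <= n)%N.
Proof.
by rewrite leq_eqVlt => /predU1P[sp|//] pn; move: (lead_coef_eq0 p);
  rewrite /lead_coef sp pn eqxx -size_poly_eq0 sp.
Qed.

Lemma pole_le_lt f m : pole_le f m -> pcoef m f = 0 -> pole_lt f m.
Proof.
rewrite /pole_le /pcoef /pole_lt uphalf_half; case: ifP => om /andP[h1 h2] c0.
  rewrite add1n h1 /=; case: m om c0 h1 h2 => [|[|[|m]]] // om c0 _ h2.
  have e : m.+3.-2./2 = m./2 by move: om; lia.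
  rewrite e; apply: size_drop; last by move: c0; rewrite -[m.+3]addn3 addnK.
  by rewrite (leq_trans h2) //; move: om; lia.
rewrite add0n size_drop //=; apply: leq_trans h2 _.
by move: om; lia.
Qed.

(** At most one monomial x^i or x^i y has a pole of order exactly [m], so the quotient of the two
    successive pole spaces has dimension at most one. *)
Lemma pole_cancel f g m : pole_le f m -> pole_le g m -> ~~ pole_lt g m ->
  exists c, pole_lt (f - cst E c * g) m.
Proof.
move=> hf hg ng; have g0 : pcoef m g != 0 by apply: contraNN ng => /eqP; apply: pole_le_lt.
exists (pcoef m f / pcoef m g); rewrite -mulNr -rmorphN.
apply: pole_le_lt; first by rewrite pole_leD ?pole_leZ.
by rewrite pcoefD pcoefZ mulNr divfK // subrr.
Qed.

End LeadingTerm.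

(** * Transport of functions and orders along a field morphism *)

Section Functoriality.
Variables (K K' : fieldType) (sg : {rmorphism K -> K'}) (E : wcoef K).

Definition wmap : wcoef K' :=
  Wc (sg (wa1 E)) (sg (wa2 E)) (sg (wa3 E)) (sg (wa4 E)) (sg (wa6 E)).

Variable E' : wcoef K'.
Hypothesis EE' : E' = wmap.

(** The target curve is a variable equal to [wmap], not [wmap] itself: for Frobenius on a curve with
    rational coefficients the image then lies in the same ring [crd E]. *)
Definition crd_map (f : crd E) : crd E' := (map_poly sg f.1, map_poly sg f.2).
Definition apt (P : K * K) : K' * K' := (sg P.1, sg P.2).

Lemma map_wlin : map_poly sg (wlin E) = wlin E'.
Proof. by rewrite EE' /wlin rmorphD /= map_polyZ map_polyX map_polyC. Qed.
Lemma map_wcub : map_poly sg (wcub E) = wcub E'.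
Proof.
by rewrite EE' /wcub !rmorphD /= !map_polyZ !map_polyXn map_polyX map_polyC.
Qed.

Lemma crd_mapD f g : crd_map (f + g) = crd_map f + crd_map g.
Proof. by rewrite /crd_map !rmorphD. Qed.
Lemma crd_mapB f g : crd_map (f - g) = crd_map f - crd_map g.
Proof. by rewrite /crd_map !rmorphB. Qed.
Lemma crd_mapM f g : crd_map (f * g) = crd_map f * crd_map g.
Proof.
by rewrite !crdM /crd_map /= -map_wlin -map_wcub !(rmorphB, rmorphD, rmorphM).
Qed.
Lemma crd_map1 : crd_map 1 = 1.
Proof. by rewrite /crd_map /= rmorph1 rmorph0. Qed.
Lemma crd_mapX f n : crd_map (f ^+ n) = crd_map f ^+ n.
Proof. by elim: n => [|n IH]; rewrite ?crd_map1 // !exprS crd_mapM IH. Qed.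
Lemma crd_map_px p : crd_map (px E p) = px E' (map_poly sg p).
Proof. by rewrite /crd_map /= rmorph0. Qed.
Lemma crd_map_cst c : crd_map (cst E c) = cst E' (sg c).
Proof. by rewrite crd_map_px map_polyC. Qed.
Lemma crd_map_xc : crd_map (xc E) = xc E'.
Proof. by rewrite crd_map_px map_polyX. Qed.
Lemma crd_map_yc : crd_map (yc E) = yc E'.
Proof. by rewrite /crd_map /= rmorph0 rmorph1. Qed.
Lemma crd_map_eq0 f : (crd_map f == 0) = (f == 0).
Proof. by rewrite !crd_eq0 !map_poly_eq0. Qed.
Lemma nrm_crd_map f : nrm (crd_map f) = map_poly sg (nrm f).
Proof. by rewrite /nrm /= -map_wlin -map_wcub !(rmorphB, rmorphM, rmorphXn). Qed.
Lemma ev_map P f : ev (apt P) (crd_map f) = sg (ev P f).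
Proof. by rewrite /ev /= !horner_map rmorphD rmorphM. Qed.
Lemma oncv_map P : oncv E' (apt P) = oncv E P.
Proof.
rewrite /oncv EE' /= -(inj_eq (fmorph_inj sg)).
by rewrite !(rmorphD, rmorphM, rmorphXn).
Qed.
Lemma dwy_map P : dwy E' (apt P) = sg (dwy E P).
Proof. by rewrite /dwy EE' !(rmorphD, rmorphM, rmorphMn). Qed.
Lemma unif_map P : unif E' (apt P) = crd_map (unif E P).
Proof.
rewrite /unif dwy_map fmorph_eq0; case: ifP => _; rewrite crd_mapB crd_map_cst.
  by rewrite crd_map_xc.
by rewrite crd_map_yc.
Qed.
Lemma cpt_map P : cpt E' (apt P) = apt (cpt E P).
Proof. by rewrite /cpt /apt EE' /= !(rmorphB, rmorphN, rmorphM). Qed.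

Lemma has_ord_map P f m : has_ord P f m -> has_ord (apt P) (crd_map f) m.
Proof.
move=> [s [g [s0 g0 e]]]; exists (crd_map s), (crd_map g).
by rewrite !ev_map !fmorph_eq0 -crd_mapM e crd_mapM crd_mapX unif_map.
Qed.

Lemma ordc_map P f : smooth E -> smooth E' -> oncv E P -> f != 0 ->
  ordc (apt P) (crd_map f) = ordc P f.
Proof.
move=> sE sE' oP f0; apply: ordc_uniq; rewrite ?oncv_map ?crd_map_eq0 //.
by apply: has_ord_map; apply: ordcP.
Qed.

End Functoriality.

(** * Products, cancellation and uniqueness for affine divisors *)

Section DivisorCalculus.
Variables (K : closedFieldType) (E : wcoef K).
Implicit Types (f g h s : crd E) (P Q : K * K) (Y Z : seq (pt K)).
Hypothesis smoothE : smooth E.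
Local Notation onc := (onc E).

Definition cptp (R : pt K) : pt K := omap (cpt E) R.

Lemma onc_cptp R : onc (cptp R) = onc R.
Proof. by case: R => //= P; rewrite oncv_cpt. Qed.
Lemma cptpK : involutive cptp.
Proof. by case=> //= P; rewrite cptK. Qed.

Lemma divis_count f Y Z :
  (forall P, count_mem (Some P) Y = count_mem (Some P) Z) -> divis f Y -> divis f Z.
Proof. by move=> YZ [f0 fY]; split=> // P oP; rewrite fY ?YZ. Qed.

Lemma divis_cat f g Y Z : divis f Y -> divis g Z -> divis (f * g) (Y ++ Z).
Proof.
move=> [f0 fY] [g0 gZ]; split; first by rewrite crd_mul_eq0 negb_or f0.
by move=> P oP; rewrite ordcM // fY // gZ // count_cat.
Qed.

Lemma count_cptp (R : pt K) Z : count_mem R (map cptp Z) = count_mem (cptp R) Z.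
Proof.
rewrite count_map; apply: eq_count => S /=.
by rewrite -(inj_eq (inv_inj cptpK)) cptpK.
Qed.

Lemma divis_conj f Z : divis f Z -> divis (conj f) (map cptp Z).
Proof.
move=> [f0 fZ]; split=> [|P oP]; first by rewrite conj_eq0.
by rewrite -{1}(cptK E P) ordc_conj ?oncv_cpt // fZ ?oncv_cpt // count_cptp.
Qed.

Lemma divis_XsubC P : oncv E P -> divis (px E ('X - P.1%:P)) [:: Some P; Some (cpt E P)].
Proof.
move=> oP; split=> [|Q oQ]; first by rewrite px_eq0 polyXsubC_eq0.
rewrite ordc_XsubC // /= addn0; case: eqP => [QP|QP].
  have [->|->] := same_x oP oQ (esym QP).
    rewrite eqxx; have -> : (Some (cpt E P) == Some P) = (cpt E P == P) by [].
    by rewrite cpt_fix; case: eqP.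
  rewrite eqxx dwy_cpt oppr_eq0; have -> : (Some P == Some (cpt E P)) = (cpt E P == P).
    by rewrite eq_sym.
  by rewrite cpt_fix; case: eqP.
have -> : (Some P == Some Q) = false by apply/eqP => -[PQ]; case: QP; rewrite PQ.
by have -> : (Some (cpt E P) == Some Q) = false by apply/eqP => -[PQ]; case: QP; rewrite -PQ.
Qed.

(** Zeros at [P] and at its conjugate force both components of [f] to vanish at x(P), so the
    polynomial X - x(P) divides [f]. *)
Lemma divis_cancel f P Z : oncv E P -> divis f (Some P :: Some (cpt E P) :: Z) ->
  exists f', divis f' Z.
Proof.
move=> oP [f0 fZ]; set r := P.1.
have evf Q : oncv E Q -> (0 < ordc Q f)%N -> ev Q f = 0.
  by move=> oQ; rewrite lt0n ordc_eq0 // negbK => /eqP.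
have evP : ev P f = 0 by rewrite evf // fZ //= eqxx.
have oP' : oncv E (cpt E P) by rewrite oncv_cpt.
have evP' : ev (cpt E P) f = 0 by rewrite evf // fZ //= eqxx addnCA.
(* For distinct conjugates, f(P) - f(conj P) = f.2(r) [dwy P]. If they coincide, [f] has a double
   zero, and its first local coefficient is f.2(r) [dwx P] with [dwx P] nonzero. *)
have b0 : (f.2).[r] = 0.
  have [d0|d0] := eqVneq (dwy E P) 0; last first.
    apply/eqP; rewrite -(mulIr_eq0 _ (mulIf d0)); apply/eqP.
    have : ev P f - ev (cpt E P) f = 0 by rewrite evP evP' subrr.
    by rewrite /ev /= -/r => <-; rewrite /dwy; ring.
  have PP : cpt E P = P by apply/eqP; rewrite cpt_fix d0.
  have o2 : (1 < ordc P f)%N by rewrite fZ // PP /= eqxx.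
  have := stpE f oP; rewrite evP rmorph0 subr0 => e.
  have : ev P (stp P f) = 0.
    have [->|s0] := eqVneq (stp P f) 0; first exact: ev0.
    apply/eqP; rewrite -[_ == _]negbK -(ordc_eq0 smoothE) //.
    have ss0 : lunit E P != 0 by apply: contraNneq (ev_lunit smoothE oP) => ->; rewrite ev0.
    have := congr1 (ordc P) e; rewrite !ordcM ?unif_neq0 //.
    have -> : ordc P (lunit E P) = 0%N by apply/eqP; rewrite ordc_eq0 ?ev_lunit.
    have -> : ordc P (unif E P) = 1%N.
      apply: ordc_uniq; rewrite ?unif_neq0 //; exists 1, 1; split; rewrite ?ev1 ?oner_neq0 //.
      by rewrite expr1 mulrC.
    by move: o2; case: (ordc P f) => [|[|n]] // _; rewrite add0n add1n => -[<-].
  rewrite /stp evD !evM // !ev_px ev_e1 // ev_e2 // d0 mulr0 add0r => /eqP.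
  have := smoothE oP; rewrite d0 eqxx /= => d1.
  by rewrite mulf_eq0 (negPf d1) orbF => /eqP.
have a0 : (f.1).[r] = 0 by move: evP; rewrite /ev -/r b0 mul0r addr0.
pose f' : crd E := (f.1 %/ ('X - r%:P), f.2 %/ ('X - r%:P)).
have fE : f = px E ('X - r%:P) * f'.
  rewrite crdM /= !mul0r subr0 !addr0 ![(_ - _) * _]mulrC.
  by rewrite !divpK ?dvdp_XsubCl /root ?a0 ?b0 //; case: (f).
have f'0 : f' != 0 by apply: contraNneq f0 => f'0; rewrite fE f'0 mulr0.
exists f'; split=> // Q oQ; have := fZ Q oQ.
rewrite fE ordcM ?px_eq0 ?polyXsubC_eq0 // (divis_XsubC oP).2 //=.
by rewrite addn0 addnA => /addnI.
Qed.

Lemma divis_cancels f Y Z : all onc Y -> divis f (Y ++ map cptp Y ++ Z) ->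
  exists f', divis f' Z.
Proof.
elim: Y f => [|[P|] Y IH] f /=; first by exists f.
  case/andP=> oP oY df.
  have [|f' df'] := @divis_cancel f P (Y ++ map cptp Y ++ Z) oP.
    by apply: divis_count df => Q; rewrite /= !count_cat /= !count_cat /=; congr addn;
      rewrite addnCA.
  exact: IH df'.
move=> oY df; apply: (IH f) => //.
by apply: divis_count df => Q; rewrite /= !count_cat /= !count_cat.
Qed.

(* Otherwise some function has affine divisor [P + conj Q] with [P <> Q], yet those
   with a pole of order at most 2 are the [c x + c']. *)
Lemma divis_inj f g (P Q : pt K) Z : onc P -> onc Q -> all onc Z ->
  divis f (P :: Z) -> divis g (Q :: Z) -> P = Q.
Proof.
move=> oP oQ oZ df /divis_conj dg'.
have [|h dh] := @divis_cancels (f * conj g) Z [:: P; cptp Q] oZ.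
  apply: divis_count (divis_cat df dg') => R; rewrite /= !count_cat /= addn0; lia.
have oo : all onc [:: P; cptp Q] by rewrite /= oP onc_cptp oQ.
have h0 := dh.1; have hs := divis_dg smoothE oo dh.
have : pole_le h 2.
  by rewrite -dgE // hs; case: (P) (cptp Q) => [?|] [?|].
case/andP=> h1; rewrite leqn0 size_poly_eq0 => /eqP h2.
have hE : h = px E h.1 by rewrite {1}(crdE h) h2 rmorph0 mul0r addr0.
have {}h1 : h.1 = (h.1)`_1 *: 'X + ((h.1)`_0)%:P.
  apply/polyP=> i; rewrite coefD coefZ coefX coefC; case: i => [|[|i]] /=.
  - by rewrite mulr0 add0r.
  - by rewrite mulr1 addr0.
  by rewrite mulr0 addr0 nth_default // (leq_trans h1).
have [c0|c0] := eqVneq (h.1)`_1 0.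
  rewrite c0 scale0r add0r in h1.
  have hh : dg h = 0%N.
    by apply/eqP; rewrite -leqn0 dgE // /pole_le h1 h2 size_poly0 size_polyC; case: eqP.
  by move: hs; rewrite hh; case: (P) (Q) => [?|] [?|].
(* Now [h] is a multiple of x - x(S), with divisor S + conj S. Comparing with P + conj Q gives
   [P = Q], whichever of the two points [P] is. *)
have [y oy] := point_over E (- (h.1)`_0 / (h.1)`_1).
set S := (_, y) in oy.
have hS : h = cst E (h.1)`_1 * px E ('X - S.1%:P).
  rewrite {1}hE {1}h1 /cst -rmorphM /=; congr px.
  by rewrite mulrBr mul_polyC -rmorphM /= mulrC divfK // rmorphN opprK.
have dS := divis_XsubC oy.
have hc R : oncv E R -> count_mem (Some R) [:: P; cptp Q] = count_mem (Some R) [:: Some S;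
  Some (cpt E S)].
  by move=> oR; rewrite -dh.2 // -dS.2 // {1}hS ordc_cstM.
have dh2 : dg h = 2%N.
  rewrite {1}hS dgM ?px_eq0 ?polyC_eq0 ?polyXsubC_eq0 // /dg !nrm_px -!rmorphXn /=.
  by rewrite size_polyC expf_neq0 //= size_exp_XsubC.
move: hs hc oP oQ; rewrite dh2.
case: P {df oo dh} => [P|]; case: Q {dg'} => [Q|] //= _ hc oP oQ.
have oS' : oncv E (cpt E S) by rewrite oncv_cpt.
have := hc _ oP; rewrite eqxx /=.
have someE (a b : K * K) : (Some a == Some b) = (a == b) by [].
have cQ : (cpt E Q == cpt E P) -> Some P = Some Q.
  by move/eqP/(can_inj (cptK E)) ->.
have [SP _|SP] := eqVneq S P.
  have := hc _ oS'; rewrite !someE SP eqxx !addn0 => /eqP; rewrite eqn_add2l.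
  by case: (_ =P cpt E P) cQ => //= QP cQ _; apply: cQ.
have [SP' _|SP'] := eqVneq (cpt E S) P.
  have := hc _ oy; rewrite !someE -SP' eqxx !addn0. rewrite addnC => /eqP; rewrite eqn_add2r.
  by case: (cpt E Q =P S) => //= QS _; rewrite -QS cptK.
by rewrite !someE (negPf SP) (negPf SP').
Qed.

(* Cancelling the leading terms of [f] and [g] leaves more zeros than poles. *)
Lemma divis_scale f g Z : all onc Z -> divis f Z -> divis g Z ->
  exists2 c, c != 0 & f = cst E c * g.
Proof.
move=> oZ df dG; have [f0 fZ] := df; have [g0 gZ] := dG.
have ef := divis_dg smoothE oZ df; have eg := divis_dg smoothE oZ dG.
set m := size (affs Z) in ef eg.
have [|||c hc] := @pole_cancel _ _ f g m; rewrite -?dgE ?ef ?eg //.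
  rewrite pole_ltE // -ltnNge -eg /dg prednK // size_poly_gt0 nrm_eq0 //.
have [e|n0] := eqVneq (f - cst E c * g) 0.
  exists c; last by apply/eqP; rewrite -subr_eq0 e.
  by apply: contraNneq f0 => c0; move: e; rewrite c0 rmorph0 mul0r subr0 => ->.
have c0 : cst E c * g != 0 -> c != 0 by apply: contraNneq => ->; rewrite rmorph0 mul0r.
have [s [us os zs sf]] := sum_ord_exists smoothE f0.
have : (dg f <= dg (f - cst E c * g)%R)%N.
  rewrite -sf; apply: leq_trans (sum_ord_le smoothE n0 us os).
  rewrite big_seq [X in (_ <= X)%N]big_seq; apply: leq_sum => P /(allP os) oP.
  apply: ordcD => // hn.
  rewrite ordcN // ordc_cstM ?c0 //; last by rewrite -oppr_eq0.
  by rewrite fZ // gZ.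
rewrite pole_ltE // in hc; rewrite leqNgt ef /dg => /negP[].
by rewrite prednK // size_poly_gt0 nrm_eq0.
Qed.

End DivisorCalculus.

(** * Sums of distinct elements of a dense subset of an abelian group *)

Lemma subset_of_card (T : finType) (X : {set T}) m :
  (m <= #|X|)%N -> exists2 Y : {set T}, Y \subset X & #|Y| = m.
Proof.
move=> mX; exists [set x in take m (enum X)].
  by apply/subsetP=> x; rewrite inE => /mem_take; rewrite mem_enum.
rewrite cardsE; have /card_uniqP -> : uniq (take m (enum X)) by rewrite take_uniq ?enum_uniq.
by rewrite size_take -cardE; case: ltngtP mX.
Qed.

Lemma sum_setU (V : nmodType) (T : finType) (X Y : {set T}) (F : T -> V) :
  [disjoint X & Y] ->
  \sum_(a in X :|: Y) F a = \sum_(a in X) F a + \sum_(a in Y) F a.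
Proof. by move=> XY; rewrite -bigU //; apply: eq_bigl => a; rewrite !inE. Qed.

Section SubsetSums.
Variables (G : finZmodType) (A : {set G}).
Implicit Types (x y z w d : G) (C Q S X : {set G}).
Local Notation n := #|A|.
Local Notation N := #|G|.

Definition reps z := [set a in A | z - a \in A].
(** The doubled element is excluded, so a -> z - a acts without fixed points and the set splits into
    genuine pairs. *)
Definition dreps z := [set a in A | (z - a \in A) && (z - a != a)].

Lemma sum_card_fiber (X : {set G}) (R : G -> G -> bool) (m : nat) :
  (forall a, a \in X -> #|[set z | R z a]| = m) ->
  (\sum_z #|[set a in X | R z a]| = #|X| * m)%N.
Proof.
move=> H; transitivity (\sum_z \sum_(a in X) R z a)%N.
  apply: eq_bigr => z _; rewrite -sum1dep_card big_mkcondr /=.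
  by apply: eq_bigr => a _; case: (R z a).
rewrite exchange_big /= -sum_nat_const; apply: eq_bigr => a aX.
by rewrite -(H a aX) -sum1dep_card [in RHS]big_mkcond; apply: eq_bigr => z _; case: (R z a).
Qed.

Lemma sum_reps : (\sum_z #|reps z| = n * n)%N.
Proof.
apply: (sum_card_fiber (R := fun z a => z - a \in A)) => a _.
rewrite -(card_imset A (addrI a)); apply: eq_card => z; rewrite inE.
apply/idP/imsetP => [h|[b bA ->]]; first by exists (z - a); rewrite // addrC subrK.
by rewrite addrC addKr.
Qed.

Lemma sum_dreps : (\sum_z #|dreps z| = n * n.-1)%N.
Proof.
apply: (sum_card_fiber (R := fun z a => (z - a \in A) && (z - a != a))) => a aA.
have -> : n.-1 = #|A :\ a| by rewrite (cardsD1 a A) aA.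
rewrite -(card_imset (A :\ a) (addrI a)); apply: eq_card => z; rewrite inE.
apply/idP/imsetP => [/andP[h1 h2]|[b]].
  by exists (z - a); rewrite ?inE ?h2 // addrC subrK.
by rewrite !inE => /andP[ba bA] ->; rewrite addrC addKr bA ba.
Qed.

Lemma reps_le z : (#|reps z| <= n)%N.
Proof. by apply: subset_leq_card; apply/subsetP=> a; rewrite inE => /andP[]. Qed.

Lemma sum_shift y (F : G -> nat) : (\sum_a F (y - a)%R = \sum_z F z)%N.
Proof.
rewrite [RHS](reindex_inj (h := fun a => y - a)) //.
by move=> a b /= /addrI /oppr_inj.
Qed.

Lemma card_imset_sub (T U : finType) (f : T -> U) (X : {set T}) (Y : {set U}) :
  (forall u, u \in Y -> exists2 t, t \in X & u = f t) -> (#|Y| <= #|X|)%N.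
Proof.
move=> H; rewrite (leq_trans _ (leq_imset_card f X)) //.
by apply: subset_leq_card; apply/subsetP=> u /H[t tX ->]; apply: imset_f.
Qed.

(** The sum counts ordered triples in [A] with total [y]. At most 3 n of them have two equal entries
    and at most 3 |C| n have an entry in [C], so a good one remains. *)
Lemma triple_avoiding C y :
  (3 * n + 3 * (#|C| * n) < \sum_(a in A) #|reps (y - a)%R|)%N ->
  exists Q, [/\ Q \subset A, [disjoint Q & C], #|Q| = 3 & \sum_(a in Q) a = y].
Proof.
pose T := [set p : G * G | [&& p.1 \in A, p.2 \in A & y - p.1 - p.2 \in A]].
have -> : (\sum_(a in A) #|reps (y - a)%R| = #|T|)%N.
  rewrite -sum1_card (eq_bigl (fun p : G * G => (p.1 \in A) && (p.2 \in reps (y - p.1)))).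
    by rewrite -(pair_big_dep (fun a => a \in A) (fun a b => b \in reps (y - a)) (fun _ _ =>
      1%N)) /=; apply: eq_bigr => a _; rewrite sum1_card.
  by move=> p; rewrite !inE.
pose S1 := [set p in T | p.1 == p.2].
pose S2 := [set p in T | p.2 == y - p.1 - p.2].
pose S3 := [set p in T | p.1 == y - p.1 - p.2].
pose S4 := [set p in T | p.1 \in C].
pose S5 := [set p in T | p.2 \in C].
pose S6 := [set p in T | y - p.1 - p.2 \in C].
move=> big.
have [/existsP[[a b]]|none] := boolP [exists p, p \in T :\: (S1 :|: S2 :|: S3 :|: S4 :|: S5 :|:
  S6)].
  rewrite inE => /andP[bad Tp]; move: bad; rewrite !inE.
  have := Tp; rewrite inE /= => /and3P[-> -> cA] /=; rewrite cA /=.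
  set c := y - a - b in cA *; rewrite -!orbA !negb_or => /and5P[ab bc ac aC /andP[bC cC]].
  have [aA bA] : a \in A /\ b \in A by move: Tp; rewrite inE => /and3P[].
  exists [set a; b; c]; split.
  - by apply/subsetP=> x; rewrite !inE -orbA => /or3P[] /eqP->.
  - rewrite disjoint_subset; apply/subsetP=> x; rewrite !inE -orbA => /or3P[] /eqP-> //.
  - rewrite -setUA cardsU1 cards2 !inE negb_or ab ac /= bc.
    by [].
  - rewrite -setUA big_setU1 ?inE ?negb_or ?ab //= big_setU1 ?inE //= big_set1.
    by rewrite /c addrC [b + _]addrC !subrK.
have sub : T \subset S1 :|: S2 :|: S3 :|: S4 :|: S5 :|: S6.
  rewrite -setD_eq0; apply/eqP/setP=> p; rewrite [RHS]inE; apply/negP=> h.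
  by move/negP: none; apply; apply/existsP; exists p.
have TA p : p \in T -> [/\ p.1 \in A, p.2 \in A & y - p.1 - p.2 \in A].
  by rewrite inE => /and3P[].
have h1 : (#|S1| <= n)%N.
  apply: (@card_imset_sub _ _ (fun a => (a, a))) => -[a b];
    rewrite inE => /andP[/TA[aA _ _] /eqP /= <-].
  by exists a.
have h2 : (#|S2| <= n)%N.
  apply: (@card_imset_sub _ _ (fun b => (y - b - b, b))) => -[a b];
    rewrite inE => /andP[/TA[_ bA _] /eqP /= e].
  exists b => //; congr pair; apply/eqP.
  by rewrite eq_sym !subr_eq -addrA addrC -!subr_eq -e.
have h3 : (#|S3| <= n)%N.
  apply: (@card_imset_sub _ _ (fun a => (a, y - a - a))) => -[a b];
    rewrite inE => /andP[/TA[aA _ _] /eqP /= e].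
  exists a => //; congr pair; apply/eqP.
  by rewrite eq_sym subr_eq [b + a]addrC -subr_eq -e.
have h4 : (#|S4| <= #|C| * n)%N.
  rewrite -cardsX; apply: (@card_imset_sub _ _ id) => -[a b];
    rewrite inE => /andP[/TA[aA bA _] /= aC].
  by exists (a, b); rewrite // inE aC.
have h5 : (#|S5| <= #|C| * n)%N.
  rewrite -cardsX; apply: (@card_imset_sub _ _ (fun p => (p.2, p.1))) => -[a b];
    rewrite inE => /andP[/TA[aA bA _] /= bC].
  by exists (b, a); rewrite // inE bC.
have h6 : (#|S6| <= #|C| * n)%N.
  rewrite -cardsX; apply: (@card_imset_sub _ _ (fun p => (p.2, y - p.2 - p.1))) => -[a b];
    rewrite inE => /andP[/TA[aA bA _] /= cC].
  by exists (y - a - b, a); rewrite ?inE ?cC //= subKr.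
have := leq_trans (subset_leq_card sub) (leq_card_setU _ _).1.
move: (leq_card_setU (S1 :|: S2 :|: S3 :|: S4) S5).1 (leq_card_setU (S1 :|: S2 :|: S3) S4).1
  (leq_card_setU (S1 :|: S2) S3).1 (leq_card_setU S1 S2).1.
lia.
Qed.

Hypothesis dense : (N + 3 <= n.*2)%N.

(** [A] and its translate by [d] each fill more than half of the group, so they meet. *)
Lemma difference d : exists a b, [/\ a \in A, b \in A & a - b = d].
Proof.
have [/existsP[a /andP[aA bA]]|] := boolP [exists a, (a \in A) && (a - d \in A)].
  by exists a, (a - d); rewrite aA bA subKr.
rewrite negb_exists => /forallP h.
have dis : [disjoint A & [set a | a - d \in A]].
  rewrite disjoint_subset; apply/subsetP=> a aA; have := h a.
  by rewrite aA /= !inE.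
have cB : #|[set a | a - d \in A]| = n.
  rewrite -(card_imset A (addrI d)); apply: eq_card => z; rewrite inE.
  apply/idP/imsetP => [hz|[b bA ->]]; first by exists (z - d); rewrite // addrC subrK.
  by rewrite addrC addKr.
have : (#|A :|: [set a | (a - d)%R \in A]| <= N)%N by apply: max_card.
have := cardsUI A [set a | a - d \in A].
rewrite (disjoint_setI0 dis) cards0 cB; move: dense; rewrite -addnn; lia.
Qed.

(* If [w - sum C] is never a sum of three suitable elements, then [w - sum C - A]
   consists of unpopular sums for every [e]-subset [C]; comparing two such [C],
   the complement of [A] almost coincides with each of its translates, which
   averaging over all translates forbids. *)
Lemma few_plus_three_sum e w : (0 < e)%N -> (12 * e.+1 <= n)%N ->
  exists Q, [/\ Q \subset A, #|Q| = (e + 3)%N & \sum_(a in Q) a = w].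
Proof.
move=> e0 en; have [/existsP[Q /and3P[h1 /eqP h2 /eqP h3]]|none] :=
    boolP [exists Q : {set G}, [&& Q \subset A, #|Q| == (e + 3)%N & \sum_(a in Q) a == w]].
  by exists Q.
have few C : C \subset A -> #|C| = e ->
    (\sum_(a in A) #|reps (w - \sum_(c in C) c - a)%R| <= 3 * n + 3 * (e * n))%N.
  move=> CA eC; rewrite leqNgt -eC; apply/negP=> /triple_avoiding[Q [QA QC cQ sQ]].
  case/negP: none; apply/existsP; exists (C :|: Q).
  rewrite subUset CA QA /= cardsU setIC (disjoint_setI0 QC) cards0 subn0 cQ eC eqxx /=.
  by rewrite sum_setU ?(disjoint_sym (mem C)) //= sQ addrC subrK.
(* [k * n] is the bound in [few]. Next, each [d] is written as c - c' with both terms in [A], and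
   [few] is applied to two sets that differ only in exchanging [c] for [c']. *)
pose B := ~: A; pose k := (3 + 3 * e)%N.
have cB : #|B| = (N - n)%N by rewrite cardsCs setCK.
have inter d : (n - k.*2 <= #|[set b in B | (d + b)%R \in B]|)%N.
  have [c [c' [cA c'A <-]]] := difference d.
  have [|C0 C0A cC0] := @subset_of_card _ (A :\: [set c; c']) e.-1.
    rewrite cardsD; have : (#|A :&: [set c; c']| <= 2)%N.
      by rewrite (leq_trans (subset_leq_card (subsetIr _ _))) // cards2; case: eqP.
    by move: e0 en; lia.
  have C0c x : x \in [set c; c'] -> x \notin C0.
    by move=> xc; apply/negP=> /(subsetP C0A); rewrite inE xc.
  have [fc fc'] : (\sum_(a in A) #|reps (w - (c + \sum_(x in C0) x) - a)%R| <= k * n)%N /\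
      (\sum_(a in A) #|reps (w - (c' + \sum_(x in C0) x) - a)%R| <= k * n)%N.
    have C0A' : C0 \subset A by apply: subset_trans C0A (subsetDl _ _).
    split.
      have := few (c |: C0); rewrite subUset sub1set cA C0A' cardsU1 C0c ?inE ?eqxx //.
      rewrite cC0 big_setU1 ?C0c ?inE ?eqxx //=; rewrite /k mulnDl -mulnA; apply=> //; lia.
    have := few (c' |: C0); rewrite subUset sub1set c'A C0A' cardsU1 C0c ?inE ?eqxx ?orbT //.
    rewrite cC0 big_setU1 ?C0c ?inE ?eqxx ?orbT //=; rewrite /k mulnDl -mulnA; apply=> //; lia.
  set s := \sum_(x in C0) x in fc fc'.
  (* The representation counts add up to n^2, and [few] leaves at most k n of them outside [Y y].
     Two such sets therefore share at least n^2 - 2 k n, and as each count is at most n, they have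
     at least n - 2 k common elements. *)
  pose Y y := [set z | y - z \in B].
  have sumY y : (\sum_(a in A) #|reps (y - a)%R| + \sum_(z in Y y) #|reps z| = n * n)%N.
    rewrite -sum_reps -(sum_shift y) [RHS](bigID (mem A)) /=; congr addn.
    rewrite big_mkcond [RHS]big_mkcond -(sum_shift y) /=; apply: eq_bigr => a _.
    by rewrite !inE opprB addrC subrK.
  have YY : (#|Y (w - (c + s))%R :&: Y (w - (c' + s))%R| = #|[set b in B | (c - c' +
    b)%R \in B]|)%N.
    rewrite -(card_imset [set b in B | c - c' + b \in B] (f := fun b => w - (c + s) - b));
      last by move=> a b /addrI /oppr_inj.
    have aux z : c - c' + (w - (c + s) - z) = w - (c' + s) - z.
      rewrite !opprD !addrA; congr (_ - s - z).
      by rewrite [_ + w]addrC [c - c']addrC addrA addrK.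
    apply: eq_card => z; rewrite inE; apply/andP/imsetP.
      rewrite !inE => -[h1 h2]; exists (w - (c + s) - z); last by rewrite subKr.
      by rewrite !inE h1 /= aux.
    by case=> b; rewrite !inE => /andP[h1 h2] ->; rewrite -aux !subKr.
  have bd : (\sum_(z in Y (w - (c + s))%R :&: Y (w - (c' + s))%R) #|reps z| <=
      #|[set b in B | (c - c' + b)%R \in B]| * n)%N.
    by rewrite -YY -sum_nat_const; apply: leq_sum => z _; apply: reps_le.
  have ie : (\sum_(z in Y (w - (c + s))%R) #|reps z| + \sum_(z in Y (w - (c' + s))%R) #|reps z|
      <= \sum_(z in Y (w - (c + s))%R :&: Y (w - (c' + s))%R) #|reps z| + n * n)%N.
    rewrite -sum_reps [X in (X + _ <= _)%N]big_mkcond [X in (_ + X <= _)%N]big_mkcond.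
    rewrite [X in (_ <= X + _)%N]big_mkcond -!big_split /=; apply: leq_sum => z _.
    rewrite in_setI; case: (z \in Y (w - (c + s))%R); case: (z \in Y (w - (c' + s))%R) => /=; lia.
  have n0 : (0 < n)%N by apply/card_gt0P; exists c.
  rewrite -(leq_pmul2r n0) mulnBl -addnn.
  move: (sumY (w - (c + s))%R) (sumY (w - (c' + s))%R) => h1 h2.
  rewrite mulnDl; lia.
(* Summing over all [d] counts each pair in [B] once. The constant 12 comes from 4 k = 12 (e + 1):
   it gives n - 2 k >= n / 2, hence N n / 2 <= |B|^2, impossible because |B| = N - n < n. *)
have : (N * (n - k.*2) <= #|B| * #|B|)%N.
  rewrite -(sum_card_fiber (X := B) (R := fun d b => d + b \in B)).
    by rewrite -sum_nat_const; apply: leq_sum => d _; apply: inter.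
  move=> b bB; rewrite -(card_imset B (addIr (- b))); apply: eq_card => z.
  rewrite inE; apply/idP/imsetP => [zB|[x xB ->]]; last by rewrite subrK.
  by exists (z + b); rewrite // addrK.
rewrite cB /k -!addnn; have : (n <= N)%N by apply: max_card.
move: en dense.
move: #|_| #|G| => m M; rewrite -addnn => h1 h2 h3 h4.
have [b eM] : exists b, M = (m + b)%N by exists (M - m)%N; rewrite subnKC.
subst M.
have [c em] : exists c, m = (12 * e.+1 + c)%N by exists (m - 12 * e.+1)%N; rewrite subnKC.
have hb : (b + 3 <= m)%N by lia.
have e2 : (m + b - m = b)%N by lia.
rewrite e2 in h4.
have e3 : (m - (3 + 3 * e + (3 + 3 * e)) = 6 * e.+1 + c)%N by lia.
rewrite e3 in h4; nia.
Qed.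

Lemma paired_sum x X j : (forall a, a \in X -> (x - a \in X) && (x - a != a)) ->
  (j.*2 <= #|X|)%N ->
  exists S, [/\ S \subset X, #|S| = j.*2 & \sum_(a in S) a = x *+ j].
Proof.
elim: j X => [|j IH] X HX jX.
  by exists set0; rewrite sub0set cards0 big_set0.
have /card_gt0P[a aX] : (0 < #|X|)%N by apply: leq_trans jX.
have /andP[bX ba] := HX a aX; set b := x - a in bX ba.
have ab : a \notin [set b] by rewrite inE eq_sym.
have cX : #|X :\: [set a; b]| = (#|X| - 2)%N.
  rewrite cardsD (setIidPr _) ?cards2 1?eq_sym ?ba //.
  by apply/subsetP=> z; rewrite !inE => /orP[] /eqP->.
have [||S [SX cS sS]] := IH (X :\: [set a; b]).
- move=> z; rewrite !inE negb_or => /andP[/andP[za zb] zX].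
  have /andP[-> ->] := HX z zX; rewrite !andbT negb_or; apply/andP; split.
    by apply: contra zb => /eqP e; rewrite /b -e subKr.
  by apply: contra za => /eqP; rewrite /b => /addrI /oppr_inj ->.
- by rewrite cX; lia.
have dS z : z \in [set a; b] -> z \notin S.
  by move=> zab; apply/negP=> /(subsetP SX); rewrite inE zab.
have aS : a \notin b |: S by rewrite !inE negb_or eq_sym ba dS ?inE ?eqxx.
have bS : b \notin S by rewrite dS ?inE ?eqxx ?orbT.
exists (a |: (b |: S)); split.
- rewrite !subUset !sub1set aX bX; apply: subset_trans SX (subsetDl _ _).
- by rewrite cardsU1 aS cardsU1 bS cS.
- by rewrite !big_setU1 //= sS addrA [a + b]addrC /b subrK mulrS.
Qed.

(* Elements in pairs of sum [x] contribute a known sum wherever they are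
   taken, so the few remaining elements can be chosen first. *)
Lemma extend_by_pairs x g j Q C : Q \subset A -> C \subset A -> [disjoint Q & C] ->
  [disjoint C & dreps x] ->
  \sum_(a in Q) a + \sum_(a in C) a = g - x *+ j ->
  (j.*2 + #|Q|.*2 <= #|dreps x|)%N ->
  exists S, [/\ S \subset A, #|S| = (#|Q| + #|C| + j.*2)%N & \sum_(a in S) a = g].
Proof.
(* Removing [Q] together with its reflection leaves a union of whole pairs, at the price of at most
   2 |Q| elements. [C] costs nothing, as it is disjoint from the pairs. *)
move=> QA CA QC Cx sQC big; pose Q' := Q :|: [set x - a | a in Q].
have cQ' : (#|Q'| <= #|Q|.*2)%N.
  rewrite -addnn; apply: leq_trans (leq_card_setU _ _).1 _.
  by rewrite leq_add2l leq_imset_card.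
have Q'x a : a \in Q' -> x - a \in Q'.
  rewrite !inE => /orP[aQ|/imsetP[b bQ ->]].
    by apply/orP; right; apply/imsetP; exists a.
  by rewrite opprB addrC subrK bQ.
have [||S [SX cS sS]] := @paired_sum x (dreps x :\: Q') j.
- move=> a; rewrite !in_setD => /andP[aQ]; rewrite inE => /and3P[aA bA ba].
  rewrite ba andbT [X in _ && X]inE bA subKr aA eq_sym ba !andbT.
  by apply: contra aQ => /Q'x; rewrite subKr.
- rewrite cardsD; have := subset_leq_card (subsetIr (dreps x) Q'); lia.
have Sx : S \subset dreps x by apply: subset_trans SX (subsetDl _ _).
have SQ : [disjoint S & Q].
  rewrite disjoint_subset; apply/subsetP=> a /(subsetP SX); rewrite !inE negb_or.
  by case/andP=> /andP[].
have SC : [disjoint S & C].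
  by apply: disjointWl Sx _; rewrite disjoint_sym.
have SQC : [disjoint S & Q :|: C].
  by rewrite disjoint_subset; apply/subsetP=> a aS;
    rewrite !inE (disjointFr SQ aS) (disjointFr SC aS).
exists (Q :|: C :|: S); split.
- rewrite !subUset QA CA; apply: subset_trans Sx _.
  by apply/subsetP=> a; rewrite inE => /andP[].
- rewrite cardsU setIC (disjoint_setI0 SQC) cards0 subn0 cardsU (disjoint_setI0 QC).
  by rewrite cards0 subn0 cS.
- by rewrite !sum_setU // 1?disjoint_sym // sQC sS subrK.
Qed.

(* Take [x] with the most representations. When its pairs do not suffice, every
   [z] has at most [k + 4] representations, so almost all have many, and up to
   four elements outside the pairs of [x] and a triple complete the sum. *)
Lemma subset_sum_half k g : (50 <= n)%N -> (4 <= k)%N -> (k.*2 <= n)%N ->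
  exists S, [/\ S \subset A, #|S| = k & \sum_(a in S) a = g].
Proof.
move=> n69 k4 kn; case: (arg_maxnP (fun x => #|dreps x|) (erefl true : xpredT (0 : G))) =>
  x _ xmax.
have avg : (n * n.-1 <= N * #|dreps x|)%N.
  by rewrite -sum_dreps -sum_nat_const; apply: leq_sum => z _; apply: xmax.
(* [e] is 1 or 2, chosen so that e + 3 has the parity of [k] and the remaining elements can be taken
   in pairs. *)
pose e := (odd k).+1; pose j := ((k - (e + 3))./2).
have ek : k = (j.*2 + (e + 3))%N.
  by rewrite /j /e; move: k4; case: (boolP (odd k)); lia.
have [big|small] := leqP (j.*2 + (e + 3).*2) #|dreps x|.
  have [||Q [QA cQ sQ]] := @few_plus_three_sum e (g - x *+ j); rewrite /e //; first by lia.
  have [||||||S [SA cS sS]] := @extend_by_pairs x g j Q set0 => //.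
  - exact: sub0set.
  - by rewrite disjoint_sym; apply: eq_disjoint0 => a; rewrite inE.
  - by apply: eq_disjoint0 => a; rewrite inE.
  - by rewrite big_set0 addr0.
  - by rewrite cQ.
  by exists S; split=> //; rewrite cS cQ cards0 [RHS]ek; lia.
(* In this case the maximum is below k + e + 3, and e + 3 is at most 5. *)
have M1 z : (#|dreps z| <= k + 4)%N.
  have := xmax z isT; move: small; rewrite [in X in _ -> _ -> X]ek /e; case: (odd k); lia.
(* From n (n - 1) <= N M and N <= 2 n - 3: the margin 3 in [dense] is exactly what makes the average
   exceed n / 2. *)
have M2 : (n < #|dreps x|.*2)%N.
  have NM : (N * #|dreps x| <= (n.*2 - 3) * #|dreps x|)%N.
    by rewrite leq_mul2r; apply/orP; right; move: dense; lia.
  have := leq_trans avg NM; move: n69; move: #|dreps x| #|_| => M m.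
  case: m => [|m] //= m69; rewrite -!addnn => h; nia.
(* Again c0 + 3 has the parity of [k]. With c0 at least 3, the pairs still needed and the room lost
   to a triple take k - c0 + 3 <= k elements, and [dreps x] has more than n / 2 >= k. *)
pose c0 := (3 + odd k)%N; pose j' := ((k - (c0 + 3))./2).
have k7 : (22 <= k)%N by have := M1 x; move: M2 n69; lia.
have ek' : k = (j'.*2 + (c0 + 3))%N.
  by rewrite /j' /c0; move: k7; case: (boolP (odd k)); lia.
have xA : dreps x \subset A by apply/subsetP=> a; rewrite inE => /andP[].
have [|C CA cC] := @subset_of_card _ (A :\: dreps x) c0.
  rewrite cardsD (setIidPr xA); have := M1 x; rewrite /c0; move: n69 kn; case: (odd k); lia.
have CA' : C \subset A by apply: subset_trans CA (subsetDl _ _).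
pose w := g - x *+ j' - \sum_(a in C) a.
have c04 : (c0 <= 4)%N by rewrite /c0; case: (odd k).
(* [F] has at most 5 elements and so does its reflection [F']. Eleven representations thus leave one
   in which [b] and w - a - b both avoid [F]. *)
have [/existsP[a /andP[aAC wa]]|none] := boolP [exists a, (a \in A :\: C) &&
  (11 <= #|dreps (w - a)%R|)%N].
  move: aAC; rewrite in_setD => /andP[aC aA].
  pose F := a |: C; pose F' := [set w - a - z | z in F].
  have cF : (#|F :|: F'| <= 10)%N.
    have cF0 : #|F| = c0.+1 by rewrite cardsU1 aC cC.
    apply: leq_trans (leq_card_setU _ _).1 _.
    have : (#|F'| <= #|F|)%N by apply: leq_imset_card.
    by rewrite cF0 => h; rewrite (@leq_trans (5 + 5)) // leq_add // (leq_trans h).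
  have /card_gt0P[b] : (0 < #|dreps (w - a)%R :\: (F :|: F')|)%N.
    by rewrite cardsD; have := subset_leq_card (subsetIr (dreps (w - a)%R) (F :|: F')); lia.
  rewrite in_setD in_setU negb_or => /andP[/andP[bF bF']]; rewrite inE => /and3P[bA cA cb].
  set c := w - a - b in cA cb.
  have cF1 : c \notin F.
    by apply: contra bF' => cF'; apply/imsetP; exists c => //; rewrite subKr.
  move: bF cF1; rewrite !in_setU1 !negb_or => /andP[ba bC] /andP[ca cC'].
  have bc : b \notin [set c] by rewrite inE eq_sym.
  have abc : a \notin [set b; c] by rewrite !inE negb_or eq_sym ba eq_sym.
  have c3 : #|[set a; b; c]| = 3.
    by rewrite -setUA cardsU1 abc cards2; move: bc; rewrite inE => ->.
  have [||||||S [SA cS sS]] := @extend_by_pairs x g j' [set a; b; c] C => //.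
  - by apply/subsetP=> z; rewrite !inE -orbA => /or3P[] /eqP->.
  - by rewrite disjoint_subset; apply/subsetP=> z; rewrite !inE -orbA => /or3P[] /eqP->.
  - by rewrite disjoint_subset; apply/subsetP=> z /(subsetP CA); rewrite !in_setD => /andP[].
  - by rewrite -setUA big_setU1 //= big_setU1 //= big_set1 [a + _]addrC [b + _]addrC !subrK.
  - rewrite c3; have c03 : (3 <= c0)%N by rewrite /c0 leq_addr.
    by move: M2 ek' kn c03; clearbody c0 j'; clear; lia.
  exists S; split=> //; rewrite cS c3 cC [RHS]ek'.
  by clearbody c0 j'; clear; lia.
have sm a : a \in A :\: C -> (#|dreps (w - a)%R| <= 10)%N.
  move=> aAC; rewrite leqNgt; apply: contra none => h; apply/existsP; exists a.
  by rewrite aAC.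
(* Otherwise the total n (n - 1) is at most 10 n plus k + 4 for each of at most n + 1 other
   elements. Since 2 k <= n, this gives n^2 <= 31 n + 8, too small for n >= 50. *)
have : (n * n.-1 <= 10 * n + (k + 4) * (N - (n - c0)))%N.
  have cAC : #|A :\: C| = (n - c0)%N by rewrite cardsD (setIidPr CA') cC.
  rewrite -sum_dreps -(sum_shift w) (bigID (mem (A :\: C))) /=; apply: leq_add.
    apply: (@leq_trans (\sum_(a in A :\: C) 10)); first exact: leq_sum.
    by rewrite sum_nat_const cAC mulnC leq_mul2l leq_subr.
  apply: (@leq_trans (\sum_(a in ~: (A :\: C)) (k + 4))); last first.
    by rewrite sum_nat_const [#|~: _|]cardsCs setCK cAC mulnC.
  rewrite [X in (_ <= X)%N](eq_bigl (fun a => a \notin A :\: C)) ?leq_sum //.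
  by move=> a; rewrite in_setC.
move: dense n69 kn c04; move: #|_| #|G| => m M dM m69 km c4.
have hM : (M - (m - c0) <= m.+1)%N by lia.
move=> h; have {}h : (m * m.-1 <= 10 * m + (k + 4) * m.+1)%N.
  by apply: leq_trans h _; rewrite leq_add2l leq_mul2l hM orbT.
have h2 : ((k + 4).*2 * m.+1 <= (m + 8) * m.+1)%N by rewrite leq_mul2r; lia.
have {h2} h : (2 * (m * m.-1) <= 20 * m + (m + 8) * m.+1)%N.
  move: h2; rewrite -mul2n -mulnA => h2.
  have : (2 * (m * m.-1) <= 2 * (10 * m + (k + 4) * m.+1))%N by rewrite leq_mul2l h.
  by move/leq_trans; apply; rewrite mulnDr mulnA leq_add2l.
case: m m69 h {dM km hM} => // m m69 /=.
have : (49 * m <= m * m)%N by rewrite leq_mul2r; move: m69; lia.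
rewrite !(mulnDl, mulnDr, mulSn, mulnS); move: (m * m)%N m69; clear; lia.
Qed.

(** When [k] exceeds half of [A], the complement is chosen instead, with the complementary sum; this
    is where [k + 4 <= n] enters. *)
Lemma subset_sum k g : (50 <= n)%N -> (4 <= k)%N -> (k + 4 <= n)%N ->
  exists S, [/\ S \subset A, #|S| = k & \sum_(a in S) a = g].
Proof.
move=> n69 k4 kn; have [kh|kh] := leqP k.*2 n; first exact: subset_sum_half.
have [||| S [SA cS sS]] := @subset_sum_half (n - k) (\sum_(a in A) a - g) => //; try lia.
exists (A :\: S); split; first exact: subsetDl.
  by rewrite cardsD (setIidPr SA) cS subKn //; lia.
have : \sum_(a in A :\: S) a + \sum_(a in S) a = \sum_(a in A) a.
  by rewrite [RHS](big_setID S) /= (setIidPr SA) addrC.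
by rewrite sS => /(canRL (addrK _)) ->; rewrite opprB addrC subrK.
Qed.

End SubsetSums.

(** * Forms and their restriction to the curve *)

Definition i0 : 'I_3 := @Ordinal 3 0 isT.
Definition i1 : 'I_3 := @Ordinal 3 1 isT.
Definition i2 : 'I_3 := @Ordinal 3 2 isT.

Lemma I3P (Pr : 'I_3 -> Prop) : Pr i0 -> Pr i1 -> Pr i2 -> forall i, Pr i.
Proof.
move=> h0 h1 h2 [[|[|[|//]]] lt]; [move: h0|move: h1|move: h2];
  by congr (Pr _); apply: val_inj.
Qed.

Lemma big_I3 (T : Type) (idx : T) (op : Monoid.law idx) (F : 'I_3 -> T) :
  \big[op/idx]_i F i = op (op (F i0) (F i1)) (F i2).
Proof.
rewrite !big_ord_recl big_ord0 Monoid.mulm1 Monoid.mulmA.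
by congr (op (op (F _) (F _)) (F _)); apply: val_inj.
Qed.

Lemma mdeg3 (m : 'X_{1..3}) : mdeg m = (m i0 + m i1 + m i2)%N.
Proof. by rewrite mdegE (big_I3 addn). Qed.

Lemma mmap1_3 (S : comNzRingType) (h : 'I_3 -> S) (m : 'X_{1..3}) :
  mmap1 h m = h i0 ^+ m i0 * h i1 ^+ m i1 * h i2 ^+ m i2.
Proof. by rewrite /mmap1 (big_I3 *%R). Qed.

Lemma mmap_var n (R : nzRingType) (S : comNzRingType) (f : {rmorphism R -> S})
  (h : 'I_n -> S) i : mmap f h 'X_i = h i.
Proof. by rewrite mmapX mmap1U. Qed.

Lemma mmap_comp_mpoly n k (R S : comNzRingType) (f : {rmorphism R -> S})
  (h : 'I_k -> S) (p : {mpoly R[n]}) (lq : n.-tuple {mpoly R[k]}) :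
  mmap f h (p \mPo lq) = mmap f (fun i => mmap f h (tnth lq i)) p.
Proof.
rewrite comp_mpolyEX raddf_sum [RHS]/mmap /=; apply: eq_bigr => m _.
rewrite mmapZ comp_mpolyX rmorph_prod; congr (_ * _).
by apply: eq_bigr => i _; rewrite rmorphXn.
Qed.

(** Taylor expansion at [v]: it exposes the coefficients about which [mult_ge] speaks. *)
Lemma mmap_shift n (R S : comNzRingType) (f : {rmorphism R -> S})
  (h : 'I_n -> S) (p : {mpoly R[n]}) (v : 'I_n -> R) :
  mmap f h p =
  mmap f (fun i => h i - f (v i)) (p \mPo [tuple 'X_i + (v i)%:MP | i < n]).
Proof.
rewrite mmap_comp_mpoly /mmap; apply: eq_bigr => m _; congr (_ * _).
rewrite /mmap1; apply: eq_bigr => i _; congr (_ ^+ _).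
by rewrite tnth_mktuple -/(mmap _ _ _) rmorphD /= mmap_var mmapC subrK.
Qed.

Section Multiplicity.
Variable K : comNzRingType.
Implicit Types (S T : {mpoly K[3]}) (p : 'I_3 -> K).

Lemma mult_ge_leq T p m n : (m <= n)%N -> mult_ge T p n -> mult_ge T p m.
Proof. by move=> mn h k km; apply: h; apply: leq_trans mn. Qed.

Lemma mult_geD S T p m : mult_ge S p m -> mult_ge T p m -> mult_ge (S + T) p m.
Proof. by move=> h1 h2 k km; rewrite comp_mpolyD mcoeffD h1 ?h2 ?addr0. Qed.

Lemma mult_geM S T p a b : mult_ge S p a -> mult_ge T p b -> mult_ge (S * T) p (a + b).
Proof.
move=> hS hT k kab; rewrite rmorphM /= mcoeffM big1 // => -[[k1 k1b] [k2 k2b]] /= /eqP kE.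
have [ka|ka] := ltnP (mdeg k1) a; first by rewrite hS ?mul0r.
rewrite hT ?mulr0 // -(ltn_add2l a) (leq_ltn_trans _ kab) // kE mdegD leq_add2r //.
Qed.

Lemma mult_ge_any T p : mult_ge T p 0.
Proof. by []. Qed.

Lemma mult_geX T p n : mult_ge T p 1 -> mult_ge (T ^+ n) p n.
Proof.
move=> h; elim: n => [|n IH]; first exact: mult_ge_any.
by rewrite exprS; apply: (mult_geM h IH).
Qed.

Lemma mcoeff0_meval T : T@_0 = T.@[fun=> 0].
Proof.
have z (m : 'X_{1..3}) : m != 0%MM -> mmap1 (fun=> 0 : K) m = 0.
  move=> m0; rewrite mmap1_3; apply/eqP; move: m0; apply: contraNT.
  move: (m i0) (m i1) (m i2) (mdeg3 m) (mdeg_eq0 m) => [|a] [|b] [|c] -> <- //;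
    by rewrite !exprS ?(mul0r, mulr0) eqxx.
rewrite /meval /mmap; have [h|h] := boolP (0%MM \in msupp T).
  by rewrite (bigD1_seq 0%MM) //= mmap11 mulr1 big1 ?addr0 // => m /z ->; rewrite mulr0.
rewrite memN_msupp_eq0 // big1_seq // => m /= mq; rewrite z ?mulr0 //.
by apply: contraNneq h => <-.
Qed.

Lemma mult_ge1 T p : T.@[p] = 0 -> mult_ge T p 1.
Proof.
move=> Tp k; rewrite ltnS leqn0 mdeg_eq0 => /eqP ->.
rewrite mcoeff0_meval comp_mpoly_meval -[RHS]Tp; apply: meval_eq => i.
by rewrite tnth_mktuple mevalD mevalXU mevalC add0r.
Qed.

End Multiplicity.

Section Forms.
Variables (K : fieldType) (E : wcoef K).
Implicit Types (S T B C Q R : {mpoly K[3]}) (f g : crd E).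

Local Notation W := (weierstrass (wa1 E) (wa2 E) (wa3 E) (wa4 E) (wa6 E)).

Definition aff (i : 'I_3) : crd E := nth 0 [:: xc E; yc E; 1] i.

(* Dehomogenisation [X2 = 1] followed by reduction modulo the curve equation. *)
Fact rho_key : unit. Proof. exact: Datatypes.tt. Qed.
Definition rho : {mpoly K[3]} -> crd E := locked_with rho_key (mmap (cst E) aff).

Lemma rhoE T : rho T = mmap (cst E) aff T.
Proof. by rewrite /rho unlock. Qed.

Fact rho_is_zmod_morphism : zmod_morphism rho.
Proof. by move=> S T; rewrite !rhoE rmorphB. Qed.
Fact rho_is_monoid_morphism : monoid_morphism rho.
Proof. by split=> [|S T]; rewrite !rhoE ?rmorph1 ?rmorphM. Qed.
HB.instance Definition _ :=
  GRing.isZmodMorphism.Build {mpoly K[3]} (crd E) rho rho_is_zmod_morphism.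
HB.instance Definition _ :=
  GRing.isMonoidMorphism.Build {mpoly K[3]} (crd E) rho rho_is_monoid_morphism.

Lemma rho_X0 : rho X0 = xc E. Proof. by rewrite rhoE; apply: mmap_var. Qed.
Lemma rho_X1 : rho X1 = yc E. Proof. by rewrite rhoE; apply: mmap_var. Qed.
Lemma rho_X2 : rho X2 = 1. Proof. by rewrite rhoE; apply: mmap_var. Qed.
Lemma rhoC c : rho c%:MP = cst E c. Proof. by rewrite rhoE; apply: mmapC. Qed.
Lemma rhoM S T : rho (S * T) = rho S * rho T. Proof. exact: rmorphM. Qed.
Lemma rhoB S T : rho (S - T) = rho S - rho T. Proof. exact: rmorphB. Qed.

Lemma rho_W : rho W = 0.
Proof.
rewrite /weierstrass !(rmorphD, rmorphN, rmorphM, rmorphXn) /= !rhoC rho_X0 rho_X1 rho_X2.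
have h := yc2 E; rewrite -expr2 in h; ring: h.
Qed.

Definition mon i j l : {mpoly K[3]} := X0 ^+ i * X1 ^+ j * X2 ^+ l.

Lemma monE (m : 'X_{1..3}) : 'X_[m] = mon (m i0) (m i1) (m i2).
Proof. by rewrite mpolyXE_id (big_I3 *%R). Qed.

Lemma rho_mon i j l : rho (mon i j l) = xc E ^+ i * yc E ^+ j.
Proof. by rewrite !rmorphM !rmorphXn /= rho_X0 rho_X1 rho_X2 expr1n mulr1. Qed.

Lemma homogX (i : 'I_3) : ('X_i : {mpoly K[3]}) \is 1.-homog.
Proof. by rewrite dhomogX; apply/eqP/mdeg1. Qed.

Lemma homogXn T d n : T \is d.-homog -> T ^+ n \is (d * n).-homog.
Proof. exact: dhomogMn. Qed.

Lemma homog_mon i j l : mon i j l \is (i + j + l).-homog.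
Proof.
have h (t : 'I_3) n : ('X_t : {mpoly K[3]}) ^+ n \is n.-homog.
  by have := homogXn n (homogX t); rewrite mul1n.
exact: dhomogM (dhomogM (h _ _) (h _ _)) (h _ _).
Qed.

Lemma homog_cM c T d : T \is d.-homog -> c%:MP * T \is d.-homog.
Proof. by move=> hT; rewrite mul_mpolyC dhomogZ. Qed.

Lemma homog_W : W \is 3.-homog.
Proof.
have h i j l : (i + j + l = 3)%N -> forall c, c%:MP * mon i j l \is 3.-homog.
  by move=> e c; have := homog_cM c (homog_mon i j l); rewrite e.
have -> : W = 1%:MP * mon 0 2 1 + (wa1 E)%:MP * mon 1 1 1 + (wa3 E)%:MP * mon 0 1 2
  + (-1)%:MP * mon 3 0 0 + (- wa2 E)%:MP * mon 2 0 1 + (- wa4 E)%:MP * mon 1 0 2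
  + (- wa6 E)%:MP * mon 0 0 3.
  rewrite /weierstrass /mon !mpolyCN mpolyC1; ring.
by do !apply: dhomogD; apply: h.
Qed.

Lemma homog_deg d T (m : 'X_{1..3}) : T \is d.-homog -> m \in msupp T ->
  (m i0 + m i1 + m i2)%N = d.
Proof. by move=> /dhomogP h /h <-; rewrite -mdeg3. Qed.

Lemma form_ind d (Pr : {mpoly K[3]} -> Prop) :
  Pr 0 -> (forall S T, Pr S -> Pr T -> Pr (S + T)) ->
  (forall c i j l, (i + j + l = d)%N -> Pr (c%:MP * mon i j l)) ->
  forall T, T \is d.-homog -> Pr T.
Proof.
move=> P0 PD Pm T /dhomogP hT; rewrite [T]mpolyE big_seq.
elim/big_ind: _ => // m mT; rewrite monE -mul_mpolyC; apply: Pm.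
by rewrite -(hT _ mT) -mdeg3.
Qed.

(** Normal forms modulo [W], whose equation rewrites X0^3 into terms of lower degree in X0. *)
Definition reduced R := forall m : 'X_{1..3}, m \in msupp R -> (m i0 < 3)%N.

Lemma reducedD S T : reduced S -> reduced T -> reduced (S + T).
Proof. by move=> hS hT m /msuppD_le; rewrite mem_cat => /orP[/hS|/hT]. Qed.

Lemma reduced_mon c i j l : (i < 3)%N -> reduced (c%:MP * mon i j l).
Proof.
move=> i3 m; pose mm : 'X_{1..3} := [multinom nth 0%N [:: i; j; l] k | k < 3].
have -> : mon i j l = 'X_[mm] by rewrite monE !mnmE.
by rewrite mul_mpolyC => /msuppZ_le; rewrite msuppX inE => /eqP ->; rewrite mnmE.
Qed.

Lemma reduce d T : T \is d.-homog -> exists Q R,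
  [/\ T = Q * W + R, R \is d.-homog & reduced R].
Proof.
move: T; apply: form_ind.
- by exists 0, 0; rewrite mul0r addr0 dhomog0; split=> // m; rewrite msupp0.
- move=> S T [Q [R [-> hR rR]]] [Q' [R' [-> hR' rR']]]; exists (Q + Q'), (R + R').
  by split; [ring|exact: dhomogD|exact: reducedD].
move=> c i; elim/ltn_ind: i c => i IH c j l ed.
have [i3|i3] := ltnP i 3.
  exists 0, (c%:MP * mon i j l); rewrite mul0r add0r; split=> //.
    by rewrite -ed; apply/homog_cM/homog_mon.
  exact: reduced_mon.
have [k ik] : exists k, i = (k + 3)%N by exists (i - 3)%N; rewrite subnK.
have H a b e t : (a + b + e = 3)%N -> (a < 3)%N -> exists Q R,
    [/\ t%:MP * mon (k + a) (j + b) (l + e) = Q * W + R, R \is d.-homog & reduced R].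
  by move=> abe a3; apply: IH; rewrite ?ik ?ltn_add2l // -ed ik; lia.
have [Q1 [R1 [h1 H1 r1]]] := H 0%N 2%N 1%N c erefl isT.
have [Q2 [R2 [h2 H2 r2]]] := H 1%N 1%N 1%N (c * wa1 E) erefl isT.
have [Q3 [R3 [h3 H3 r3]]] := H 0%N 1%N 2%N (c * wa3 E) erefl isT.
have [Q4 [R4 [h4 H4 r4]]] := H 2%N 0%N 1%N (- (c * wa2 E)) erefl isT.
have [Q5 [R5 [h5 H5 r5]]] := H 1%N 0%N 2%N (- (c * wa4 E)) erefl isT.
have [Q6 [R6 [h6 H6 r6]]] := H 0%N 0%N 3%N (- (c * wa6 E)) erefl isT.
exists (- (c%:MP * mon k j l) + Q1 + Q2 + Q3 + Q4 + Q5 + Q6), (R1 + R2 + R3 + R4 + R5 + R6).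
split; [|by do !apply: dhomogD|by do !apply: reducedD].
have -> : c%:MP * mon i j l = - (c%:MP * mon k j l) * W
  + c%:MP * mon (k + 0) (j + 2) (l + 1) + (c * wa1 E)%:MP * mon (k + 1) (j + 1) (l + 1)
  + (c * wa3 E)%:MP * mon (k + 0) (j + 1) (l + 2) + (- (c * wa2 E))%:MP * mon (k + 2) (j +
    0) (l + 1)
  + (- (c * wa4 E))%:MP * mon (k + 1) (j + 0) (l + 2) + (- (c * wa6 E))%:MP * mon (k + 0) (j +
    0) (l + 3).
  by rewrite /mon /weierstrass ik !exprD !mpolyCN !mpolyCM; ring.
by rewrite h1 h2 h3 h4 h5 h6; ring.
Qed.

Lemma dg_xc : dg (xc E) = 2.
Proof. by rewrite /dg nrm_px size_polyXn. Qed.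
Lemma dg_yc : dg (yc E) = 3.
Proof.
rewrite /dg; have -> : nrm (yc E) = - wcub E by rewrite /nrm /=; ring.
by rewrite size_polyN size_wcub.
Qed.
Lemma xc_neq0 : xc E != 0. Proof. by rewrite px_eq0 polyX_eq0. Qed.
Lemma yc_neq0 : yc E != 0. Proof. by rewrite crd_eq0 oner_eq0 andbF. Qed.

Lemma dg1 : dg (1 : crd E) = 0%N.
Proof. by rewrite /dg -(rmorph1 (px E)) nrm_px expr1n size_poly1. Qed.
Lemma dgX f n : f != 0 -> dg (f ^+ n) = (n * dg f)%N.
Proof.
move=> f0; elim: n => [|n IH]; first by rewrite expr0 dg1.
by rewrite exprS dgM ?crd_expf_neq0 // IH mulSn.
Qed.

Definition xy i j : crd E := xc E ^+ i * yc E ^+ j.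
Lemma xy_neq0 i j : xy i j != 0.
Proof. by rewrite crd_mul_eq0 negb_or !crd_expf_neq0 ?xc_neq0 ?yc_neq0. Qed.
Lemma dg_xy i j : dg (xy i j) = (2 * i + 3 * j)%N.
Proof.
by rewrite dgM ?crd_expf_neq0 ?xc_neq0 ?yc_neq0 // !dgX ?xc_neq0 ?yc_neq0 // dg_xc dg_yc mulnC [(j * _)%N]mulnC.
Qed.

Lemma pole_lt_dg f m : f != 0 -> pole_lt f m = (dg f < m)%N.
Proof. by move=> f0; rewrite pole_ltE // /dg prednK // size_poly_gt0 nrm_eq0. Qed.

Lemma pole_le0 m : pole_le (0 : crd E) m.
Proof. by rewrite /pole_le /= size_poly0. Qed.

Lemma pole_le_xy i j m : pole_le (xy i j) m = (2 * i + 3 * j <= m)%N.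
Proof. by rewrite -dgE ?xy_neq0 // dg_xy. Qed.

Lemma pcoef_lt f m : pole_lt f m -> pcoef m f = 0.
Proof.
case/andP=> h1 h2; rewrite /pcoef; case: ifP => om; rewrite nth_default //.
  by apply: leq_trans h2 _; move: om; case: m {h1} => [|[|[|m]]] // om; rewrite subSS; lia.
by apply: leq_trans h1 _; rewrite uphalf_half om.
Qed.

Lemma pcoef_xy i j : pcoef (2 * i + 3 * j) (xy i j) != 0.
Proof.
apply/eqP=> /(pole_le_lt (_ : pole_le (xy i j) _)); rewrite pole_le_xy leqnn => /(_ isT).
by rewrite pole_lt_dg ?xy_neq0 // dg_xy ltnn.
Qed.

Lemma pcoef_xy_lt i j m : (2 * i + 3 * j < m)%N -> pcoef m (xy i j) = 0.
Proof. by move=> h; apply: pcoef_lt; rewrite pole_lt_dg ?xy_neq0 // dg_xy. Qed.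

Lemma rho_sum T : rho T = \sum_(m <- msupp T) cst E T@_m * xy (m i0) (m i1).
Proof.
by rewrite rhoE; apply: eq_bigr => m _; rewrite mmap1_3 /aff /= expr1n mulr1.
Qed.

Lemma pcoef_rho T k : pcoef k (rho T) =
  \sum_(m <- msupp T) T@_m * pcoef k (xy (m i0) (m i1)).
Proof.
rewrite rho_sum; elim: (msupp T) => [|m s IH].
  by rewrite !big_nil /pcoef; case: ifP => _; rewrite coef0.
by rewrite !big_cons pcoefD pcoefZ IH.
Qed.

(* The monomials [x^i y^j] with [i < 3] have distinct pole orders. *)
Lemma reduced_eq0 d R : R \is d.-homog -> reduced R -> rho R = 0 -> R = 0.
Proof.
move=> hR rR R0; pose wt (m : 'X_{1..3}) := (2 * m i0 + 3 * m i1)%N.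
(* Downward induction on the pole order: in the coefficient of order [wt m], smaller orders
   contribute nothing and larger ones have already been eliminated. *)
suff H k : forall m : 'X_{1..3}, (3 * d - wt m <= k)%N -> R@_m = 0.
  by apply/mpolyP=> m; rewrite mcoeff0; apply: H (leqnn _).
have wd m : m \in msupp R -> (wt m <= 3 * d)%N.
  by move=> mR; have := homog_deg hR mR; rewrite /wt; have := rR _ mR; lia.
elim/ltn_ind: k => k IH m mk; have [mR|] := boolP (m \in msupp R); last exact: memN_msupp_eq0.
have := pcoef_rho R (wt m); rewrite R0 (bigD1_seq m) //= big1_seq ?addr0.
  have -> : pcoef (wt m) (0 : crd E) = 0 by rewrite /pcoef; case: ifP => _; rewrite coef0.
  by move/esym/eqP; rewrite mulf_eq0 (negPf (pcoef_xy _ _)) orbF => /eqP.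
move=> m' /andP[mm' mR'].
have [lt|gt|eq] := ltngtP (wt m') (wt m).
- by rewrite pcoef_xy_lt ?mulr0.
- by rewrite (IH (3 * d - wt m')%N _ m') ?mul0r // (leq_trans _ mk) // ltn_sub2l // (leq_trans gt) // wd.
case/eqP: mm'; apply/mnmP; have := rR _ mR; have := rR _ mR'.
have := homog_deg hR mR; have := homog_deg hR mR'; move: eq; rewrite /wt => h1 h2 h3 h4 h5.
by apply: I3P; lia.
Qed.

(** The reduced remainder of [T] modulo [W] restricts to 0, hence is 0. Divisibility by [W] is
    always established through this test in the coordinate ring. *)
Lemma kernel d T : T \is d.-homog -> rho T = 0 -> exists Q, T = Q * W.
Proof.
move=> /reduce[Q [R [-> hR rR]]]; rewrite rmorphD rmorphM /= rho_W mulr0 add0r.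
by move/(reduced_eq0 hR rR) ->; exists Q; rewrite addr0.
Qed.

(** Every order except 1 is 2 i + 3 j with i < 3, and no function has a simple pole at infinity as
    its only pole, so leading terms can be removed one by one. *)
Lemma pole_ind M (Pr : crd E -> Prop) :
  (forall f g, Pr f -> Pr g -> Pr (f + g)) ->
  (forall c i j, (i < 3)%N -> (2 * i + 3 * j <= M)%N -> Pr (cst E c * xy i j)) ->
  forall f, pole_le f M -> Pr f.
Proof.
move=> PD Pm f; rewrite -pole_ltS; move: (leqnn M.+1); move: {-2}M.+1 => m.
elim: m f => [|m IH] f mM hf.
  move: hf; rewrite pole_lt0 => /eqP ->.
  by have := Pm 0 0%N 0%N isT isT; rewrite rmorph0 mul0r.
have [m1|m1] := eqVneq m 1%N.
  apply: IH; rewrite ?(ltnW mM) //; move: hf; rewrite m1 /pole_lt /=; lia.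
have [i [j [i3 em]]] : exists i j, (i < 3)%N /\ m = (2 * i + 3 * j)%N.
  (* The exponent i must satisfy 2 i = m modulo 3, and 2 is its own inverse there. *)
  exists ((2 * m) %% 3)%N, ((m - 2 * ((2 * m) %% 3)) %/ 3)%N.
  by move: m1; clear; lia.
have [|||c hc] := @pole_cancel _ _ f (xy i j) m.
- by rewrite -pole_ltS.
- by rewrite pole_le_xy em.
- by rewrite pole_lt_dg ?xy_neq0 // dg_xy em ltnn.
rewrite -[f](subrK (cst E c * xy i j)); apply: PD; first exact: IH (ltnW mM) hc.
by apply: Pm; rewrite // -em -ltnS.
Qed.

(** Because i < 3, the inequality 2 i + 3 j <= 3 d already implies i + j <= d, so each monomial is
    homogenised in degree [d]. *)
Lemma form_of_pole f d : pole_le f (3 * d) -> exists2 T, T \is d.-homog & rho T = f.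
Proof.
move: f; apply: pole_ind => [f g [S hS <-] [T hT <-]|c i j i3 ij].
  by exists (S + T); rewrite ?rmorphD //; apply: dhomogD.
have e : d = (i + j + (d - i - j))%N by move: i3 ij; lia.
exists (c%:MP * mon i j (d - i - j)); last by rewrite rmorphM /= rhoC rho_mon.
by rewrite {2}e; apply/homog_cM/homog_mon.
Qed.

End Forms.

Lemma homogenize_monomial (R : comNzRingType) (c x y : R) i j l :
  c%:P * ((x%:P * 'X) ^+ i * (y%:P * 'X) ^+ j * (1%:P * 'X) ^+ l) =
  (c * (x ^+ i * y ^+ j))%:P * 'X^(i + j + l).
Proof. by rewrite !exprMn polyC1 expr1n !polyCM !polyC_exp !exprD; ring. Qed.

(** * Orders of forms at affine points and at infinity *)

Section LocalOrders.
Variables (K : fieldType) (E : wcoef K).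
Implicit Types (S T B C Q R : {mpoly K[3]}) (f g : crd E) (P : K * K).
Hypothesis smoothE : smooth E.

Local Notation W := (weierstrass (wa1 E) (wa2 E) (wa3 E) (wa4 E) (wa6 E)).
Local Notation rho := (rho E).

Lemma meval_rho T P : oncv E P -> T.@[pcoord (Some P)] = ev P (rho T).
Proof.
case: P => x y oP; rewrite rho_sum /meval /mmap.
elim: (msupp T) => [|m s IH]; rewrite ?big_nil ?ev0 // !big_cons IH evD evM // ev_cst.
by rewrite evM // !evX // ev_xc ev_yc mmap1_3 /= expr1n mulr1.
Qed.

Lemma onCurveE P : onCurve W (Some P) = oncv E P.
Proof.
case: P => x y; rewrite /onCurve /oncv /weierstrass /= -[RHS]subr_eq0; congr (_ == 0).
rewrite !(mevalB, mevalD, mevalM, rmorphXn, mevalC, mevalXU) /=; ring.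
Qed.

Lemma onCurve_infty : onCurve W None.
Proof.
rewrite /onCurve /weierstrass !(mevalB, mevalD, mevalM, rmorphXn, mevalC, mevalXU) /=.
by apply/eqP; ring.
Qed.

Lemma vanish0 P m : vanish P (0 : crd E) m.
Proof. by exists 1, 0; rewrite ev1 oner_neq0 !mulr0. Qed.

(** In the expansion of [S] at [P], the local variable X2 - 1 restricts to 0, and the other two are
    multiples of [unif P] up to the unit [lunit P]. *)
Lemma mult_ge_vanish S P m : oncv E P -> mult_ge S (pcoord (Some P)) m -> vanish P (rho S) m.
Proof.
case: P => x y oP hS; set P := (x, y) in oP *.
rewrite rhoE (mmap_shift _ _ _ (pcoord (Some P))) /mmap big_seq.
elim/big_ind: _ => [|f g|k _]; [exact: vanish0|exact: vanishD|].
have [km|km] := ltnP (mdeg k) m; first by rewrite hS // rmorph0 mul0r; apply: vanish0.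
rewrite mmap1_3 /aff /= rmorph1 subrr.
have [k0|k0] := eqVneq (k i2) 0%N; last by rewrite expr0n (negPf k0) !mulr0; apply: vanish0.
rewrite k0 expr0 mulr1 mulrC -/(ux E P) -/(uy E P); apply: vanishMr => //.
apply: vanish_leq km _; rewrite mdeg3 k0 addn0.
exists (lunit E P ^+ (k i0 + k i1)), (e1 E P ^+ k i0 * e2 E P ^+ k i1).
split; first by rewrite evX // expf_neq0 ?ev_lunit.
rewrite exprD mulrACA -!exprMn lunit_ux // lunit_uy // !exprMn mulrACA exprD //.
Qed.

Lemma vanish_divr P f g m : oncv E P -> ev P g != 0 -> vanish P (f * g) m -> vanish P f m.
Proof.
move=> oP g0 [s [h [s0 e]]]; exists (s * g), h; rewrite evM // mulf_neq0 //.
by split=> //; rewrite -e; ring.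
Qed.

Lemma form_of f : exists d, forall e, (d <= e)%N ->
  exists2 T, T \is e.-homog & rho T = f.
Proof.
exists (maxn (size f.1) (size f.2)).*2.+1 => e de; apply: form_of_pole.
by rewrite /pole_le; move: de; case: f => a b /=; move: (size a) (size b) => u v; lia.
Qed.

Definition tform P : {mpoly K[3]} :=
  if dwy E P != 0 then X0 - P.1%:MP * X2 else X1 - P.2%:MP * X2.

Lemma rho_tform P : rho (tform P) = unif E P.
Proof.
by rewrite /tform /unif; case: ifP => _;
  rewrite rmorphB rmorphM /= rhoC ?rho_X0 ?rho_X1 rho_X2 mulr1.
Qed.

Lemma homog_tform P : tform P \is 1.-homog.
Proof.
by rewrite /tform; case: ifP => _; apply: rpredB; rewrite ?homogX //;
  apply: homog_cM; apply: homogX.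
Qed.

Lemma mult_ge_tform P : mult_ge (tform P) (pcoord (Some P)) 1.
Proof.
case: P => x y; apply: mult_ge1; rewrite /tform; case: ifP => _;
  by rewrite mevalB mevalM mevalC !mevalXU /= mulr1 subrr.
Qed.

Lemma ord_ge_affP P T d m : oncv E P -> T \is d.-homog ->
  ord_ge W (Some P) T m <-> vanish P (rho T) m.
Proof.
move=> oP hT; split.
  case=> B [C [e [d' [hB [B0 [_ hS]]]]]].
  have := mult_ge_vanish oP hS; rewrite rmorphB !rmorphM /= rho_W mulr0 subr0.
  by apply: vanish_divr => //; rewrite -meval_rho.
case=> s [g [s0 e]].
have [d1 h1] := form_of s; have [d2 h2] := form_of g.
(* Large enough to lift both [s] and [g], and such that the two products compared below have the
   same degree, as [kernel] requires. *)
pose N := (d1 + d2 + m)%N.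
have [B hB eB] := h1 N (leq_trans (leq_addr _ _) (leq_addr _ _)).
have [S hS eS] : exists2 S, S \is (d + N - m).-homog & rho S = g by apply: h2; rewrite /N; lia.
have hR : tform P ^+ m * S \is (d + N).-homog.
  have -> : (d + N)%N = (1 * m + (d + N - m))%N by rewrite /N; lia.
  by apply: dhomogM hS; apply/homogXn/homog_tform.
have [C eC] : exists C, T * B - tform P ^+ m * S = C * W.
  apply: (@kernel _ E (d + N)); first by apply: rpredB => //; apply: dhomogM.
  by rewrite rmorphB !rmorphM rmorphXn /= eB eS rho_tform -e; ring.
have eR : T * B - C * W = tform P ^+ m * S by rewrite -eC; ring.
exists B, C, N, (d + N)%N; rewrite eR; split=> //; split; first by rewrite meval_rho // eB.
split=> //; have := mult_geM (@mult_geX _ _ _ m (mult_ge_tform P)) (mult_ge_any S _).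
by rewrite addn0.
Qed.

(* [bform] takes the value 1 at infinity and [X2 * bform = X0^3] on the curve. *)
Definition bform : {mpoly K[3]} := X1 ^+ 2 + (wa1 E)%:MP * X0 * X1 + (wa3 E)%:MP * X1 * X2
  - (wa2 E)%:MP * X0 ^+ 2 - (wa4 E)%:MP * X0 * X2 - (wa6 E)%:MP * X2 ^+ 2.

Lemma rho_bform : rho bform = xc E ^+ 3.
Proof.
rewrite /bform !(rmorphB, rmorphD, rmorphM, rmorphXn) /= !rhoC rho_X0 rho_X1 rho_X2.
by have h := yc2 E; rewrite -expr2 in h; ring: h.
Qed.

Lemma homog_bform : bform \is 2.-homog.
Proof.
have h i j l : (i + j + l = 2)%N -> forall c, c%:MP * mon K i j l \is 2.-homog.
  by move=> e c; have := homog_cM c (homog_mon K i j l); rewrite e.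
have -> : bform = 1%:MP * mon K 0 2 0 + (wa1 E)%:MP * mon K 1 1 0 + (wa3 E)%:MP * mon K 0 1 1
  + (- wa2 E)%:MP * mon K 2 0 0 + (- wa4 E)%:MP * mon K 1 0 1 + (- wa6 E)%:MP * mon K 0 0 2.
  by rewrite /bform /mon !mpolyCN mpolyC1; ring.
by do !apply: dhomogD; apply: h.
Qed.

Lemma meval_bform : bform.@[pcoord None] = 1.
Proof.
rewrite /bform !(mevalB, mevalD, mevalM, rmorphXn, mevalC, mevalXU) /=; ring.
Qed.

(** As [bform] is a unit at infinity with X2 [bform] = X0^3 on the curve, each X2 in a homogenised
    monomial is traded for X0^3. The resulting power i + 3 l of X0 is the order 3 d - 2 i - 3 j at
    infinity. *)
Lemma form_at_infty f M d : pole_le f M -> (M <= 3 * d)%N ->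
  exists S, [/\ S \is (3 * d).-homog, mult_ge S (pcoord None) (3 * d - M) &
    rho S = f * xc E ^+ (3 * d)].
Proof.
move=> hf Md; move: f hf; apply: pole_ind => [f g [S [hS mS eS]] [T [hT mT eT]]|c i j i3 ij].
  by exists (S + T); rewrite rmorphD /= eS eT mulrDl; split=> //;
    [apply: dhomogD|apply: mult_geD].
pose l := (d - i - j)%N; have el : d = (i + j + l)%N by rewrite /l; lia.
exists (c%:MP * mon K (i + 3 * l) j 0 * bform ^+ (i + j)); split.
- have -> : (3 * d = (i + 3 * l + j + 0) + 2 * (i + j))%N by lia.
  apply: dhomogM; first exact/homog_cM/homog_mon.
  exact/homogXn/homog_bform.
- rewrite -[X in mult_ge _ _ X]addn0; apply: mult_geM (mult_ge_any _ _).
  rewrite -[X in mult_ge _ _ X]add0n; apply: mult_geM (mult_ge_any _ _) _.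
  rewrite /mon expr0 mulr1 -[X in mult_ge _ _ X]addn0; apply: mult_geM (mult_ge_any _ _).
  apply: (@mult_ge_leq _ _ _ _ (i + 3 * l)); first by lia.
  by apply: mult_geX; apply: mult_ge1; rewrite mevalXU.
rewrite 2!rmorphM rmorphXn /= rhoC rho_mon rho_bform /xy -!mulrA -exprM; congr (_ * _).
rewrite mulrCA [RHS]mulrCA; congr (_ * _); rewrite -!exprD; congr (_ ^+ _); lia.
Qed.

(** Setting X1 = 1 loses nothing on a homogeneous form, and X0, X2 are then independent coordinates
    centred at (0 : 1 : 0). The coefficients are compared in polynomials in these two variables. *)
Lemma mult_ge_supp S D m (k : 'X_{1..3}) : S \is D.-homog ->
  mult_ge S (pcoord None) m -> k \in msupp S -> (m <= k i0 + k i2)%N.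
Proof.
move=> hS mS kS; rewrite leqNgt; apply/negP=> km.
pose f : K -> {poly {poly K}} := polyC \o polyC.
pose h (i : 'I_3) : {poly {poly K}} := nth 0 [:: 'X%:P; 1; 'X] i.
have coefE (T : {mpoly K[3]}) (h' : 'I_3 -> {poly {poly K}}) a b i l :
    (f a * ('X%:P ^+ b * 1 ^+ i * 'X ^+ l))`_(k i2)`_(k i0) = a * ((k i0 == b) && (k i2 == l))%:R.
  rewrite expr1n mulr1 -rmorphXn /f /= mulrA -polyCM coefCM coefXn mulr_natr.
  case: eqP => _; last by rewrite mulr0n coef0 andbF mulr0.
  by rewrite mulr1n coefCM coefXn andbT.
have e1 : (mmap f h S)`_(k i2)`_(k i0) = S@_k.
  rewrite /mmap (bigD1_seq k) //= coefD coefD mmap1_3 /h /= coefE // !eqxx mulr1.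
  rewrite coef_sum coef_sum big1_seq ?addr0 // => k' /andP[kk' k'S].
  rewrite mmap1_3 /= coefE //; case: andP => [[/eqP e0 /eqP e2]|]; last by rewrite mulr0.
  case/eqP: kk'; apply/mnmP; have := homog_deg hS kS; have := homog_deg hS k'S => h1 h2.
  by apply: I3P => //; lia.
have e2 : (mmap f h S)`_(k i2)`_(k i0) = 0.
  rewrite (mmap_shift _ _ _ (pcoord None)) /mmap coef_sum coef_sum big1_seq // => k' /andP[_ k'S].
  rewrite mmap1_3 /h /= /f /= !polyC0 polyC1 !subr0 subrr.
  have [k1|k1] := eqVneq (k' i1) 0%N; last by rewrite expr0n (negPf k1) mulr0 mul0r mulr0 !coef0.
  have := coefE S h ((S \mPo [tuple 'X_i + (pcoord None i)%:MP | i < 3])@_k') (k' i0) 0%N (k' i2).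
  rewrite k1 !expr0 /f /= => ->; case: andP => [[/eqP e0 /eqP e2]|]; last by rewrite mulr0.
  by rewrite mS ?mul0r // mdeg3 k1 addn0 -e0 -e2.
by move: kS; rewrite mcoeff_msupp -e1 e2 eqxx.
Qed.

Lemma pole_rho T M : (forall m : 'X_{1..3}, m \in msupp T -> (2 * m i0 + 3 * m i1 <= M)%N) ->
  pole_le (rho T) M.
Proof.
move=> h; rewrite rho_sum big_seq; elim/big_ind: _ => [|f g|m mT]; first exact: pole_le0.
  exact: pole_leD.
by apply/pole_leZ; rewrite pole_le_xy h.
Qed.

(** For a monomial with exponents i, j, l and i + j + l = D, the pole order 2 i + 3 j equals 3 D - i
    - 3 l, and i + l >= m. *)
Lemma mult_ge_pole S D m : S \is D.-homog -> mult_ge S (pcoord None) m ->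
  pole_le (rho S) (3 * D - m).
Proof.
move=> hS mS; apply: pole_rho => k kS.
by have := homog_deg hS kS; have := mult_ge_supp hS mS kS; lia.
Qed.

Lemma pole_homog T d : T \is d.-homog -> pole_le (rho T) (3 * d).
Proof. by move=> hT; apply: pole_rho => m /(homog_deg hT); lia. Qed.

(** X1^d is the only monomial of degree [d] whose pole has order 3 d, and the only one not vanishing
    at infinity. *)
Lemma pcoef_infty T d : T \is d.-homog ->
  pcoef (3 * d) (rho T) = T.@[pcoord None] * pcoef (3 * d) (xy E 0 d).
Proof.
move=> hT; rewrite pcoef_rho /meval /mmap mulr_suml; apply: eq_big_seq => m /(homog_deg hT) dm.
rewrite -mulrA; congr (_ * _); rewrite mmap1_3 /= expr1n mulr1.
have [e0|n0] := eqVneq (m i0) 0%N; last first.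
  by rewrite expr0n (negPf n0) !mul0r pcoef_xy_lt //; move: n0; lia.
have [e2|n2] := eqVneq (m i2) 0%N; last first.
  by rewrite [0 ^+ m i2]expr0n (negPf n2) mulr0 mul0r pcoef_xy_lt //; move: n2; lia.
by rewrite e0 e2 !expr0 !mul1r -dm e0 e2 add0n addn0.
Qed.

Lemma dg_infty T d : T \is d.-homog -> rho T != 0 ->
  (T.@[pcoord None] != 0) = (dg (rho T) == 3 * d)%N.
Proof.
move=> hT T0; have pT := pole_homog hT; have := pT; rewrite -dgE // => dT.
have p0 : pcoef (3 * d) (xy E 0 d) != 0 by have := pcoef_xy E 0 d; rewrite muln0 add0n.
have -> : (T.@[pcoord None] == 0) = (pcoef (3 * d) (rho T) == 0).
  by rewrite pcoef_infty // mulf_eq0 (negPf p0) orbF.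
apply/idP/eqP => [|e].
  apply: contraNeq => ne; apply/eqP/pcoef_lt; rewrite pole_lt_dg //.
  by rewrite ltn_neqAle ne.
by apply/eqP => /(pole_le_lt pT); rewrite pole_lt_dg // e ltnn.
Qed.

Lemma dg_infty_neq0 T d : T \is d.-homog -> T.@[pcoord None] != 0 -> rho T != 0.
Proof.
move=> hT; apply: contraNneq => T0; have := pcoef_infty hT; rewrite T0.
have -> : pcoef (3 * d) (0 : crd E) = 0 by rewrite /pcoef; case: ifP => _; rewrite coef0.
move/esym/eqP; rewrite mulf_eq0 => /orP[//|].
by have := pcoef_xy E 0 d; rewrite muln0 add0n => /negPf->.
Qed.

(* Sending [X_i] to [aff i] times a new variable keeps the degree visible modulo [W]. *)
Lemma homog_deg_uniq S T C d e : S \is d.-homog -> T \is e.-homog ->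
  S - T = C * W -> rho S != 0 -> d = e.
Proof.
move=> hS hT eC S0.
pose F : {mpoly K[3]} -> {poly (crd E)} :=
  mmap (polyC \o cst E) (fun i => (aff E i)%:P * 'X).
have FE R r : R \is r.-homog -> F R = (rho R)%:P * 'X^r.
  move=> hR; rewrite rho_sum rmorph_sum mulr_suml; apply: eq_big_seq => m /(homog_deg hR) <-.
  by rewrite mmap1_3; apply: homogenize_monomial.
have : F (S - T) = 0.
  by rewrite eC /F rmorphM /= -/(F W) (FE W 3) ?homog_W // rho_W polyC0 mul0r mulr0.
have eST : rho S = rho T.
  by apply/eqP; rewrite -subr_eq0 -rmorphB eC rmorphM /= rho_W mulr0.
rewrite /F rmorphB /= -/(F S) -/(F T) (FE S d) // (FE T e) // -eST => /eqP.
rewrite subr_eq0 => /eqP /polyP /(_ d); rewrite !coefCM !coefXn eqxx mulr1.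
by case: eqP => // _ /eqP; rewrite mulr0 (negPf S0).
Qed.

Lemma ord_ge_inftyP T d m : T \is d.-homog -> rho T != 0 ->
  ord_ge W None T m <-> (dg (rho T) + m <= 3 * d)%N.
Proof.
move=> hT T0; split.
  case=> B [C [e [d' [hB [B0 [hS mS]]]]]].
  have rB := dg_infty_neq0 hB B0.
  have eB : dg (rho B) = (3 * e)%N by apply/eqP; rewrite -dg_infty.
  have TB0 : rho (T * B) != 0 by rewrite rmorphM; apply: crd_mul_neq0.
  have eS : T * B - (T * B - C * W) = C * W by ring.
  have ed := homog_deg_uniq (dhomogM hT hB) hS eS TB0.
  have eR : rho (T * B - C * W) = rho T * rho B.
    by rewrite rmorphB !rmorphM /= rho_W mulr0 subr0.
  have := mult_ge_pole hS mS; rewrite eR.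
  (* A monomial in the support bounds [m] by the degree, so the subtraction in [mult_ge_pole] is not
     truncated. *)
  have [k kS] : exists k, k \in msupp (T * B - C * W).
    case s: (msupp (T * B - C * W)) => [|k ks]; last by exists k; rewrite mem_head.
    have /eqP : T * B - C * W = 0 by apply/eqP; rewrite -msupp_eq0 s.
    rewrite subr_eq0 => /eqP tb; move: TB0.
    by rewrite tb rmorphM /= rho_W mulr0 eqxx.
  have := mult_ge_supp hS mS kS; have := homog_deg hS kS.
  have RB0 : rho T * rho B != 0 by apply: crd_mul_neq0.
  rewrite -dgE // dgM // eB; move: ed; clear; lia.
move=> h; have hp : pole_le (rho T) (3 * d - m) by rewrite -dgE //; lia.
have [S [hS mS eS]] := form_at_infty hp (leq_subr _ _).
have hTB : T * bform ^+ d \is (3 * d).-homog.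
  have -> : (3 * d = d + 2 * d)%N by lia.
  exact/(dhomogM hT)/homogXn/homog_bform.
have [C eC] : exists C, T * bform ^+ d - S = C * W.
  apply: (@kernel _ E (3 * d)); first exact: rpredB.
  by rewrite rmorphB rmorphM rmorphXn /= eS rho_bform -exprM subrr.
have eR : T * bform ^+ d - C * W = S by rewrite -eC; ring.
exists (bform ^+ d), C, (2 * d)%N, (3 * d)%N; rewrite eR.
split; first exact/homogXn/homog_bform.
split; first by rewrite rmorphXn /= meval_bform expr1n oner_neq0.
by split=> //; apply: mult_ge_leq mS; lia.
Qed.

End LocalOrders.

(** * Frobenius descent and the group of rational points *)

Section Frobenius.
Variables (F : finFieldType) (L : closedFieldType) (iota : {rmorphism F -> L}).

(* [iota] only ties the exponent to [F], so that [frob] can carry instances. *)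
Definition frob (x : L) : L := let _ := iota in x ^+ #|F|.

Lemma pchar_nat_card : [pchar L].-nat #|F|.
Proof.
have [p p_pr pF] := finPcharP F.
rewrite (card_pprimeChar pF) pnatX pnatE //.
by rewrite (fmorph_pchar iota) pF.
Qed.

Fact frob_is_zmod_morphism : zmod_morphism frob.
Proof.
move=> x y; apply/eqP; rewrite eq_sym subr_eq /frob; apply/eqP.
by rewrite -exprDn_pchar ?subrK // pchar_nat_card.
Qed.
Fact frob_is_monoid_morphism : monoid_morphism frob.
Proof. by split=> [|x y]; rewrite /frob ?expr1n ?exprMn. Qed.
HB.instance Definition _ := GRing.isZmodMorphism.Build L L frob frob_is_zmod_morphism.
HB.instance Definition _ := GRing.isMonoidMorphism.Build L L frob frob_is_monoid_morphism.

Lemma frob_iota a : frob (iota a) = iota a.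
Proof. by rewrite /frob -rmorphXn expf_card. Qed.

Lemma frob_fix x : frob x = x -> exists a, x = iota a.
Proof.
move=> fx; have := congr1 (fun p => (map_poly iota p).[x]) (finField_genPoly F).
rewrite rmorphB /= map_polyXn map_polyX !hornerE -/(frob x) fx subrr => /esym/eqP.
rewrite rmorph_prod horner_prod prodf_seq_eq0 => /hasP[a _ /=].
rewrite rmorphB /= map_polyX map_polyC !hornerE subr_eq0 => /eqP ->.
by exists a.
Qed.

Lemma frob_surj y : exists x, frob x = y.
Proof.
have q0 : (0 < #|F|)%N by apply/card_gt0P; exists 0.
have /closed_rootP[x] : size ('X^#|F| - y%:P) != 1%N.
  by rewrite size_XnsubC // eqSS -lt0n.
by rewrite /root !hornerE subr_eq0 => /eqP; exists x.
Qed.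

Lemma frob_poly_fix (p : {poly L}) : map_poly frob p = p -> exists r, p = map_poly iota r.
Proof.
move=> pf; pose h c := odflt 0 [pick a | c == iota a].
have hE c : frob c = c -> c = iota (h c).
  move=> /frob_fix[a e]; rewrite /h; case: pickP => [b /eqP //|/(_ a)].
  by rewrite e eqxx.
exists (\poly_(i < size p) h p`_i); apply/polyP=> i; rewrite coef_map coef_poly.
case: ltnP => [_|sp]; last by rewrite /= (nth_default _ sp) rmorph0.
by apply: hE; rewrite -[in RHS]pf coef_map.
Qed.

Lemma frob_pt_fix (P : pt L) : map_pt frob P = P -> exists Q, P = map_pt iota Q.
Proof.
case: P => [[x y]|] /=; last by exists None.
by case=> /frob_fix[a ->] /frob_fix[b ->]; exists (Some (a, b)).
Qed.

End Frobenius.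

Section DivisorMap.
Variables (L : closedFieldType) (sg : {rmorphism L -> L}) (E : wcoef L).
Hypothesis smoothE : smooth E.
Hypothesis sgE : E = wmap sg E.
Hypothesis sg_surj : forall y, exists x, sg x = y.

Lemma map_pt_inj : injective (map_pt sg).
Proof.
move=> [[x y]|] [[z t]|] //= [/fmorph_inj -> /fmorph_inj ->] //.
Qed.

Lemma divis_map (f : crd E) (Z : seq (pt L)) : divis f Z -> divis (crd_map sg E f :
  crd E) (map (map_pt sg) Z).
Proof.
case=> f0 fZ; split=> [|P]; first by rewrite crd_map_eq0.
have [x xP] := sg_surj P.1; have [y yP] := sg_surj P.2.
have -> : P = apt sg (x, y) by rewrite /apt /= xP yP; case: (P).
rewrite (oncv_map sgE) => oP; rewrite (ordc_map sgE) // fZ //.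
rewrite count_map; apply: eq_count => R /=.
have -> : Some (apt sg (x, y)) = map_pt sg (Some (x, y)) by [].
by rewrite (inj_eq map_pt_inj).
Qed.

End DivisorMap.

(** The smoothness proofs are arguments of the type because the group law attached to it as an
    instance depends on them. *)
Definition rpt (F : finFieldType) (L : closedFieldType) (iota : {rmorphism F -> L})
  (E : wcoef F) of smooth E & smooth (wmap iota E) := {P : pt F | onc E P}.

HB.instance Definition _ F L iota E sE sL :=
  Finite.copy (@rpt F L iota E sE sL) {P : pt F | onc E P}.

Section Group.
Variables (F : finFieldType) (L : closedFieldType) (iota : {rmorphism F -> L}).
Variables (E : wcoef F) (sE : smooth E) (sL : smooth (wmap iota E)).
Local Notation EL := (wmap iota E).
Local Notation G := (rpt sE sL).
Implicit Types P Q R : G.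

Definition mkrpt (S : pt F) (oS : onc E S) : G := exist (fun S : pt F => onc E S) S oS.

Definition emb P : pt L := map_pt iota (val P).

Lemma emb_inj : injective emb.
Proof.
move=> P Q; rewrite /emb => e; apply: val_inj; move: e.
by case: (val P) (val Q) => [[x y]|] [[z t]|] //= [/fmorph_inj -> /fmorph_inj ->].
Qed.

Lemma onc_map_pt (R : pt F) : onc EL (map_pt iota R) = onc E R.
Proof. by case: R => [[x y]|] //=; rewrite -(oncv_map (erefl EL) (x, y)). Qed.

Lemma onc_emb P : onc EL (emb P).
Proof. by rewrite /emb onc_map_pt (valP P). Qed.

Lemma frob_coef : EL = wmap (frob iota) EL.
Proof. by rewrite /wmap /= !frob_iota. Qed.

Lemma frob_emb P : map_pt (frob iota) (emb P) = emb P.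
Proof. by rewrite /emb; case: (val P) => [[x y]|] //=; rewrite !frob_iota. Qed.

(** Frobenius carries [f] to a function with the same prescribed zeros, so uniqueness of the
    residual point makes [R] a fixed point of Frobenius, hence rational. *)
Lemma rational_residual (f : crd EL) (R : pt L) (Z : seq (pt L)) : all (onc EL) Z ->
  (forall S : pt L, count_mem S (map (map_pt (frob iota)) Z) = count_mem S Z) ->
  onc EL R -> divis f (R :: Z) -> exists P, R = emb P.
Proof.
move=> oZ frZ oR df.
have df' := divis_map sL frob_coef (@frob_surj _ _ iota) df.
have oR' : onc EL (map_pt (frob iota) R).
  by case: (R) oR => [[x y]|] //=; rewrite -(oncv_map frob_coef (x, y)).
have [|Q eQ] := @frob_pt_fix _ _ iota R.
  apply: (divis_inj sL oR' oR oZ _ df); apply: divis_count df' => P /=.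
  by rewrite frZ.
have oQ : onc E Q by rewrite -onc_map_pt -eQ.
by exists (mkrpt oQ).
Qed.

Lemma onc_neg P : onc E (omap (cpt E) (val P)).
Proof. by case: P => -[P|] //= oP; rewrite oncv_cpt. Qed.
Definition gneg P : G := mkrpt (onc_neg P).
Definition gzero : G := @mkrpt None isT.

Lemma emb_neg P : emb (gneg P) = cptp EL (emb P).
Proof.
by rewrite /emb /=; case: (val P) => [[x y]|] //=; rewrite /cpt /= !(rmorphB, rmorphN, rmorphM).
Qed.

Lemma gnegK : involutive gneg.
Proof. by move=> P; apply: emb_inj; rewrite !emb_neg cptpK. Qed.

(** The chord and tangent law: with the implicit pole, [f] has divisor (-R) + P + Q - 3 times
    infinity. Only the points are rational; [f] may have coefficients in [L]. *)
Definition is_sum R P Q := exists f : crd EL, divis f [:: emb (gneg R); emb P; emb Q].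

Lemma is_sum_exists P Q : exists R, is_sum R P Q.
Proof.
have oZ : all (onc EL) [:: emb P; emb Q] by rewrite /= !onc_emb.
have [R oR [f df]] := residual sL oZ.
have [|R' eR] := rational_residual oZ _ oR df; first by move=> S; rewrite /= !frob_emb.
by exists (gneg R'), f; rewrite gnegK -eR.
Qed.

Lemma is_sum_inj R R' P Q : is_sum R P Q -> is_sum R' P Q -> R = R'.
Proof.
move=> [f df] [g dg']; apply: (can_inj gnegK); apply: emb_inj.
by apply: (divis_inj sL _ _ _ df dg'); rewrite /= ?onc_emb.
Qed.

(* Associativity is inherited from linear equivalence, so no addition formulas are needed. *)
Definition gadd P Q : G :=
  proj1_sig (constructive_indefinite_description _ (is_sum_exists P Q)).

Lemma gaddP P Q : is_sum (gadd P Q) P Q.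
Proof. exact: proj2_sig (constructive_indefinite_description _ (is_sum_exists P Q)). Qed.

Lemma gaddC : commutative gadd.
Proof.
move=> P Q; apply: is_sum_inj (gaddP P Q) _; have [f df] := gaddP Q P; exists f.
by apply: divis_count df => S /=; lia.
Qed.

Lemma divis1 : divis (1 : crd EL) [::].
Proof.
split; first exact: oner_neq0.
by move=> P oP; apply/eqP; rewrite ordc_eq0 ?ev1 ?oner_neq0.
Qed.

Lemma divis_pair P : exists f : crd EL, divis f [:: emb P; emb (gneg P)].
Proof.
rewrite emb_neg; have := onc_emb P; case: (emb P) => [S|] /= oS.
  by eexists; apply: divis_XsubC.
by exists 1; apply: divis_count divis1.
Qed.

Lemma gadd0 : left_id gzero gadd.
Proof.
move=> P; apply: is_sum_inj (gaddP _ _) _; have [f df] := divis_pair P; exists f.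
by apply: divis_count df => S /=; lia.
Qed.

Lemma gaddN : left_inverse gzero gneg gadd.
Proof.
move=> P; apply: is_sum_inj (gaddP _ _) _; have [f df] := divis_pair P; exists f.
by apply: divis_count df => S /=; lia.
Qed.

Lemma gadd3 P Q R : exists f : crd EL,
  divis f [:: emb (gneg (gadd P (gadd Q R))); emb P; emb Q; emb R].
Proof.
have [f df] := gaddP Q R; have [g dg'] := gaddP P (gadd Q R).
have oY : all (onc EL) [:: emb (gadd Q R)] by rewrite /= onc_emb.
apply: (divis_cancels sL (f := f * g) oY).
apply: divis_count (divis_cat sL df dg') => S /=; rewrite -emb_neg; lia.
Qed.

(** The negatives of P + (Q + R) and R + (P + Q) are both residual to the list P, Q, R, and the
    residual point is unique. *)
Lemma gaddA : associative gadd.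
Proof.
move=> P Q R; have [f df] := gadd3 P Q R; have [g dg'] := gadd3 R P Q.
rewrite [RHS]gaddC; apply: (can_inj gnegK); apply: emb_inj.
have oZ : all (onc EL) [:: emb P; emb Q; emb R] by rewrite /= !onc_emb.
apply: (divis_inj sL (onc_emb _) (onc_emb _) oZ df).
by apply: divis_count dg' => S /=; lia.
Qed.

HB.instance Definition _ := GRing.isZmodule.Build G gaddA gaddC gadd0 gaddN.

Lemma divis_sum (Z : seq G) : exists f : crd EL, divis f (emb (- \sum_(P <- Z) P) :: map emb Z).
Proof.
elim: Z => [|P Z [f df]].
  by rewrite big_nil oppr0; exists 1; apply: divis_count divis1.
rewrite big_cons; have [g dg'] := gaddP P (\sum_(Q <- Z) Q).
have oY : all (onc EL) [:: emb (\sum_(Q <- Z) Q)] by rewrite /= onc_emb.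
apply: (divis_cancels sL (f := g * f) oY).
apply: divis_count (divis_cat sL dg' df) => S /=; rewrite -emb_neg.
have gnegE Q : gneg Q = - Q by [].
have gaddE Q R : gadd Q R = Q + R by [].
by rewrite !gnegE gaddE; lia.
Qed.

(** A point is coded by x and by whether y is the chosen root [y0 x]; a second root over the same x
    can only be the conjugate. Infinity takes the code [None]. *)
Lemma card_rpt : (#|{: G}| <= #|F|.*2.+1)%N.
Proof.
pose y0 x := odflt 0 [pick y | oncv E (x, y)].
pose h (P : G) : option (F * bool) := if val P is Some (x, y) then Some (x, y == y0 x) else None.
have hinj : injective h.
  case=> -[[x y]|] oP [[[z t]|] oQ] //=; rewrite /h /=; last by move=> _; apply: val_inj.
  case=> exz; rewrite -{z}exz in oQ * => e; apply: val_inj => /=; congr (Some (_, _)).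
  have oy0 : oncv E (x, y0 x).
    by rewrite /y0; case: pickP => // /(_ y); rewrite /= in oP *; rewrite oP.
  have [y1|y1] := eqVneq y (y0 x); first by move: e; rewrite y1 eqxx => /esym/eqP.
  have t1 : t != y0 x by rewrite -e; case: eqP y1.
  have [|[->]] := same_x oy0 (oP : oncv E (x, y)) erefl; first by case=> yy;
    rewrite yy eqxx in y1.
  by have [|[->]] := same_x oy0 (oQ : oncv E (x, t)) erefl; first by case=> yy;
    rewrite yy eqxx in t1.
by have := leq_card _ hinj; rewrite card_option card_prod card_bool muln2.
Qed.

End Group.

(** * Codewords *)

Lemma sum_support_eq (V : nmodType) (T : eqType) (s1 s2 : seq T) (F : T -> V) :
  uniq s1 -> uniq s2 -> (forall x, F x != 0 -> (x \in s1) = (x \in s2)) ->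
  \sum_(x <- s1) F x = \sum_(x <- s2) F x.
Proof.
move=> u1 u2 s12; rewrite (bigID (fun x => F x == 0)) [RHS](bigID (fun x => F x == 0)) /=.
rewrite big1 => [|x /eqP//]; rewrite [in RHS]big1 => [|x /eqP//]; rewrite !add0r.
rewrite -big_filter -[RHS]big_filter; apply: perm_big; apply: uniq_perm; rewrite ?filter_uniq //.
by move=> x; rewrite !mem_filter; have [//|Fx] := eqVneq (F x) 0; rewrite s12.
Qed.

Lemma count_nseqs (T : eqType) (s : seq T) (m : T -> nat) x :
  uniq s -> (m x != 0%N -> x \in s) ->
  count_mem x (flatten [seq nseq (m y) y | y <- s]) = m x.
Proof.
move=> us mx; transitivity (if x \in s then m x else 0%N); last first.
  by case: ifP mx => // _ mx; apply/eqP; rewrite eq_sym; apply: contraT => /mx.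
elim: s us {mx} => //= y s IH /andP[ys us].
rewrite count_cat IH // count_nseq inE /= [y == x]eq_sym.
by have [->|_] := eqVneq x y; rewrite ?(negPf ys) ?mul1n ?addn0 ?mul0n.
Qed.

Lemma sum_pts (K : eqType) (t : seq (pt K)) (F : pt K -> nat) :
  (\sum_(R <- t) F R = \sum_(P <- affs t) F (Some P) + count_mem None t * F None)%N.
Proof.
elim: t => [|[P|] t IH]; first by rewrite !big_nil.
  by rewrite [affs _]/= !big_cons IH addnA.
by rewrite [affs _]/= big_cons IH /= mulnDl mul1n addnCA.
Qed.

Lemma mem_affs (K : eqType) (t : seq (pt K)) P : (P \in affs t) = (Some P \in t).
Proof. by rewrite -!has_pred1 !has_count count_affs. Qed.

Lemma affs_uniq (K : eqType) (t : seq (pt K)) : uniq t -> uniq (affs t).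
Proof.
by elim: t => //= -[P|] t IH /andP[Pt /IH] //= ->; rewrite mem_affs Pt.
Qed.

Lemma size_affs (K : eqType) (t : seq (pt K)) : (size (affs t) + count_mem None t = size t)%N.
Proof. by elim: t => //= -[P|] t IH /=; rewrite -IH ?addnS. Qed.

Section FormOrders.
Variables (K : closedFieldType) (E : wcoef K).
Hypothesis smoothE : smooth E.
Local Notation W := (weierstrass (wa1 E) (wa2 E) (wa3 E) (wa4 E) (wa6 E)).

(* The order at [R] of a form of degree [d] that restricts to [f]. *)
Definition ordf (R : pt K) (d : nat) (f : crd E) : nat :=
  if R is Some P then ordc P f else (3 * d - dg f)%N.

Lemma ord_geE (R : pt K) (T : {mpoly K[3]}) d m : onc E R -> T \is d.-homog ->
  rho E T != 0 -> ord_ge W R T m <-> (m <= ordf R d (rho E T))%N.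
Proof.
case: R => [P|] oP hT T0 /=.
  rewrite -vanishE //; exact: ord_ge_affP hT.
have := pole_homog E hT; rewrite -dgE // => dT.
have := ord_ge_inftyP m hT T0; move: dT; move: (dg _) => a dT.
have -> : (a + m <= 3 * d)%N = (m <= 3 * d - a)%N by lia.
by [].
Qed.

Lemma sum_ordf (t : seq (pt K)) d (f : crd E) : f != 0 -> (dg f <= 3 * d)%N ->
  uniq t -> all (onc E) t -> None \in t ->
  (forall P, oncv E P -> ev P f = 0 -> Some P \in t) ->
  (\sum_(R <- t) ordf R d f = 3 * d)%N.
Proof.
move=> f0 fd ut ot Nt zt; rewrite sum_pts count_uniq_mem // Nt mul1n /=.
rewrite (sum_ord smoothE f0 (affs_uniq ut) (all_affs ot)) ?subnKC // => P oP e0.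
by rewrite mem_affs zt.
Qed.

Lemma divis_self (Z : seq (pt K)) : all (onc E) Z -> exists f :
  crd E, divis f (Z ++ map (cptp E) Z).
Proof.
elim: Z => [|[P|] Z IH] /=.
- exists 1; split; first exact: oner_neq0.
  by move=> P oP; apply/eqP; rewrite ordc_eq0 ?ev1 ?oner_neq0.
- case/andP=> oP /IH[f df]; exists (px E ('X - P.1%:P) * f).
  by apply: divis_count (divis_cat smoothE (divis_XsubC smoothE oP) df) => Q /=;
    rewrite !count_cat /=; lia.
move=> /IH[f df]; exists f.
by apply: divis_count df => Q /=; rewrite !count_cat /=; lia.
Qed.

Lemma pcoef_dg (f : crd E) : f != 0 -> pcoef (dg f) f != 0.
Proof.
move=> f0; apply/eqP => /(pole_le_lt (_ : pole_le f _)); rewrite -dgE // leqnn => /(_ isT).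
by rewrite pole_lt_dg // ltnn.
Qed.

End FormOrders.

(** * Descent of functions to the finite field *)

Section Descent.
Variables (F : finFieldType) (L : closedFieldType) (iota : {rmorphism F -> L}) (E : wcoef F).
Local Notation EL := (wmap iota E).
Hypotheses (sE : smooth E) (sL : smooth EL).

Lemma pcoef_map (K : fieldType) (K' : fieldType) (sg : {rmorphism K -> K'}) (E0 : wcoef K)
  (E' : wcoef K') m (f : crd E0) : pcoef m (crd_map sg E' f) = sg (pcoef m f).
Proof. by rewrite /pcoef; case: ifP => _; rewrite coef_map. Qed.

Lemma dg_map (f : crd E) : dg (crd_map iota EL f) = dg f.
Proof. by rewrite /dg (nrm_crd_map (erefl EL)) size_map_poly. Qed.

(* Normalised at infinity, a function with a Frobenius-stable divisor is fixed by Frobenius. *)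
Lemma descent (f : crd EL) (Z : seq (pt L)) : all (onc EL) Z ->
  (forall S : pt L, count_mem S (map (map_pt (frob iota)) Z) = count_mem S Z) ->
  divis f Z -> exists g : crd E, divis (crd_map iota EL g) Z.
Proof.
move=> oZ frZ df; have f0 := df.1; have p0 := pcoef_dg f0; set m := dg f in p0.
pose f1 := cst EL (pcoef m f)^-1 * f.
have df1 : divis f1 Z.
  split; first by rewrite crd_mul_neq0 // px_eq0 polyC_eq0 invr_eq0.
  by move=> P oP; rewrite ordc_cstM ?invr_eq0 // df.2.
have pf1 : pcoef m f1 = 1 by rewrite pcoefZ mulVf.
have df2 : divis (crd_map (frob iota) EL f1 : crd EL) Z.
  by apply: divis_count (divis_map sL (frob_coef iota E) (@frob_surj _ _ iota) df1) => P;
    rewrite frZ.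
have [c _ e] := divis_scale sL oZ df1 df2.
have c1 : c = 1.
  by have := congr1 (pcoef m) e; rewrite pcoefZ pcoef_map pf1 rmorph1 mulr1.
move: e; rewrite c1 rmorph1 mul1r => e.
have [p1 e1] : exists p, f1.1 = map_poly iota p by apply: frob_poly_fix;
  rewrite [RHS](congr1 fst e).
have [p2 e2] : exists p, f1.2 = map_poly iota p by apply: frob_poly_fix;
  rewrite [RHS](congr1 snd e).
exists (p1, p2); have -> : crd_map iota EL (p1, p2) = f1 :> crd EL.
  by rewrite /crd_map /= -e1 -e2; case: (f1).
exact: df1.
Qed.

Lemma rho_map (T : {mpoly F[3]}) : rho EL (map_mpoly iota T) = crd_map iota EL (rho E T).
Proof.
have XE j : crd_map iota EL (xc E ^+ j) = xc EL ^+ j.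
  by rewrite (crd_mapX (erefl EL)) crd_map_xc.
have YE j : crd_map iota EL (yc E ^+ j) = yc EL ^+ j.
  by rewrite (crd_mapX (erefl EL)) crd_map_yc.
elim/mpolyind: T => [|c m p _ _ IH].
  by rewrite !rmorph0 /crd_map /= rmorph0.
rewrite rmorphD /= map_mpolyZ map_mpolyX rmorphD /= IH [in RHS]rmorphD /= crd_mapD; congr (_ + _).
rewrite -!mul_mpolyC !rmorphM /= !rhoC (crd_mapM (erefl EL)) crd_map_cst; congr (_ * _).
by rewrite !monE !rho_mon (crd_mapM (erefl EL)) XE YE.
Qed.

Lemma map_weierstrass : map_mpoly iota (weierstrass (wa1 E) (wa2 E) (wa3 E) (wa4 E) (wa6 E)) =
  weierstrass (wa1 EL) (wa2 EL) (wa3 EL) (wa4 EL) (wa6 EL).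
Proof.
rewrite /weierstrass !(rmorphB, rmorphD, rmorphM, rmorphXn) /= !map_mpolyC.
by rewrite /X0 /X1 /X2 !map_mpolyX.
Qed.

Lemma map_homog (T : {mpoly F[3]}) d : T \is d.-homog -> map_mpoly iota T \is d.-homog.
Proof.
move=> hT; apply/dhomogP => m; rewrite mcoeff_msupp mcoeff_map_mpoly fmorph_eq0.
by rewrite -mcoeff_msupp => /(dhomog_mf hT).
Qed.

End Descent.

Lemma pole_arith a b x m N : (a + m = x + b)%N -> x != m -> (x <= m)%N -> (b <= N)%N ->
  (N - b < N - a)%N.
Proof. by lia. Qed.

Lemma int_step (a b : nat) (t : bool) : (a < b)%N -> (a%:Z + t%:Z <= b%:Z)%R.
Proof. by case: t; lia. Qed.

Lemma int_bound (a b : nat) (v : int) (Pr : nat -> Prop) :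
  (forall z, Pr z -> (z <= b)%N) ->
  (match (a%:Z - v)%R with Posz z => Pr z | Negz _ => True end) -> (a%:Z <= b%:Z + v)%R.
Proof.
by move=> h; case e: (a%:Z - v)%R => [z|z]; [move/h; move: e; lia|move: e; lia].
Qed.

Lemma cross_ring (R : comNzRingType) (g h s1 s2 t u g' h' : R) :
  s1 * g = t * u * g' -> s2 * h = t * h' -> g * (s1 * h') = s2 * u * g' * h.
Proof.
move=> e1 e2; have -> : g * (s1 * h') = s1 * g * h' by ring.
have -> : s2 * u * g' * h = u * g' * (s2 * h) by ring.
by rewrite e1 e2; ring.
Qed.

Definition posz (z : int) : nat := if z is Posz m then m else 0%N.
Definition negz (z : int) : nat := if z is Negz m then m.+1 else 0%N.
Lemma posz_negz z : z = (posz z)%:Z - (negz z)%:Z.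
Proof. by case: z => m /=; rewrite ?subr0 ?sub0r ?NegzE. Qed.

Lemma int_sub (m a b : nat) (v : int) : (m <= a)%N -> (a + negz v <= b + posz v)%N ->
  forall z : nat, (m%:Z - v)%R = z%:Z -> (z <= b)%N.
Proof. by move=> ma; rewrite [in (m%:Z - v)%R](posz_negz v); lia. Qed.

(** * The weight bound and a codeword attaining it *)

Section Code.
Variables (F : finFieldType) (L : closedFieldType) (iota : {rmorphism F -> L}) (E : wcoef F).
Variables (n : nat) (D : 'I_n -> pt F) (V : pt L -> int) (s : seq (pt L)) (k : nat).
Local Notation EL := (wmap iota E).
Local Notation W := (weierstrass (wa1 E) (wa2 E) (wa3 E) (wa4 E) (wa6 E)).
Hypotheses (sE : smooth E) (sL : smooth EL).
Hypothesis injD : injective D.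
Hypothesis oncD : forall i, onc E (D i).
Hypotheses (uniq_s : uniq s) (suppV : forall P, V P != 0 -> P \in s).
Hypothesis oncV : forall P, V P != 0 -> onc EL P.
Hypothesis frobV : forall P, V (frob_pt #|F| P) = V P.
Hypothesis degV : \sum_(P <- s) V P = k%:Z.
Hypothesis VD : forall i, V (map_pt iota (D i)) = 0.

Lemma onCurve_onc (P : pt L) : onCurve (map_mpoly iota W) P = onc EL P.
Proof.
rewrite map_weierstrass; case: P => [P|]; first exact: onCurveE.
exact: onCurve_infty.
Qed.

Lemma dvdW_rho (T : {mpoly F[3]}) : dvdW W T -> rho E T = 0.
Proof. by case=> Q ->; rewrite rhoM rho_W mulr0. Qed.

Lemma dvdW_cross (G H G' H' : {mpoly F[3]}) : dvdW W (G * H' - G' * H) ->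
  rho E G * rho E H' = rho E G' * rho E H.
Proof. by move/dvdW_rho/eqP; rewrite rhoB !rhoM subr_eq0 => /eqP. Qed.

Lemma eval_neq0 (T : {mpoly F[3]}) d i : T \is d.-homog -> T.@[pcoord (D i)] != 0 -> rho E T != 0.
Proof.
move=> hT; have := oncD i; case: (D i) => [P|] oP.
  by rewrite (meval_rho T (oP : oncv E P)); apply: contraNneq => ->; rewrite ev0.
exact: (@dg_infty_neq0 F E T d hT).
Qed.

Lemma codeword_neq0 (G H : {mpoly F[3]}) i c : ~ dvdW W H -> rho E H != 0 ->
  evalAt W G H (D i) c -> c != 0 -> rho E G != 0.
Proof.
move=> nH H0 [G' [H' [d [hG' [hH' [/dvdW_cross e [H'0 eG']]]]]]] c0.
have G'0 : rho E G' != 0.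
  apply: (@eval_neq0 G' d i hG'); rewrite eG'.
  exact: mulf_neq0.
apply: contraNneq (crd_mul_neq0 G'0 H0) => G0.
by rewrite -e G0 mul0r.
Qed.

(** The value at [D i] comes from another fraction G'/H' with H' nonzero there. On the curve G H' =
    G' H, and G' vanishes at the point while H' does not, so [G] has strictly larger order than
    [H]. *)
Lemma codeword_zero (G H : {mpoly F[3]}) d i : G \is d.-homog -> H \is d.-homog ->
  rho E G != 0 -> rho E H != 0 -> evalAt W G H (D i) 0 ->
  (ordf (map_pt iota (D i)) d (crd_map iota EL (rho E H)) <
   ordf (map_pt iota (D i)) d (crd_map iota EL (rho E G)))%N.
Proof.
move=> hG hH G0 H0 [G' [H' [d' [hG' [hH' [/dvdW_cross e [H'e]]]]]]]; rewrite mul0r => G'e.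
have H'0 := eval_neq0 hH' H'e.
have G'0 : rho E G' != 0.
  by apply: contraTneq (crd_mul_neq0 G0 H'0) => z; rewrite e z mul0r eqxx.
move: (oncD i) H'e G'e; case: (D i) => [[x y]|] oP H'e G'e.
  have oP' : oncv E (x, y) by [].
  have og T : rho E T != 0 ->
      ordf (map_pt iota (Some (x, y))) d (crd_map iota EL (rho E T)) = ordc (x, y) (rho E T).
    by move=> T0; apply: (ordc_map (erefl EL) sE sL oP' T0).
  rewrite (og _ G0) (og _ H0).
  have := congr1 (ordc (x, y)) e.
  rewrite (ordcM sE oP' G0 H'0) (ordcM sE oP' G'0 H0) => eo.
  have o1 : ordc (x, y) (rho E H') = 0%N.
    by apply/eqP; rewrite (ordc_eq0 sE oP' H'0) -meval_rho.
  have o2 : ordc (x, y) (rho E G') != 0%N.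
    by rewrite (ordc_eq0 sE oP' G'0) negbK -meval_rho // G'e.
  by rewrite o1 addn0 in eo; rewrite eo -[X in (X < _)%N]add0n ltn_add2r lt0n.
rewrite /ordf /=.
rewrite !dg_map; have := congr1 (@dg _ _) e; rewrite !dgM // => eo.
have d1 : dg (rho E H') = (3 * d')%N by apply/eqP; rewrite -dg_infty.
have d2 : dg (rho E G') != (3 * d')%N by rewrite -dg_infty // G'e eqxx.
have := pole_homog E hG'; rewrite -dgE // => d3.
have := pole_homog E hH; rewrite -dgE // => d4.
by rewrite d1 in eo; apply: pole_arith eo d2 d3 d4.
Qed.

Lemma code_weight c : in_code iota W V D c -> (exists i, c i != 0) -> (n - k <= hweight c)%N.
Proof.
case=> G [H [[[d [hG [hH nH]]] gord] ev_c]] [i0 ci0].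
have H0 : rho E H != 0 by apply/eqP => h0; apply: nH; apply: kernel hH h0.
have G0 := codeword_neq0 nH H0 (ev_c i0) ci0.
pose g := crd_map iota EL (rho E G); pose h := crd_map iota EL (rho E H).
have g0 : g != 0 by rewrite crd_map_eq0.
have h0 : h != 0 by rewrite crd_map_eq0.
have hGL := map_homog iota hG; have hHL := map_homog iota hH.
have eg : rho EL (map_mpoly iota G) = g by rewrite rho_map.
have eh : rho EL (map_mpoly iota H) = h by rewrite rho_map.
have dg3 : (dg g <= 3 * d)%N by rewrite dgE // -eg pole_homog.
have dh3 : (dg h <= 3 * d)%N by rewrite dgE // -eh pole_homog.
pose Zs := [seq map_pt iota (D i) | i <- enum [pred i | c i == 0]].
have injm : injective (map_pt iota).
  by move=> [[x y]|] [[z t]|] //= [/fmorph_inj -> /fmorph_inj ->].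
have uZ : uniq Zs by rewrite map_inj_uniq ?enum_uniq // => i j /injm /injD.
have oZ : all (onc EL) Zs.
  by apply/allP => P /mapP[i _ ->]; rewrite onc_map_pt.
have [tg [_ otg ztg _]] := sum_ord_exists sL g0.
have [th [_ oth zth _]] := sum_ord_exists sL h0.
(* A finite set carrying all orders and all coefficients of [V], including infinity so that both
   forms have total order 3 d on it. The list [s] is filtered because it may contain points off the
   curve, where [V] is 0. *)
pose t := undup (None :: filter (onc EL) s ++ map some tg ++ map some th ++ Zs).
have ut : uniq t by apply: undup_uniq.
have ot : all (onc EL) t.
  apply/allP => P; rewrite mem_undup inE !mem_cat mem_filter.
  case/orP=> [/eqP->//|/orP[/andP[]//|/orP[|/orP[]]]].
  - by case/mapP=> Q /(allP otg) oQ ->.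
  - by case/mapP=> Q /(allP oth) oQ ->.
  exact: (allP oZ).
have Nt : None \in t by rewrite mem_undup mem_head.
have sumG : (\sum_(R <- t) ordf R d g = 3 * d)%N.
  apply: sum_ordf => // P oP e0; rewrite mem_undup inE !mem_cat.
  by rewrite (map_f some (ztg _ oP e0)) !orbT.
have sumH : (\sum_(R <- t) ordf R d h = 3 * d)%N.
  apply: sum_ordf => // P oP e0; rewrite mem_undup inE !mem_cat.
  by rewrite (map_f some (zth _ oP e0)) !orbT.
have sumV : \sum_(R <- t) V R = k%:Z.
  rewrite -degV; apply: sum_support_eq => // R VR.
  rewrite (suppV VR) mem_undup inE !mem_cat mem_filter (suppV VR) oncV //= orbT //.
have sumZ : (\sum_(R <- t) count_mem R Zs)%N = size Zs.
  by apply: sum_count_mem => // R RZ; rewrite mem_undup inE !mem_cat RZ !orbT.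
(* At a zero of the codeword [V] is 0 and G/H has order at least 1; elsewhere the order is at least
   - V. Summed over [t], the orders cancel and the number of zeros is at most [k]. *)
have loc R : R \in t -> ((ordf R d h)%:Z + (count_mem R Zs)%:Z <= (ordf R d g)%:Z + V R)%R.
  move=> /(allP ot) oR; have [/mapP[i]|RZ] := boolP (R \in Zs).
    rewrite mem_enum inE => /eqP ci ->; rewrite VD addr0 count_uniq_mem //.
    have e := ev_c i; rewrite ci in e.
    exact: int_step (codeword_zero hG hH G0 H0 e).
  rewrite (count_memPn RZ) addr0.
  have hR := gord R; rewrite onCurve_onc oR map_weierstrass in hR.
  have h0' : rho EL (map_mpoly iota H) != 0 by rewrite eh.
  have g0' : rho EL (map_mpoly iota G) != 0 by rewrite eg.
  have oh := (ord_geE sL (ordf R d h) oR hHL h0').2; rewrite eh in oh.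
  have := hR isT (ordf R d h) (oh (leqnn _)).
  apply: int_bound => z hz; rewrite -eg.
  exact: (ord_geE sL z oR hGL g0').1 hz.
have zk : (size Zs <= k)%N.
  have : (\sum_(R <- t) ((ordf R d h)%:Z + (count_mem R Zs)%:Z) <=
          \sum_(R <- t) ((ordf R d g)%:Z + V R))%R.
    by rewrite big_seq [X in (_ <= X)%R]big_seq; apply: Num.Theory.ler_sum.
  have sumPosz (f : pt L -> nat) :
      (\sum_(R <- t) (f R)%:Z = (\sum_(R <- t) f R)%N%:Z)%R.
    by rewrite (big_morph Posz PoszD (erefl _)).
  by rewrite !big_split /= sumV !sumPosz sumG sumH sumZ Num.Theory.lerD2l lez_nat.
have : (size Zs + hweight c = n)%N.
  rewrite size_map -cardE /hweight -[RHS]card_ord -(cardC [pred i | c i == 0]).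
  by congr addn; apply: eq_card.
have arith a w m : (a + w = m -> a <= k -> m - k <= w)%N by clear; lia.
by move/arith; apply.
Qed.

(** The given forms may both vanish at [R], so another fraction with denominator nonzero at [R] is
    built. The boolean is the order of g/h at [R], which is 0 or 1. *)
Lemma evaluation (g h : crd E) (G H : {mpoly F[3]}) d (R : pt F) (b : bool) :
  g != 0 -> h != 0 -> G \is d.-homog -> H \is d.-homog ->
  rho E G = g -> rho E H = h -> onc E R ->
  (if R is Some P then ordc P g = (ordc P h + b)%N else dg h = (dg g + b)%N) ->
  exists c, evalAt W G H R c /\ (c == 0) = b.
Proof.
move=> g0 h0 hG hH eG eH oR ord_gh.
have suff_forms e (G' H' : {mpoly F[3]}) : G' \is e.-homog -> H' \is e.-homog ->
    g * rho E H' = rho E G' * h -> H'.@[pcoord R] != 0 -> (G'.@[pcoord R] == 0) = b ->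
    exists c, evalAt W G H R c /\ (c == 0) = b.
  move=> hG' hH' e' H'0 G'b; exists (G'.@[pcoord R] / H'.@[pcoord R]); split.
    exists G', H', e; do 2!split=> //; split; last by rewrite divfK.
    apply: (@kernel _ E (d + e)).
      by apply: rpredB; [apply: dhomogM|rewrite addnC; apply: dhomogM].
    by rewrite rhoB !rhoM eG eH e' subrr.
  by rewrite mulf_eq0 invr_eq0 (negPf H'0) orbF.
case: R oR ord_gh suff_forms => [P|] oR ord_gh suff_forms.
  have oP : oncv E P by [].
  have [s1 [g' [s10 g'0 e1]]] := ordcP sE oP g0.
  have [s2 [h' [s20 h'0 e2]]] := ordcP sE oP h0.
  have [d1 f1] := form_of (s2 * unif E P ^+ b * g').
  have [d2 f2] := form_of (s1 * h').
  have [G' hG' eG'] := f1 (d1 + d2)%N (leq_addr _ _).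
  have [H' hH' eH'] := f2 (d1 + d2)%N (leq_addl _ _).
  apply: (suff_forms _ G' H' hG' hH').
  - by rewrite eG' eH'; apply: cross_ring e2; rewrite e1 ord_gh exprD.
  - by rewrite (meval_rho H' oP) eH' (evM _ _ oP) mulf_neq0.
  rewrite (meval_rho G' oP) eG' !(evM _ _ oP) (evX _ _ oP) ev_unif !mulf_eq0 (negPf s20) (negPf g'0) orbF /=.
  by case: (b); rewrite ?expr1 ?expr0 ?eqxx ?oner_eq0.
(* As x has a pole of order 2, h x^j has one of order 3 j when j = [dg h]; a form of degree j
   restricting to it does not vanish at infinity. *)
have x0 := xc_neq0 E; pose j := dg h.
have dh : dg (h * xc E ^+ j) = (3 * j)%N.
  by rewrite dgM ?crd_expf_neq0 // dgX // dg_xc -/j mulnC -mulSn.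
have dgg : (dg (g * xc E ^+ j)%R + b = 3 * j)%N.
  by rewrite -dh !dgM ?crd_expf_neq0 // ord_gh addnAC.
have hx0 : h * xc E ^+ j != 0 by rewrite crd_mul_neq0 ?crd_expf_neq0.
have gx0 : g * xc E ^+ j != 0 by rewrite crd_mul_neq0 ?crd_expf_neq0.
have [|G' hG' eG'] := @form_of_pole _ E (g * xc E ^+ j) j.
  by rewrite -dgE // -dgg leq_addr.
have [|H' hH' eH'] := @form_of_pole _ E (h * xc E ^+ j) j.
  by rewrite -dgE // dh.
apply: (suff_forms _ G' H' hG' hH').
- by rewrite eG' eH'; ring.
- by rewrite (@dg_infty _ E _ _ hH') ?eH' // dh.
apply: negb_inj; rewrite (@dg_infty _ E _ _ hG') ?eG' // -dgg.
by rewrite -[X in X == _]addn0 eqn_add2l; case: (b).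
Qed.

Definition Zpos : seq (pt L) := flatten [seq nseq (posz (V P)) P | P <- s].
Definition Zneg : seq (pt L) := flatten [seq nseq (negz (V P)) P | P <- s].

Lemma count_Zpos P : count_mem P Zpos = posz (V P).
Proof.
by apply: count_nseqs => // p0; apply: suppV; apply: contraNneq p0 => ->.
Qed.
Lemma count_Zneg P : count_mem P Zneg = negz (V P).
Proof.
by apply: count_nseqs => // p0; apply: suppV; apply: contraNneq p0 => ->.
Qed.

Lemma onc_Z (Z : seq (pt L)) (m : int -> nat) : m 0 = 0%N ->
  (forall P, count_mem P Z = m (V P)) -> all (onc EL) Z.
Proof.
move=> m0 cZ; apply/allP => P PZ; apply: oncV; apply: contraTneq PZ => VP.
by apply/count_memPn; rewrite cZ VP.
Qed.

Lemma onc_Zpos : all (onc EL) Zpos. Proof. exact: (@onc_Z _ posz erefl count_Zpos). Qed.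
Lemma onc_Zneg : all (onc EL) Zneg. Proof. exact: (@onc_Z _ negz erefl count_Zneg). Qed.

Lemma size_Zpos_Zneg : size Zpos = (size Zneg + k)%N.
Proof.
have sz (m : int -> nat) : size (flatten [seq nseq (m (V P)) P | P <- s]) =
  (\sum_(P <- s) m (V P))%N.
  by elim: (s) => [|P t IH]; rewrite ?big_nil //= size_cat size_nseq IH big_cons.
apply/eqP; rewrite -eqz_nat PoszD -degV addrC -subr_eq; apply/eqP.
rewrite /Zpos /Zneg (sz posz) (sz negz) !(big_morph Posz PoszD (erefl _)) -sumrB.
by apply: eq_bigr => P _; rewrite -posz_negz.
Qed.

Lemma frob_stable (Z : seq (pt L)) (m : pt L -> nat) :
  (forall P, count_mem P Z = m P) -> (forall P, m (map_pt (frob iota) P) = m P) ->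
  forall P : pt L, count_mem P (map (map_pt (frob iota)) Z) = count_mem P Z.
Proof.
move=> cZ fm P.
have [Q ->] : exists Q, P = map_pt (frob iota) Q.
  case: (P) => [[x y]|]; last by exists None.
  have [a <-] := frob_surj iota x; have [b <-] := frob_surj iota y.
  by exists (Some (a, b)).
rewrite cZ fm -cZ count_map; apply: eq_count => R /=.
by rewrite (inj_eq (@map_pt_inj _ (frob iota))).
Qed.

Lemma frobV' P : V (map_pt (frob iota) P) = V P.
Proof. by rewrite -[RHS]frobV; case: P => [[x y]|]. Qed.

Lemma cptp_frob P : cptp EL (map_pt (frob iota) P) = map_pt (frob iota) (cptp EL P).
Proof.
case: P => [[x y]|] //=.
by rewrite (cpt_map (frob_coef iota E) (x, y)).
Qed.

Local Notation G := (@rpt F L iota E sE sL).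

Local Notation gemb := (@emb F L iota E sE sL).

Definition rD (i : 'I_n) : G := @mkrpt F L iota E sE sL (D i) (oncD i).

Lemma rD_inj : injective rD.
Proof. by move=> i j /(congr1 val) /injD. Qed.

Lemma emb_rD i : emb (rD i) = map_pt iota (D i).
Proof. by []. Qed.

(** An effective stand-in for - V: positive coefficients are moved to the conjugate points, which
    changes the class only by multiples of infinity. *)
Local Notation Z0 := (Zneg ++ map (cptp EL) Zpos).

Lemma onc_Z0 : all (onc EL) Z0.
Proof.
rewrite all_cat onc_Zneg; apply/allP => P /mapP[Q QZ ->].
by rewrite onc_cptp (allP onc_Zpos).
Qed.

Lemma frob_Z0 P : count_mem P (map (map_pt (frob iota)) Z0) = count_mem P Z0.
Proof.
apply: (@frob_stable _ (fun P => negz (V P) + posz (V (cptp EL P)))%N) => Q.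
  by rewrite count_cat count_cptp count_Zpos count_Zneg.
by rewrite cptp_frob !frobV'.
Qed.

(** The residual point of [Z0] is the sum of [V] in the group; it is rational because [V] is stable
    under Frobenius. *)
Lemma exists_target : exists (R : G) (f : crd EL), divis f (gemb R :: Z0).
Proof.
have [R oR [f df]] := residual sL onc_Z0.
have [R0 eR] := @rational_residual F L iota E sE sL f R Z0 onc_Z0 frob_Z0 oR df.
by exists R0, f; rewrite -eR.
Qed.

(* Numerator and denominator of a function with divisor [\sum_(P in S) P - V]. *)
Lemma exists_quotient (S : {set G}) (f : crd EL) :
  divis f (gemb (\sum_(P in S) P) :: Z0) ->
  exists g h : crd E, divis (crd_map iota EL g) (Z0 ++ map gemb (enum S)) /\
    divis (crd_map iota EL h) (Zpos ++ map (cptp EL) Zpos).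
Proof.
move=> df; set R := \sum_(P in S) P in df.
have [f' df'] := divis_sum (enum S); rewrite big_enum -/R in df'.
have oY : all (onc EL) [:: gemb R] by rewrite /= onc_emb.
have oS : all (onc EL) (map gemb (enum S)) by apply/allP => P /mapP[Q _ ->]; apply: onc_emb.
have [|f1 df1] := divis_cancels sL (f := f * f') (Z := Z0 ++ map gemb (enum S)) oY.
  apply: divis_count (divis_cat sL df df') => P.
  have nE (Q : G) : cptp EL (gemb Q) = gemb (- Q) by rewrite -emb_neg.
  by rewrite /= nE !count_cat; congr addn; rewrite [RHS]addnCA.
have [||g dg'] := @descent _ _ iota E sL f1 _ _ _ df1.
- by rewrite all_cat onc_Z0.
- move=> P; rewrite map_cat (count_cat _ (map _ Z0)) frob_Z0 [RHS](count_cat _ Z0); congr addn.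
  by rewrite -map_comp; congr (count_mem _ _); apply: eq_map => Q; apply: frob_emb.
have [f2 df2] := divis_self sL onc_Zpos.
have [||h dh] := @descent _ _ iota E sL f2 _ _ _ df2.
- by have := onc_Z0; rewrite !all_cat onc_Zpos => /andP[].
- apply: (@frob_stable _ (fun P => posz (V P) + posz (V (cptp EL P)))%N) => P.
    by rewrite count_cat count_cptp !count_Zpos.
  by rewrite cptp_frob !frobV'.
by exists g, h.
Qed.

Lemma exists_codeword (S : {set G}) (g h : crd E) : #|S| = k ->
  S \subset [set rD i | i : 'I_n] ->
  divis (crd_map iota EL g) (Z0 ++ map gemb (enum S)) ->
  divis (crd_map iota EL h) (Zpos ++ map (cptp EL) Zpos) ->
  exists c, in_code iota W V D c /\ hweight c = (n - k)%N.
Proof.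
move=> cS SD dG dh; set ES := map gemb (enum S) in dG.
have g0 : g != 0 by have := dG.1; rewrite crd_map_eq0.
have h0 : h != 0 by have := dh.1; rewrite crd_map_eq0.
have oES : all (onc EL) ES by apply/allP => P /mapP[Q _ ->]; apply: onc_emb.
(* [divis] does not record the order at infinity. It is recovered from degrees: V has degree [k] and
   [S] has [k] elements. *)
have dgh : (dg g + negz (V None) + count_mem None ES = dg h + posz (V None))%N.
  rewrite -(dg_map iota g) -(dg_map iota h).
  have oA : all (onc EL) (Z0 ++ ES) by rewrite all_cat onc_Z0.
  rewrite (divis_dg sL oA dG).
  rewrite (divis_dg sL _ dh); last by have := onc_Z0; rewrite !all_cat onc_Zpos => /andP[].
  have := size_affs (Z0 ++ ES); have := size_affs (Zpos ++ map (cptp EL) Zpos).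
  rewrite !size_cat !size_map !count_cat !count_cptp !count_Zpos count_Zneg -cardE cS.
  rewrite /cptp /= size_Zpos_Zneg.
  move: (size (affs (Zpos ++ _))) (size (affs (_ ++ ES))) (size Zneg) (negz _) (posz _) =>
    a b m p q.
  move: (count_mem _ _) => t.
  by clear; lia.
have locA P : oncv EL P ->
    (ordc P (crd_map iota EL g) + posz (V (Some P)) =
     ordc P (crd_map iota EL h) + negz (V (Some P)) + count_mem (Some P) ES)%N.
  move=> oP; rewrite dG.2 // dh.2 // !count_cat !count_cptp !count_Zpos count_Zneg.
  move: (negz _) (posz (V (cptp EL (Some P)))) (posz (V (Some P))) (count_mem _ _) => a b e m.
  by clear; lia.
pose d := (dg g + dg h)%N.
have [|G hG eG] := @form_of_pole _ E g d.
  by rewrite -dgE // (leq_trans (leq_addr (dg h) _)) // leq_pmull.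
have [|H hH eH] := @form_of_pole _ E h d.
  by rewrite -dgE // (leq_trans (leq_addl (dg g) _)) // leq_pmull.
have loc (P : pt L) : onc EL P ->
    (ordf P d (crd_map iota EL h) + negz (V P) <= ordf P d (crd_map iota EL g) + posz (V P))%N.
  case: P => [P|] oP; first by rewrite /ordf locA // leq_addr.
  rewrite /ordf !dg_map; move: dgh; rewrite /d; clear; lia.
have rr : inRR iota W V G H.
  split.
    exists d; do 2!split=> //; move/dvdW_rho; rewrite eH => h00; by rewrite h00 eqxx in h0.
  move=> P; rewrite onCurve_onc => oP m; rewrite map_weierstrass.
  have eHL : rho EL (map_mpoly iota H) = crd_map iota EL h by rewrite rho_map eH.
  have eGL : rho EL (map_mpoly iota G) = crd_map iota EL g by rewrite rho_map eG.
  have hL0 : rho EL (map_mpoly iota H) != 0 by rewrite eHL crd_map_eq0.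
  have gL0 : rho EL (map_mpoly iota G) != 0 by rewrite eGL crd_map_eq0.
  move/(ord_geE sL m oP (map_homog iota hH) hL0).1; rewrite eHL => mh.
  have := int_sub mh (loc P oP).
  case: (m%:Z - V P) => [z|z] //= /(_ z erefl) hz.
  by apply: (ord_geE sL z oP (map_homog iota hG) gL0).2; rewrite eGL.
have countES i : count_mem (map_pt iota (D i)) ES = (rD i \in S).
  rewrite -emb_rD count_uniq_mem ?map_inj_uniq ?enum_uniq //; try exact: emb_inj.
  by rewrite mem_map ?mem_enum //; apply: emb_inj.
have ev_i i : exists c, evalAt W G H (D i) c /\ (c == 0) = (rD i \in S).
  apply: (evaluation g0 h0 hG hH eG eH (oncD i)).
  have := countES i; have := VD i; have := oncD i.
  case: (D i) => [[x y]|] oP VP cP; last by move: dgh; rewrite VP -cP /= addn0 addn0 => ->.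
  have oP' : oncv E (x, y) by [].
  have oPL : oncv EL (apt iota (x, y)) by rewrite (oncv_map (erefl EL)).
  have := locA _ oPL; rewrite [V _]VP /= !addn0.
  rewrite (ordc_map (erefl EL) sE sL oP' g0) (ordc_map (erefl EL) sE sL oP' h0) => ->.
  by rewrite -cP.
have [c hc] := fin_all_exists ev_i.
exists c; split; first by exists G, H; split=> // i; have [] := hc i.
have cz : #|[pred i | c i == 0]| = k.
  rewrite -cS -(card_imset _ rD_inj); apply: eq_card => P; apply/imsetP/idP.
    by case=> i; rewrite inE (hc i).2 => iS ->.
  by move=> PS; have /imsetP[i _ eP] := subsetP SD _ PS; exists i; rewrite ?inE ?(hc i).2 -?eP.
rewrite /hweight -[in RHS](card_ord n) -(cardC [pred i | c i == 0]) cz addKn.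
by apply: eq_card.
Qed.

End Code.

Theorem theorem1p2 (F : finFieldType) (L : closedFieldType)
  (iota : {rmorphism F -> L}) (a1 a2 a3 a4 a6 : F)
  (n k : nat) (D : 'I_n -> pt F) (V : pt L -> int) (s : seq (pt L)) :
  (64 < #|F|)%N ->
  wdisc a1 a2 a3 a4 a6 != 0 ->
  injective D ->
  (forall i, onCurve (weierstrass a1 a2 a3 a4 a6) (D i)) ->
  (#|F|.+2 <= n)%N ->
  (3 < k)%N -> (k < #|F|.-1)%N ->
  is_divisor iota (weierstrass a1 a2 a3 a4 a6) V s ->
  divisor_deg V s = k%:Z ->
  (forall i, V (map_pt iota (D i)) = 0) ->
  min_dist_eq iota (weierstrass a1 a2 a3 a4 a6) V D (n - k).
Proof.
move=> q64 nz injD onD qn k3 kq [us supV onV frV] degV VD.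
pose E := Wc a1 a2 a3 a4 a6.
have sE : smooth E by apply: smooth_wdisc.
have sL : smooth (wmap iota E).
  apply: smooth_wdisc; rewrite [wdisc _ _ _ _ _](_ : _ = iota (wdisc a1 a2 a3 a4 a6)).
    by rewrite fmorph_eq0.
  by rewrite /wdisc /=; ring.
have oncD i : onc E (D i).
  have := onD i; case: (D i) => [P|] // oP.
  exact: etrans (esym (onCurveE E P)) oP.
have oncV P : V P != 0 -> onc (wmap iota E) P.
  by move/onV; rewrite (onCurve_onc iota E P).
split; last first.
  by move=> c; apply: (code_weight sE sL injD oncD us supV oncV degV VD).
have [R [f df]] := exists_target sE sL us supV oncV frV.
pose A := [set rD sE sL oncD i | i : 'I_n].
have cA : #|A| = n by rewrite card_imset ?card_ord //; apply: rD_inj.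
have [||||S [SA cS sS]] := @subset_sum _ A _ k R.
(* Here n >= q + 2 is used exactly: 2 (q + 2) = (2 q + 1) + 3. *)
- rewrite cA; apply: leq_trans (_ : #|F|.*2.+1 + 3 <= n.*2)%N;
  first by rewrite leq_add2r card_rpt.
  by move: qn; clear; lia.
- by rewrite cA; move: q64 qn; clear; lia.
- exact: k3.
(* The bound k < q - 1 gives k + 4 <= q + 2 <= n. *)
- by rewrite cA; move: q64 kq qn; clear; lia.
rewrite -sS in df.
have [g [h [dg dh]]] := exists_quotient us supV oncV frV df.
have [c [inc wc]] := exists_codeword injD us supV oncV degV VD cS SA dg dh.
exists c; split=> //; split=> //.
have : (0 < hweight c)%N by rewrite wc; move: q64 kq qn; clear; lia.
by case/card_gt0P => i ci; exists i.
Qed.
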